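(* Let $\theta,\ell\in\{1,2\}$ and $\nu\in(0,2)$. Let $X$ be a stationary, isotropic Gaussian random field on $\mathbb R^2$ with covariance function $K(\mathbf x,\mathbf y)=\tilde K(\mathbf x-\mathbf y)$ of the form described in the context, with smoothness parameter $\nu$. Let $\Omega\subset\mathbb R^2$ be an open set containing $[0,1]^2$ and let $\tilde\varphi=(\varphi_1,\varphi_2):\Omega\to\mathbb R^2$ be a $C^2(\Omega)$ diffeomorphism (as defined in the context). Let $\bar V_{\theta,\ell}$ be the second-order quadratic variation based on the observations of $X$ at the points $\tilde\varphi(i_1/n,i_2/n)$, $1\le i_1,i_2\le n$, defined in the context. Suppose that the function $\mathcal J_{\nu,\ell}(\cdot,\cdot)$ defined in the context is not identically $0$ on $[0,1]^2$. Then, as $n\to\infty$, $$E(\bar V_{\theta,\ell})\sim\bar f_{\theta,\ell}(\nu)\asymp n^{4-2\nu}.$$ In addition, let $\Delta=\{(\varphi_1(u,v),\varphi_2(u,v))':0\le u,v\le1\}$ and suppose that (i) $\tilde K^{(a_1,a_2)}(\cdot)$ is a continuous function on an open set containing $\{\mathbf x-\mathbf y:\mathbf x,\mathbf y\in\Delta,\ \mathbf x\ne\mathbf y\}$ whenever $a_1,a_2$ are nonnegative integers such that $a_1+a_2=4$, and (ii) there exists a constant $\tilde C$ such that $|\tilde K^{(a_1,a_2)}(\mathbf x-\mathbf y)|\le\tilde C\|\mathbf x-\mathbf y\|^{2\nu-4}$ for all nonnegative integers $a_1,a_2$ with $a_1+a_2=4$ and all $\mathbf x,\mathbf y\in\Delta$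 with $\mathbf x\ne\mathbf y$. Then $$\operatorname{Var}\{\bar V_{\theta,\ell}/E(\bar V_{\theta,\ell})\}=\begin{cases}O(n^{-2}),&\text{if }\nu\in(0,3/2),\\ O\{n^{-2}\log(n)\},&\text{if }\nu=3/2,\\ O(n^{-8+4\nu}),&\text{if }\nu\in(3/2,2),\end{cases}$$ and $\bar V_{\theta,\ell}/E(\bar V_{\theta,\ell})\to1$ almost surely as $n\to\infty$.
   Context: Notation: $\|\cdot\|$ is the Euclidean norm; $\lfloor\cdot\rfloor$ is the greatest integer function; $a_n\sim b_n$ means $\lim a_n/b_n=1$; $a_n\asymp b_n$ means $0<\liminf a_n/b_n\le\limsup a_n/b_n<\infty$; $|A|$ is the determinant of a square matrix $A$. Covariance model. $X$ is a stationary, isotropic Gaussian random field on $\mathbb R^2$ with constant mean $\mu$ and covariance function $$K(\mathbf x,\mathbf y)=\operatorname{Cov}\{X(\mathbf x),X(\mathbf y)\}=\sum_{j=0}^{\lfloor\nu\rfloor}\beta_j\|\mathbf x-\mathbf y\|^{2j}+\beta_\nu^*G_\nu(\|\mathbf x-\mathbf y\|)+r(\mathbf x,\mathbf y),$$ where $\nu>0$, $\beta_\nu^*\ne0$, $\beta_0,\dots,\beta_{\lfloor\nu\rfloor}$ are constants; $r(\mathbf x,\mathbf y)=O(\|\mathbf x-\mathbf y\|^{2\nu+\tau})$ as $\|\mathbf x-\mathbf y\|\to0$ for some constant $\tau>0$; and $G_\nu:[0,\infty)\to\mathbb R$ satisfies $G_\nu(0)=0$ and, for $s>0$, $G_\nu(s)=s^{2\nu}$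 if $\nu\notin\mathbb Z$, $G_\nu(s)=s^{2\nu}\log(s)$ if $\nu\in\mathbb Z$. Write $\tilde K(\mathbf x-\mathbf y)=K(\mathbf x,\mathbf y)$ and, for $\mathbf x=(x_1,x_2)'$, $\tilde K^{(a_1,a_2)}(\mathbf x)=\frac{\partial^{a_1+a_2}}{\partial x_1^{a_1}\partial x_2^{a_2}}\tilde K(\mathbf x)$. Diffeomorphism. A $C^1(\Omega)$ diffeomorphism is a continuous invertible map $\tilde\varphi:\Omega\to\mathbb R^2$ with continuous first-order partial derivatives on $\Omega$ whose inverse has continuous first-order partial derivatives on the range of $\tilde\varphi$; a $C^2(\Omega)$ diffeomorphism is a $C^1(\Omega)$ diffeomorphism with continuous second-order mixed partial derivatives. Write $\varphi_j^{(1,0)}(u,v)=\partial\varphi_j(u,v)/\partial u$, $\varphi_j^{(0,1)}(u,v)=\partial\varphi_j(u,v)/\partial v$. Quadratic variation. For $1\le i_1,i_2\le n$ let $\mathbf x^{i_1,i_2}=(x_1^{i_1,i_2},x_2^{i_1,i_2})'=(\varphi_1(i_1/n,i_2/n),\varphi_2(i_1/n,i_2/n))'$ and $X_{i_1,i_2}=X(\mathbf x^{i_1,i_2})$. For $\theta\in\{1,2\}$ and $1\le i_1,i_2\le n-\theta$ let $$A_{\theta;i_1,i_2}=\begin{pmatrix}x_1^{i_1+\theta,i_2}-x_1^{i_1,i_2}&x_2^{i_1+\theta,i_2}-x_2^{i_1,i_2}\\ x_1^{i_1,i_2+\theta}-x_1^{i_1,i_2}&x_2^{i_1,i_2+\theta}-x_2^{i_1,i_2}\end{pmatrix},$$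 $$B_{\theta;i_1,i_2}=\begin{pmatrix}x_1^{i_1+\theta,i_2}-x_1^{i_1+\theta,i_2+\theta}&x_2^{i_1+\theta,i_2}-x_2^{i_1+\theta,i_2+\theta}\\ x_1^{i_1,i_2+\theta}-x_1^{i_1+\theta,i_2+\theta}&x_2^{i_1,i_2+\theta}-x_2^{i_1+\theta,i_2+\theta}\end{pmatrix},$$ which are invertible for all sufficiently large $n$; write $A_{\theta;i_1,i_2}^{-1}=(\alpha^{j,l}_{\theta;i_1,i_2})_{j,l=1,2}$, $B_{\theta;i_1,i_2}^{-1}=(\beta^{j,l}_{\theta;i_1,i_2})_{j,l=1,2}$. For $\ell\in\{1,2\}$ define $$\bar\nabla_{\theta,\ell}X_{i_1,i_2}=\beta^{\ell,1}_{\theta;i_1,i_2}(X_{i_1+\theta,i_2}-X_{i_1+\theta,i_2+\theta})+\beta^{\ell,2}_{\theta;i_1,i_2}(X_{i_1,i_2+\theta}-X_{i_1+\theta,i_2+\theta})-\alpha^{\ell,1}_{\theta;i_1,i_2}(X_{i_1+\theta,i_2}-X_{i_1,i_2})-\alpha^{\ell,2}_{\theta;i_1,i_2}(X_{i_1,i_2+\theta}-X_{i_1,i_2}),$$ and let $c^{k_1,k_2}_{\theta,\ell;i_1,i_2}$, $0\le k_1,k_2\le1$, be the resulting coefficients: $\bar\nabla_{\theta,\ell}X_{i_1,i_2}=\sum_{0\le k_1,k_2\le1}c^{k_1,k_2}_{\theta,\ell;i_1,i_2}X_{i_1+\theta k_1,i_2+\theta k_2}$. Define $$\bar V_{\theta,\ell}=\sum_{1\le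 i_1,i_2\le n-\theta}(\bar\nabla_{\theta,\ell}X_{i_1,i_2})^2,$$ $$\bar f_{\theta,\ell}(\nu)=\beta_\nu^*\sum_{1\le i_1,i_2\le n-\theta}\ \sum_{\substack{0\le k_1,l_1,k_2,l_2\le1\\(k_1,k_2)\ne(l_1,l_2)}}c^{k_1,k_2}_{\theta,\ell;i_1,i_2}c^{l_1,l_2}_{\theta,\ell;i_1,i_2}G_\nu(\|\mathbf x^{i_1+\theta k_1,i_2+\theta k_2}-\mathbf x^{i_1+\theta l_1,i_2+\theta l_2}\|),\quad\nu\in(0,2).$$ The function $\mathcal J_{\nu,\ell}:[0,1]^2\to\mathbb R$ is (all derivatives evaluated at $(u,v)$; $\ell^c=2$ if $\ell=1$, $\ell^c=1$ if $\ell=2$) $$\mathcal J_{\nu,\ell}(u,v)=\frac{\{\varphi_{\ell^c}^{(0,1)}-\varphi_{\ell^c}^{(1,0)}\}^2}{\{\varphi_1^{(1,0)}\varphi_2^{(0,1)}-\varphi_1^{(0,1)}\varphi_2^{(1,0)}\}^2}\Bigl\{-2G_\nu\Bigl(\Bigl[\sum_{j=1}^2(\varphi_j^{(0,1)})^2\Bigr]^{1/2}\Bigr)-2G_\nu\Bigl(\Bigl[\sum_{j=1}^2(\varphi_j^{(1,0)})^2\Bigr]^{1/2}\Bigr)$$ $$\qquad+G_\nu\Bigl(\Bigl[\sum_{j=1}^2\{\varphi_j^{(1,0)}+\varphi_j^{(0,1)}\}^2\Bigr]^{1/2}\Bigr)+G_\nu\Bigl(\Bigl[\sum_{j=1}^2\{\varphi_j^{(0,1)}-\varphi_j^{(1,0)}\}^2\Bigr]^{1/2}\Bigr)\Bigr\}.$$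 For all $n$ the observations come from the same realization of $X$. *)

(* Defs.v *)
From HB Require Import structures.
From mathcomp Require Import all_boot all_order all_algebra.
From mathcomp Require Import all_classical all_reals all_analysis.
From mathcomp Require Import ring.

Set Implicit Arguments.
Unset Strict Implicit.
Unset Printing Implicit Defensive.

Import Order.TTheory GRing.Theory Num.Theory.
Import numFieldNormedType.Exports.

Local Open Scope classical_set_scope.
Local Open Scope ring_scope.

(* The library norm on 'rV[R]_2 is the max norm, which induces the same
   topology. *)
Definition enorm (R : realType) (x : 'rV[R]_2) : R :=
  Num.sqrt (\sum_(j < 2) x 0 j ^+ 2).

Definition pt (R : realType) (u v : R) : 'rV[R]_2 :=
  \row_(j < 2) (if j == 0 then u else v).

Definition unit_square (R : realType) : set 'rV[R]_2 :=
  [set p | forall j, 0 <= p 0 j <= 1].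

Definition Gnu (R : realType) (nu s : R) : R :=
  if s == 0 then 0
  else if nu \is a Num.int then s `^ (2 * nu) * ln s
  else s `^ (2 * nu).

(* Partial derivatives; coordinates are numbered from 0, so that [pderiv a b f]
   is d^(a+b) f / dx_1^a dx_2^b, differentiating in x_2 first. *)
Definition partial (R : realType) (j : 'I_2) (f : 'rV[R]_2 -> R) :
    'rV[R]_2 -> R := fun x => 'D_(delta_mx 0 j) f x.

Definition pderiv (R : realType) (a b : nat) (f : 'rV[R]_2 -> R) :
    'rV[R]_2 -> R := iter a (partial 0) (iter b (partial 1) f).

(* ['D_v f] is a total operator, so existence has to be asserted at each
   differentiation step. *)
Definition has_partial (R : realType) (U : set 'rV[R]_2) (j : 'I_2)
    (f : 'rV[R]_2 -> R) : Prop :=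
  forall x, U x -> derivable f x (delta_mx 0 j).

Definition has_pderiv (R : realType) (U : set 'rV[R]_2) (a b : nat)
    (f : 'rV[R]_2 -> R) : Prop :=
  (forall k, (k < b)%N -> has_partial U 1 (pderiv 0 k f)) /\
  (forall k, (k < a)%N -> has_partial U 0 (pderiv k b f)).

(* Only used on open sets [U]. *)
Definition continuous_on (R : realType) (W : topologicalType)
    (U : set 'rV[R]_2) (f : 'rV[R]_2 -> W) : Prop :=
  forall x, U x -> {for x, continuous f}.

Definition comp_fun (R : realType) (phi : 'rV[R]_2 -> 'rV[R]_2) (j : 'I_2) :
    'rV[R]_2 -> R := fun x => phi x 0 j.

Definition C1_partials (R : realType) (U : set 'rV[R]_2)
    (phi : 'rV[R]_2 -> 'rV[R]_2) : Prop :=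
  forall i j : 'I_2, has_partial U i (comp_fun phi j) /\
    continuous_on U (partial i (comp_fun phi j)).

(* A map on [Om] is represented by a total function of which only the values
   on [Om] matter.  The range of a continuous injection of an open subset of
   the plane is open (invariance of domain), so the clause [open (phi @` Om)]
   excludes nothing; it is what makes partial derivatives of the inverse on
   the range meaningful. *)
Definition C1_diffeo (R : realType) (Om : set 'rV[R]_2)
    (phi : 'rV[R]_2 -> 'rV[R]_2) : Prop :=
  [/\ continuous_on Om phi, C1_partials Om phi, open (phi @` Om) &
    exists psi : 'rV[R]_2 -> 'rV[R]_2,
      (forall x, Om x -> psi (phi x) = x) /\ C1_partials (phi @` Om) psi].

Definition C2_diffeo (R : realType) (Om : set 'rV[R]_2)
    (phi : 'rV[R]_2 -> 'rV[R]_2) : Prop :=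
  C1_diffeo Om phi /\
  forall i k j : 'I_2, i != k ->
    has_partial Om i (partial k (comp_fun phi j)) /\
    continuous_on Om (partial i (partial k (comp_fun phi j))).

Section RandomField.
Context (R : realType) (d : measure_display) (T : measurableType d)
  (P : probability T R).

(* Normal law, possibly degenerate ([normal_prob m 0] is not the Dirac mass
   at [m] in the library). *)
Definition gaussian_rv (Y : T -> R) : Prop :=
  (exists m s : R, 0 < s /\
     forall A : set R, measurable A -> P (Y @^-1` A) = normal_prob m s A) \/
  (exists m : R,
     forall A : set R, measurable A -> P (Y @^-1` A) = \d_m A).

Definition gaussian_field (X : 'rV[R]_2 -> {RV P >-> R}) : Prop :=
  forall (k : nat) (t : 'I_k -> 'rV[R]_2) (a : 'I_k -> R),
    gaussian_rv (fun w => \sum_(i < k) a i * X (t i) w).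

Definition has_mean_cov (X : 'rV[R]_2 -> {RV P >-> R}) (mu : R)
    (K : 'rV[R]_2 -> 'rV[R]_2 -> R) : Prop :=
  (forall x, 'E_P[X x]%E = mu%:E) /\
  (forall x y, covariance P (X x) (X y) = (K x y)%:E).

End RandomField.

Definition stationary_cov (R : realType) (K : 'rV[R]_2 -> 'rV[R]_2 -> R)
    (Kt : 'rV[R]_2 -> R) : Prop := forall x y, K x y = Kt (x - y).

Definition isotropic_cov (R : realType) (K : 'rV[R]_2 -> 'rV[R]_2 -> R) : Prop :=
  exists k : R -> R, forall x y, K x y = k (enorm (x - y)).

(* [Num.truncn nu] is the integer part of [nu >= 0] as a natural number.  The
   bound on [r] includes [x = y], where it says [r x x = 0] (no nugget). *)
Definition cov_model (R : realType) (nu : R) (beta : nat -> R) (bstar : R)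
    (K : 'rV[R]_2 -> 'rV[R]_2 -> R) : Prop :=
  bstar != 0 /\
  exists (tau : R) (r : 'rV[R]_2 -> 'rV[R]_2 -> R),
    [/\ 0 < tau,
        (exists C delta : R, 0 < delta /\ forall x y,
           enorm (x - y) < delta ->
           `|r x y| <= C * enorm (x - y) `^ (2 * nu + tau)) &
        forall x y, K x y =
          \sum_(j < (Num.truncn nu).+1) beta j * enorm (x - y) ^+ (2 * j)
          + bstar * Gnu nu (enorm (x - y)) + r x y].

Section QuadraticVariation.
Context (R : realType) (phi : 'rV[R]_2 -> 'rV[R]_2) (theta : nat) (l : 'I_2)
  (n : nat).

Definition grid (i1 i2 : nat) : 'rV[R]_2 :=
  phi (pt (i1%:R / n%:R) (i2%:R / n%:R)).

Definition Amx (i1 i2 : nat) : 'M[R]_2 :=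
  \matrix_(i < 2) (if i == 0 then grid (i1 + theta) i2 - grid i1 i2
                   else grid i1 (i2 + theta) - grid i1 i2).

Definition Bmx (i1 i2 : nat) : 'M[R]_2 :=
  \matrix_(i < 2)
    (if i == 0 then grid (i1 + theta) i2 - grid (i1 + theta) (i2 + theta)
     else grid i1 (i2 + theta) - grid (i1 + theta) (i2 + theta)).

(* The superscript index l in {1, 2} is the ordinal [l : 'I_2] in {0, 1}. *)
Definition nabla (Y : nat -> nat -> R) (i1 i2 : nat) : R :=
  let al := invmx (Amx i1 i2) l in
  let be := invmx (Bmx i1 i2) l in
  be 0 * (Y (i1 + theta)%N i2 - Y (i1 + theta)%N (i2 + theta)%N)
  + be 1 * (Y i1 (i2 + theta)%N - Y (i1 + theta)%N (i2 + theta)%N)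
  - al 0 * (Y (i1 + theta)%N i2 - Y i1 i2)
  - al 1 * (Y i1 (i2 + theta)%N - Y i1 i2).

(* Coefficients of [nabla]; see [nablaE]. *)
Definition ccoef (i1 i2 : nat) (k : bool * bool) : R :=
  let al := invmx (Amx i1 i2) l in
  let be := invmx (Bmx i1 i2) l in
  match k with
  | (false, false) => al 0 + al 1
  | (true, false) => be 0 - al 0
  | (false, true) => be 1 - al 1
  | (true, true) => - (be 0 + be 1)
  end.

Lemma nablaE (Y : nat -> nat -> R) (i1 i2 : nat) :
  nabla Y i1 i2 = \sum_(k : bool * bool)
    ccoef i1 i2 k * Y (i1 + theta * k.1)%N (i2 + theta * k.2)%N.
Proof.
rewrite (eq_bigr (fun k : bool * bool => (fun a b => ccoef i1 i2 (a, b) *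
  Y (i1 + theta * a)%N (i2 + theta * b)%N) k.1 k.2)); last by case.
rewrite -(pair_bigA _ (fun a b => ccoef i1 i2 (a, b) *
  Y (i1 + theta * a)%N (i2 + theta * b)%N)) /=.
rewrite !big_bool /= !muln0 !muln1 !addn0 /nabla /=.
ring.
Qed.

Definition Vbar (d : measure_display) (T : measurableType d)
    (P : probability T R) (X : 'rV[R]_2 -> {RV P >-> R}) (w : T) : R :=
  \sum_(1 <= i1 < (n - theta).+1) \sum_(1 <= i2 < (n - theta).+1)
    nabla (fun j1 j2 => X (grid j1 j2) w) i1 i2 ^+ 2.

Definition fbar (bstar nu : R) : R :=
  bstar * \sum_(1 <= i1 < (n - theta).+1) \sum_(1 <= i2 < (n - theta).+1)
    \sum_(k : bool * bool) \sum_(m : bool * bool | k != m)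
      ccoef i1 i2 k * ccoef i1 i2 m *
      Gnu nu (enorm (grid (i1 + theta * k.1) (i2 + theta * k.2)
                     - grid (i1 + theta * m.1) (i2 + theta * m.2))).

End QuadraticVariation.

(* [rev_ord l] is the other index. *)
Definition Jfun (R : realType) (phi : 'rV[R]_2 -> 'rV[R]_2) (nu : R) (l : 'I_2)
    (u v : R) : R :=
  let du j := pderiv 1 0 (comp_fun phi j) (pt u v) in
  let dv j := pderiv 0 1 (comp_fun phi j) (pt u v) in
  (dv (rev_ord l) - du (rev_ord l)) ^+ 2
  / (du 0 * dv 1 - dv 0 * du 1) ^+ 2
  * (- 2 * Gnu nu (Num.sqrt (\sum_(j < 2) dv j ^+ 2))
     - 2 * Gnu nu (Num.sqrt (\sum_(j < 2) du j ^+ 2))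
     + Gnu nu (Num.sqrt (\sum_(j < 2) (du j + dv j) ^+ 2))
     + Gnu nu (Num.sqrt (\sum_(j < 2) (dv j - du j) ^+ 2))).

Section Asymptotics.
Context (R : realType).

Definition asym_equiv (a b : nat -> R) : Prop :=
  (fun n => a n / b n) @ \oo --> (1 : R).

Definition same_order (a b : nat -> R) : Prop :=
  (0 < limn_einf (fun n => (a n / b n)%:E))%E /\
  (limn_esup (fun n => (a n / b n)%:E) < +oo)%E.

(* Extended-real valued left-hand side: the bound entails that [u] is
   eventually finite. *)
Definition bigO_seq (u : nat -> \bar R) (v : nat -> R) : Prop :=
  exists C : R, \forall n \near \oo, (`|u n| <= (C * `|v n|)%:E)%E.

End Asymptotics.

(* Main.v *)
Require Import Defs.
From HB Require Import structures.
From mathcomp Require Import all_boot all_order all_algebra.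
From mathcomp Require Import all_classical all_reals all_analysis.
From mathcomp Require Import measurable_realfun.
From mathcomp Require Import ring lra zify.

Set Implicit Arguments.
Unset Strict Implicit.
Unset Printing Implicit Defensive.

Import Order.TTheory GRing.Theory Num.Theory.
Import numFieldNormedType.Exports.

Local Open Scope classical_set_scope.
Local Open Scope ring_scope.

(** The quadratic variation is the sum of the squares of contrasts of the field
    over the cells of a grid of mesh size [h = theta / n]. Its expectation is
    the sum of their variances, and its variance is governed by the squares of
    their covariances.

    Local limits. The weights of a contrast annihilate affine functions of the
    four corners ([coef_affine]), so the quadratic form of a contrast kills the
    constant and the squared distance in the covariance ([quad_model]). For the
    same reason the logarithm produced by scaling [Gnu] at [nu = 1] drops out
    ([quad_Gnu_scale]), and the form applied to [Gnu] scales with the exponent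
    [2 * nu - 2] of [h]. Strict differentiability of the diffeomorphism lets a
    shrinking cell converge to a parallelogram, so the scaled form converges
    to [2 * Jfun] ([scaled_quad_cvg]), jointly in the mesh point and the mesh
    size; by compactness of the square the resulting bounds are uniform in the
    mesh point ([compact_uniform_bound]).

    Expectation. What the remainder of the covariance adds to the variance of a
    contrast is smaller by a factor [h `^ tau] ([cell_quad_model]), which bounds
    the difference of the expectation and [fbar]. For the order of
    magnitude from below, variances are nonnegative, so [bstar * Jfun] cannot be
    negative; where [Jfun] does not vanish it is positive ([bstar_Jfun_gt0]),
    and near such a point a positive proportion of the [n ^+ 2] cells have
    variances of exact order [h `^ (2 * nu - 2)] ([sum_cell_quad_lower]).

    Covariances. The product of two affine contrasts annihilates every cubic
    polynomial in the difference of the points, because a monomial of degree at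
    most three is affine in one of them ([affine_contrasts_taylor3]). The fourth
    derivatives of the covariance then bound the covariance of two contrasts
    that are [k] grid steps apart by a multiple of
    [n `^ (2 - 2 * nu) * k.+1 `^ (2 * nu - 4)] ([increment_cov_decay]). A shell
    of radius [k] has [O(k)] points, so the sum of the squared covariances is
    controlled by the sum of [k.+1 `^ (4 * nu - 7)] over [k < n]; the three
    regimes of the variance are those of this sum ([variance_regimes]).

    Gaussian part. Centred combinations of the field have the moments of
    centred normal variables. Polarising the moment recursion gives integration
    by parts for polynomials in them ([stein_identity]), whence the variance of a
    sum of squares is twice the sum of the squared covariances
    ([sumsq_variance]), and its central moments of even order decay
    geometrically in the relative standard deviation ([sumsq_moment_le]). This
    deviation has a polynomial rate for every [nu < 2]
    ([square_sum_rate]), so moments of sufficiently high order are summable and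
    the relative error tends to zero almost surely ([moment_ae_cvg0]). *)

(** * Moments of normal variables *)

Section NormalMoments.
Context {R : realType}.
Local Notation mu := (@lebesgue_measure R).
Implicit Types m s x : R.

Lemma ge0_integral_normal_prob m s f :
  (forall x, 0 <= f x)%E -> measurable_fun [set: R] f ->
  (\int[normal_prob m s]_x f x = \int[mu]_x (f x * (normal_pdf m s x)%:E))%E.
Proof.
move=> f0 mf; have dom := normal_prob_dominates m s.
have mpdf : measurable_fun [set: R] (fun x => (normal_pdf m s x)%:E).
  by apply/measurableT_comp => //; exact: measurable_normal_pdf.
rewrite -(Radon_Nikodym_SigmaFinite.change_of_variables dom)//.
apply: ae_eq_integral => //; try exact: emeasurable_funM.
- apply: emeasurable_funM => //; apply: (measurable_int mu).
  exact: Radon_Nikodym_SigmaFinite.f_integrable.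
- apply: ae_eqe_mul2l; apply: integral_ae_eq => //=.
  + exact: Radon_Nikodym_SigmaFinite.f_integrable.
  + by move=> E _ mE; rewrite -Radon_Nikodym_SigmaFinite.f_integral.
Qed.

Lemma expX_le_fact_expR (u : R) k : 0 <= u -> u ^+ k <= k`!%:R * expR u.
Proof.
move=> u0; rewrite -ler_pdivrMl ?ltr0n ?fact_gt0// mulrC.
case: k => [|k]; first by rewrite expr0 divr1 -expR0 ler_expR.
by apply: le_trans (expR_ge1Dxn k u0); rewrite lerDr.
Qed.

(** A power of [x - m] costs only a doubling of the variance: half of the
    exponent absorbs it, since [u ^+ k <= k`! * expR u]. *)
Lemma even_moment_normal_fun m s k x : s != 0 ->
  (x - m) ^+ (2 * k) * normal_fun m s x <=
  (s ^+ 2 * 4) ^+ k * k`!%:R * normal_fun m (Num.sqrt 2 * s) x.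
Proof.
move=> s0; have s2 : 0 < s ^+ 2 by rewrite exprn_even_gt0.
pose u := (x - m) ^+ 2 / (s ^+ 2 * 4).
have u0 : 0 <= u by rewrite divr_ge0 ?sqr_ge0// mulr_ge0// ltW.
have E1 : normal_fun m s x = expR (- u) * expR (- u).
  rewrite /normal_fun -expRD; congr expR; rewrite /u -mulNr mulNr -mulNr.
  by field.
have E2 : normal_fun m (Num.sqrt 2 * s) x = expR (- u).
  rewrite /normal_fun exprMn sqr_sqrtr//; congr expR; rewrite /u.
  by field.
have E3 : (x - m) ^+ (2 * k) = (s ^+ 2 * 4) ^+ k * u ^+ k.
  by rewrite exprM -exprMn; congr (_ ^+ _); rewrite /u; field.
have c0 : 0 <= (s ^+ 2 * 4) ^+ k by rewrite exprn_ge0// mulr_ge0// ltW.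
rewrite E1 E2 E3 -mulrA -[leRHS]mulrA ler_wpM2l// mulrA ler_pM2r ?expR_gt0//.
rewrite expRN ler_pdivrMr ?expR_gt0//; exact: expX_le_fact_expR.
Qed.

Lemma even_moment_normal_pdf m s k : 0 < s -> exists2 C : R, 0 <= C &
  forall x, (x - m) ^+ (2 * k) * normal_pdf m s x <=
    C * normal_pdf m (Num.sqrt 2 * s) x.
Proof.
move=> s0; have s2 : Num.sqrt 2 * s != 0 by rewrite gt_eqF// mulr_gt0// sqrtr_gt0.
exists ((s ^+ 2 * 4) ^+ k * k`!%:R *
   (normal_peak s / normal_peak (Num.sqrt 2 * s))) => [|x].
  by rewrite !mulr_ge0 ?invr_ge0 ?normal_peak_ge0 ?exprn_ge0// ?mulr_ge0// ltW.
rewrite !normal_pdfE ?(gt_eqF s0)// mulrCA -mulrA -[X in _ <= _ * X]mulrA.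
rewrite mulKf ?gt_eqF ?normal_peak_gt0//.
rewrite [leRHS]mulrCA ler_wpM2l ?normal_peak_ge0//.
by apply: even_moment_normal_fun; rewrite gt_eqF.
Qed.

Lemma measurable_moment_normal m s k :
  measurable_fun [set: R] (fun x => ((x - m) ^+ k * normal_pdf m s x)%:E).
Proof.
apply/measurable_EFinP/measurable_funM; last exact: measurable_normal_pdf.
by apply: measurable_funX; apply: measurable_funB.
Qed.

Lemma integrable_moment_normal m s k : 0 < s ->
  mu.-integrable setT (fun x => ((x - m) ^+ k * normal_pdf m s x)%:E).
Proof.
move=> s0; have [C C0 HC] := even_moment_normal_pdf m k s0.
apply: (@le_integrable _ _ _ mu _ measurableT _
  (fun x => (normal_pdf m s x)%:E +
    C%:E * (normal_pdf m (Num.sqrt 2 * s) x)%:E)%E).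
- exact: measurable_moment_normal.
- move=> x _ /=; rewrite lee_fin; have p0 := normal_pdf_ge0 m s x.
  have q0 := normal_pdf_ge0 m (Num.sqrt 2 * s) x.
  rewrite normrM (ger0_norm p0) [leRHS]ger0_norm ?addr_ge0 ?mulr_ge0//.
  apply: le_trans (_ : (1 + (x - m) ^+ (2 * k)) * normal_pdf m s x <= _); last first.
    by rewrite mulrDl mul1r lerD2l HC.
  rewrite ler_wpM2r// mulnC exprM normrX -real_normK ?num_real// normrX.
  set t := _ ^+ k; have t0 : 0 <= t by exact: exprn_ge0.
  nra.
- apply: integrableD => //; first exact: integrable_normal_pdf.
  by apply: integrableZl => //; exact: integrable_normal_pdf.
Qed.

Lemma is_derive_moment_normal m s k x : s != 0 ->
  is_derive x 1 (fun y => (y - m) ^+ k * normal_pdf m s y)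
    (k%:R * ((x - m) ^+ k.-1 * normal_pdf m s x)
     - (s ^+ 2)^-1 * ((x - m) ^+ k.+1 * normal_pdf m s x)).
Proof.
move=> s0; rewrite normal_pdfE//.
pose c := - (s ^+ 2 *+ 2)^-1.
have d1 : is_derive x 1 (fun y : R => y - m) 1.
  by apply: is_derive_eq; rewrite subr0.
have d2 : is_derive x 1 (fun y : R => (y - m) ^+ k) (k%:R * (x - m) ^+ k.-1).
  have := @is_deriveX R _ (fun y : R => y - m) k x 1 1 d1.
  by rewrite exprfctE /GRing.scale /= mulr1.
have d3 : is_derive x 1 (fun y : R => c * (y - m) ^+ 2) (c * (2 * (x - m))).
  have d5 := @is_deriveX R _ (fun y : R => y - m) 2 x 1 1 d1.
  have := @is_deriveZ R _ _ _ c x 1 _ d5.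
  by rewrite exprfctE /GRing.scale /= expr1 mulr1.
have d4 : is_derive x 1 (expR \o (fun y => c * (y - m) ^+ 2))
   (c * (2 * (x - m)) * expR (c * (x - m) ^+ 2)).
  by rewrite mulrC; exact: is_derive1_comp.
have e y : normal_fun m s y = expR (c * (y - m) ^+ 2).
  by rewrite /normal_fun; congr expR; rewrite /c; field.
have d6 := is_deriveZ (normal_peak s) d4.
have := is_deriveM d2 d6.
have -> : (fun y => (y - m) ^+ k * (normal_peak s * normal_fun m s y)) =
  (fun y : R => (y - m) ^+ k) * (normal_peak s \*: (expR \o (fun y : R => c * (y - m) ^+ 2))).
  by apply/funext => y /=; rewrite e.
move=> d7; apply: (is_derive_eq d7); rewrite /= /GRing.scale/= e [(x - m) ^+ k.+1]exprS.
by rewrite /c; field.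
Qed.

Definition normal_moment m s k : R :=
  \int[mu]_x ((x - m) ^+ k * normal_pdf m s x).

Lemma moment_normal_bounded m s k : 0 < s -> exists2 C : R, 0 <= C &
  forall x, `|x - m| ^+ k * normal_pdf m s x <= C.
Proof.
move=> s0; have [C C0 HC] := even_moment_normal_pdf m k s0.
have s2 : Num.sqrt 2 * s != 0 by rewrite gt_eqF// mulr_gt0// sqrtr_gt0.
exists (normal_peak s + C * normal_peak (Num.sqrt 2 * s)) => [|x].
  by rewrite addr_ge0 ?mulr_ge0 ?normal_peak_ge0.
have p0 := normal_pdf_ge0 m s x.
apply: le_trans (_ : (1 + (x - m) ^+ (2 * k)) * normal_pdf m s x <= _).
  rewrite ler_wpM2r// mulnC exprM -real_normK ?num_real// normrX.
  set t := _ ^+ k; have t0 : 0 <= t by exact: exprn_ge0.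
  nra.
rewrite mulrDl mul1r lerD ?normal_pdf_ub ?gt_eqF//.
by apply: le_trans (HC x) _; rewrite ler_wpM2l// normal_pdf_ub.
Qed.

Lemma moment_normal_cvg0 m s k (e : R) : 0 < s -> `|e| = 1 ->
  (fun n : nat => (m + e * n.+1%:R - m) ^+ k * normal_pdf m s (m + e * n.+1%:R))
    @ \oo --> (0 : R).
Proof.
move=> s0 e1; have [C C0 HC] := moment_normal_bounded m k.+1 s0.
apply: norm_cvg0; apply: (@squeeze_cvgr _ _ _ _ (fun=> 0) (fun n => C * harmonic n)).
- near=> n; rewrite normr_ge0/= normrM normrX (ger0_norm (normal_pdf_ge0 _ _ _)).
  have en : `|m + e * n.+1%:R - m| = n.+1%:R.
    by rewrite addrAC subrr add0r normrM e1 mul1r ger0_norm.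
  rewrite en /= ler_pdivlMr// mulrAC -exprSr.
  by have := HC (m + e * n.+1%:R); rewrite en.
- exact: cvg_cst.
- by rewrite -[X in _ --> X](mulr0 C); apply: cvgM; [exact: cvg_cst|exact: cvg_harmonic].
Unshelve. all: by end_near. Qed.

(** Integration by parts: the derivative of [(x - m) ^+ k * normal_pdf m s x]
    has integral zero because the boundary values vanish in the limit. *)
Lemma normal_moment_rec m s k : 0 < s ->
  normal_moment m s k.+1 = k%:R * s ^+ 2 * normal_moment m s k.-1.
Proof.
move=> s0.
pose F x := (x - m) ^+ k * normal_pdf m s x.
pose f x := k%:R * ((x - m) ^+ k.-1 * normal_pdf m s x)
     - (s ^+ 2)^-1 * ((x - m) ^+ k.+1 * normal_pdf m s x).
have dF x : is_derive x 1 F (f x) by apply: is_derive_moment_normal; rewrite gt_eqF.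
have i1 : mu.-integrable setT (fun x => (k%:R * ((x - m) ^+ k.-1 * normal_pdf m s x))%:E).
  under eq_fun do rewrite EFinM.
  by apply: integrableZl => //; exact: integrable_moment_normal.
have i2 : mu.-integrable setT (fun x => ((s ^+ 2)^-1 * ((x - m) ^+ k.+1 * normal_pdf m s x))%:E).
  under eq_fun do rewrite EFinM.
  by apply: integrableZl => //; exact: integrable_moment_normal.
have intf : mu.-integrable setT (EFin \o f) by exact: (integrableB _ i1 i2).
pose I n : set R := [set` `[m + (-1) * n.+1%:R, m + 1 * n.+1%:R]].
have cf : continuous f.
  move=> x; apply: cvgB; (apply: cvgM; first exact: cvg_cst);
    (apply: cvgM; last by apply: continuous_normal_pdf; rewrite gt_eqF);
    by apply: (@cvg_comp _ _ _ (fun x => x - m) (fun x => x ^+ _));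
      [apply: cvgB; [exact: cvg_id|exact: cvg_cst]|exact: exprn_continuous].
have cF : continuous F.
  by move=> x; apply: differentiable_continuous; apply/derivable1_diffP; case: (dF x).
have FTC n : (\int[mu]_(x in I n) (f x)%:E = (F (m + 1 * n.+1%:R) - F (m + (-1) * n.+1%:R))%:E)%E.
  rewrite EFinB; apply: continuous_FTC2.
  - by rewrite ltrD2l mul1r mulN1r gtrN.
  - exact: continuous_subspaceT.
  - split => [x _| |]; first by case: (dF x).
    + exact/cvg_at_right_filter/cF.
    + exact/cvg_at_left_filter/cF.
  - by move=> x _; rewrite derive1E; case: (dF x).
have cvgI : (fun n => \int[mu]_(x in I n) (f x)%:E)%E @ \oo --> (\int[mu]_x (f x)%:E)%E.
  under eq_fun do rewrite integral_mkcond.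
  have [] // := @dominated_convergence _ _ _ mu setT measurableT
    (fun n => (EFin \o f) \_ (I n)) (EFin \o f) (abse \o (EFin \o f)).
  - move=> n; apply/(measurable_restrict _ _ _) => //; first exact: measurable_itv.
    by rewrite setTI; apply: measurable_funTS; exact: measurable_int intf.
  - exact: measurable_int intf.
  - apply: aeW => x _; apply: cvg_near_cst; near=> n.
    rewrite patchE ifT// inE /I/= in_itv/= mul1r mulN1r -ler_distl.
    apply: ltW; apply: lt_le_trans (_ : n%:R <= _); last by rewrite ler_nat.
    by near: n; exact: nbhs_infty_gtr.
  - exact: integrable_abse.
  - apply: aeW => x n _ /=; rewrite patchE; case: ifP => // _.
    by rewrite -[point]/(0%E) abse0 lee_fin.
have f0 : (\int[mu]_x (f x)%:E = 0)%E.
  apply: (cvg_unique _ cvgI) => //.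
  have cvgF : (fun n => F (m + 1 * n.+1%:R) - F (m + (-1) * n.+1%:R)) @ \oo --> (0 : R).
    rewrite -[X in _ --> X](subrr (0 : R)).
    by apply: cvgB; apply: moment_normal_cvg0; rewrite ?normrN ?normr1.
  have -> : (fun n => \int[mu]_(x in I n) (f x)%:E)%E =
      EFin \o (fun n => F (m + 1 * n.+1%:R) - F (m + (-1) * n.+1%:R)).
    by apply/funext => n; rewrite FTC.
  by apply: cvg_EFin => //; near=> n.
move: f0; under eq_integral do rewrite EFinB.
rewrite integralB//; under eq_integral do rewrite EFinM.
rewrite integralZl//; last exact: integrable_moment_normal.
under [X in (_ - X)%E]eq_integral do rewrite EFinM.
rewrite integralZl//; last exact: integrable_moment_normal.
rewrite /normal_moment /Rintegral.
have /(_ measurableT) := integrable_fin_num _ (integrable_moment_normal m k.+1 s0).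
have /(_ measurableT) := integrable_fin_num _ (integrable_moment_normal m k.-1 s0).
case: (\int[mu]_x _)%E => // a _; case: (\int[mu]_x _)%E => // b _.
rewrite -!EFinM -EFinB => -[]/eqP; rewrite subr_eq0 => /eqP E.
rewrite /= -mulrA mulrCA E mulrA mulfV ?mul1r//.
by rewrite expf_neq0// gt_eqF.
Unshelve. all: by end_near. Qed.

End NormalMoments.

Section GaussianMoments.
Context {R : realType} {d : measure_display} {T : measurableType d}
  (P : probability T R).
Implicit Types Y : T -> R.

(** Change of variables through the law of [Y]. The law is given by its values
    on measurable sets, as in [gaussian_rv], and not as a pushforward measure. *)
Lemma integrable_law (d' : measure_display) (U : measurableType d') (Y : T -> U)
    (Q : {measure set U -> \bar R}) (g : U -> R) :
  measurable_fun [set: T] Y -> measurable_fun [set: U] g ->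
  (forall A : set U, measurable A -> P (Y @^-1` A) = Q A) ->
  Q.-integrable setT (EFin \o g) ->
  P.-integrable setT (EFin \o (g \o Y)) /\
  (\int[P]_w (g (Y w)) = \int[Q]_x g x)%R.
Proof.
move=> mY mg YQ ig.
have PQ (h : U -> \bar R) : measurable_fun [set: U] h -> (forall x, 0 <= h x)%E ->
    (\int[P]_w h (Y w) = \int[Q]_x h x)%E.
  move=> mh h0; rewrite -(ge0_integral_pushforward mY P measurableT mh)//.
  by apply: eq_measure_integral => A mA _; rewrite -YQ.
have mgE : measurable_fun [set: U] (EFin \o g) by exact/measurable_EFinP.
have i : P.-integrable setT (EFin \o (g \o Y)).
  apply/integrableP; split; first by apply/measurable_EFinP; exact: measurableT_comp.
  rewrite (PQ (fun x => `|(g x)%:E|%E))//; first by case/integrableP: ig.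
  exact: measurableT_comp.
split => //; rewrite /Rintegral; congr fine.
rewrite integralE [RHS]integralE -!PQ//.
- rewrite (_ : (fun x => (g (Y x))%:E) = (EFin \o g) \o Y)//.
  by rewrite funepos_comp funeneg_comp.
- exact: measurable_funeneg.
- exact: measurable_funepos.
Qed.

Lemma integrable_normal_prob (m s : R) (g : R -> R) : measurable_fun [set: R] g ->
  (@lebesgue_measure R).-integrable setT (fun x => (g x * normal_pdf m s x)%:E) ->
  (normal_prob m s).-integrable setT (EFin \o g) /\
  (\int[normal_prob m s]_x (g x) = \int[@lebesgue_measure R]_x (g x * normal_pdf m s x))%R.
Proof.
move=> mg ig; have mgE : measurable_fun [set: R] (EFin \o g) by exact/measurable_EFinP.
have i : (normal_prob m s).-integrable setT (EFin \o g).
  apply/integrableP; split => //.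
  rewrite ge0_integral_normal_prob//; last exact: measurableT_comp.
  case/integrableP: ig => _; under eq_integral do rewrite EFinM abseM.
  under eq_integral do rewrite [X in (_ * X)%E]gee0_abs ?lee_fin ?normal_pdf_ge0//.
  by [].
split => //; rewrite /Rintegral; congr fine.
rewrite integralE [RHS]integralE !ge0_integral_normal_prob//; last 2 first.
- exact: measurable_funeneg.
- exact: measurable_funepos.
congr (_ - _)%E; apply: eq_integral => x _.
- by rewrite !funeposE -!EFin_max -EFinM maxr_pMl ?normal_pdf_ge0// mul0r.
- by rewrite !funenegE -!EFinN -!EFin_max -EFinM maxr_pMl ?normal_pdf_ge0// mul0r mulNr.
Qed.

(** A degenerate law obeys the recursion of the normal moments with variance
    [v = 0], so that the two cases of [gaussian_rv] need not be told apart
    afterwards. *)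
Lemma gaussian_rv_moments Y : measurable_fun setT Y -> gaussian_rv P Y ->
  exists m v : R,
  (forall k, P.-integrable setT (EFin \o (fun w => (Y w - m) ^+ k))) /\
  (forall k, (\int[P]_w ((Y w - m) ^+ k.+1) =
     k%:R * v * \int[P]_w ((Y w - m) ^+ k.-1))%R).
Proof.
move=> mY.
have mp m k : measurable_fun [set: R] (fun x : R => (x - m) ^+ k).
  by apply: measurable_funX; apply: measurable_funB.
case=> [[m [s [s0 law]]]|[m law]].
- have N k := integrable_normal_prob (mp m k) (integrable_moment_normal m k s0).
  have L k := @integrable_law _ (measurableTypeR R) Y (normal_prob m s) _ mY (mp m k) law (N k).1.
  exists m, (s ^+ 2); split => k; first exact: (L k).1.
  rewrite (L k.+1).2 (L k.-1).2 (N k.+1).2 (N k.-1).2.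
  exact: normal_moment_rec.
- have N k : (\d_m : {measure set R -> \bar R}).-integrable setT (EFin \o (fun x : R => (x - m) ^+ k)).
    apply/integrableP; split; first exact/measurable_EFinP.
    rewrite integral_dirac//; first by rewrite diracT mul1e ltry.
    by apply: measurableT_comp => //; exact/measurable_EFinP.
  have L k := @integrable_law _ R Y \d_m _ mY (mp m k) law (N k).
  exists m, 0; split => k; first exact: (L k).1.
  rewrite (L k.+1).2 mulr0 mul0r /Rintegral integral_dirac//.
    by rewrite diracT mul1e /= subrr expr0n.
  exact/measurable_EFinP.
Qed.

End GaussianMoments.

(** * Gaussian integration by parts *)

Section Interpolation.
Context {R : realType}.

(** Inverting a Vandermonde matrix yields weights that recover one coefficient
    of a polynomial of degree at most [n] from its values at [0, ..., n]. *)
Lemma interpolation_weights n (b : 'I_n.+1) : exists w : 'I_n.+1 -> R,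
  forall j : 'I_n.+1, \sum_i w i * (i%:R) ^+ j = (j == b)%:R.
Proof.
pose V := Vandermonde n.+1 (\row_(i < n.+1) (i%:R : R)).
have uV : V \in unitmx.
  rewrite unitmxE det_Vandermonde unitfE; apply/prodf_neq0 => i _.
  apply/prodf_neq0 => j ij; rewrite !mxE subr_eq0 eqr_nat.
  by rewrite neq_ltn ij orbT.
exists (fun i => (invmx V *m delta_mx b (0 : 'I_1)) i 0) => j.
have /matrixP/(_ j 0) := mulKVmx uV (delta_mx b (0 : 'I_1)).
rewrite !mxE eqxx andbT => <-; apply: eq_bigr => i _.
by rewrite mulrC; congr (_ * _); rewrite !mxE.
Qed.

(** Polarisation: [(u + i v) ^+ (a + b)] is a polynomial in [i], and the
    weights isolate its coefficient of degree [b]. *)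
Lemma monomial_interpolation a b : exists w : 'I_(a + b).+1 -> R,
  forall u v : {poly R},
    \sum_i w i *: (u + i%:R *: v) ^+ (a + b) = u ^+ a * v ^+ b.
Proof.
have [w Hw] := @interpolation_weights (a + b) (inord b).
pose C : R := 'C(a + b, b)%:R.
have C0 : C != 0 by rewrite pnatr_eq0 -lt0n bin_gt0 leq_addl.
exists (fun i => C^-1 * w i) => u v.
transitivity (C^-1 *: \sum_(j < (a + b).+1) (\sum_i w i * i%:R ^+ j) *:
    ((u ^+ (a + b - j) * v ^+ j) *+ 'C(a + b, j))).
  rewrite scaler_sumr.
  under [RHS]eq_bigr do rewrite scaler_suml scaler_sumr.
  rewrite exchange_big /=; apply: eq_bigr => i _.
  rewrite exprDn scaler_sumr; apply: eq_bigr => j _.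
  rewrite [(_ *: v) ^+ j]exprZn -scalerAr -!scalerMnr !scalerA.
  by rewrite mulrA.
rewrite (bigD1 (inord b : 'I_(a + b).+1))//= [X in _ + X]big1 => [|j jb]; last first.
  by rewrite Hw (negbTE jb) scale0r.
rewrite Hw eqxx scale1r addr0 inordK ?ltnS ?leq_addl// addnK.
by rewrite -scaler_nat scalerA mulVf// scale1r.
Qed.

Lemma poly_ext (p q : {poly R}) : (forall t, p.[t] = q.[t]) -> p = q.
Proof.
move=> pq; apply/eqP; rewrite -subr_eq0; apply/eqP.
pose rs : seq R := [seq i%:R | i <- iota 0 (size (p - q))].
apply: (@roots_geq_poly_eq0 _ _ rs); last by rewrite size_map size_iota.
  by apply/allP => t _; rewrite rootE hornerD hornerN pq subrr.
by rewrite map_inj_uniq ?iota_uniq// => i j /eqP; rewrite eqr_nat => /eqP.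
Qed.

End Interpolation.

Definition mean {R : realType} {d : measure_display} {T : measurableType d}
  (P : probability T R) (F : T -> R) : R := (\int[P]_w F w)%R.

Lemma mean_cst {R : realType} {d : measure_display} {T : measurableType d}
  (P : probability T R) (c : R) : mean P (fun=> c) = c.
Proof.
rewrite /mean Rintegral_cst// [X in fine X](_ : _ = 1%E) ?mulr1//.
exact: probability_setT.
Qed.

Section Wick.
Context {R : realType} {d : measure_display} {T : measurableType d}
  (P : probability T R) (L : set (T -> R)).
Local Notation Ex := (mean P).
Implicit Types F G X Y Z : T -> R.

(** [L] is a space of centred, jointly Gaussian variables: every combination
    is in [L] and has the moments of a centred normal law. *)
Hypothesis L_lin : forall c Y Z, L Y -> L Z -> L (fun w => Y w + c * Z w).
Hypothesis L_int : forall Y k, L Y ->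
  P.-integrable setT (EFin \o (fun w => Y w ^+ k)).
Hypothesis L_mom : forall Y k, L Y ->
  Ex (fun w => Y w ^+ k.+1) = k%:R * Ex (fun w => Y w ^+ 2) * Ex (fun w => Y w ^+ k.-1).

Local Notation integ F := (P.-integrable setT (EFin \o F)).

Lemma integ_lin c F G : integ F -> integ G -> integ (fun w => F w + c * G w).
Proof.
move=> iF iG; have := integrableD measurableT iF (integrableZl measurableT c iG).
by apply: eq_integrable.
Qed.

Lemma Ex_lin c F G : integ F -> integ G ->
  Ex (fun w => F w + c * G w) = Ex F + c * Ex G.
Proof.
move=> iF iG; rewrite /mean RintegralD// ?RintegralZl//.
by have := integrableZl measurableT c iG; apply: eq_integrable.
Qed.

Lemma integ_sum I (r : seq I) (p : pred I) (c : I -> R) (F : I -> T -> R) :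
  (forall i, integ (F i)) -> integ (fun w => \sum_(i <- r | p i) c i * F i w).
Proof.
move=> iF; elim: r => [|i r IH].
  by under eq_fun do rewrite big_nil; exact: integrable0.
under eq_fun do rewrite big_cons; case: (p i) => //.
under eq_fun do rewrite addrC.
exact: integ_lin.
Qed.

Lemma Ex_sum I (r : seq I) (p : pred I) (c : I -> R) (F : I -> T -> R) :
  (forall i, integ (F i)) ->
  Ex (fun w => \sum_(i <- r | p i) c i * F i w) = \sum_(i <- r | p i) c i * Ex (F i).
Proof.
move=> iF; elim: r => [|i r IH].
  rewrite big_nil /mean; under eq_Rintegral do rewrite big_nil.
  by rewrite /Rintegral integral0.
rewrite big_cons /mean; under eq_Rintegral do rewrite big_cons.
case: (p i) => //; under eq_Rintegral do rewrite addrC.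
by rewrite -/(mean P _) Ex_lin ?IH 1?addrC//; exact: integ_sum.
Qed.

Lemma le_Ex F G : integ F -> integ G -> (forall w, F w <= G w) -> Ex F <= Ex G.
Proof. by move=> iF iG FG; apply: le_Rintegral. Qed.

Lemma L_meas Y : L Y -> measurable_fun setT Y.
Proof.
by move=> /(L_int 1)/(measurable_int P)/measurable_EFinP.
Qed.

Lemma integ_monomial Y Z a b : L Y -> L Z -> integ (fun w => Y w ^+ a * Z w ^+ b).
Proof.
move=> LY LZ; have mY := L_meas LY; have mZ := L_meas LZ.
apply: (@le_integrable _ _ _ P _ measurableT _
  (EFin \o (fun w => Y w ^+ (2 * a) + 1 * Z w ^+ (2 * b)))).
- by apply/measurable_EFinP/measurable_funM; exact: measurable_funX.
- move=> w _ /=; rewrite lee_fin mul1r ![(2 * _)%N]mulnC !exprM.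
  set y := _ ^+ a; set z := _ ^+ b.
  rewrite [leRHS]ger0_norm ?addr_ge0 ?sqr_ge0// ler_norml.
  by apply/andP; split; nra.
- by apply: integ_lin; exact: L_int.
Qed.

(** Comparing the coefficients of [t] in the moment recursion of [Y + t X]
    polarises it; the mixed moment that remains on the right-hand side is of
    lower order. *)
Lemma stein_pow X Y k : L X -> L Y ->
  Ex (fun w => X w * Y w ^+ k) =
  k%:R * Ex (fun w => X w * Y w) * Ex (fun w => Y w ^+ k.-1).
Proof.
move=> LX LY.
pose M a b := Ex (fun w => Y w ^+ a * X w ^+ b).
pose p n : {poly R} := \poly_(j < n.+1) (M (n - j)%N j *+ 'C(n, j)).
have pE n t : (p n).[t] = Ex (fun w => (Y w + t * X w) ^+ n).
  rewrite horner_poly.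
  pose c (j : 'I_n.+1) := t ^+ j *+ 'C(n, j).
  have -> : (fun w => (Y w + t * X w) ^+ n) =
      (fun w => \sum_(j < n.+1) c j * (Y w ^+ (n - j) * X w ^+ j)).
    apply/funext => w; rewrite exprDn; apply: eq_bigr => j _.
    by rewrite /c exprMn mulrCA mulrnAl.
  rewrite Ex_sum => [|j]; last exact: integ_monomial.
  by apply: eq_bigr => j _; rewrite /c /M mulrC mulrnAr mulrnAl.
have pM n : p n.+1 = n%:R *: (p 2 * p n.-1).
  apply: poly_ext => t; rewrite hornerZ hornerM !pE.
  by rewrite (L_mom _ (L_lin t LY LX)) mulrA.
have M0 n : M n 0 = Ex (fun w => Y w ^+ n).
  by congr mean; apply/funext => w; rewrite mulr1.
have M1 n : M n 1 = Ex (fun w => X w * Y w ^+ n).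
  by congr mean; apply/funext => w; rewrite mulrC.
rewrite -M1 -M0.
have -> : Ex (fun w => X w * Y w) = M 1 1.
  by congr mean; apply/funext => w; rewrite mulrC.
elim/ltn_ind: k => k IH.
case: k IH => [|k] IH.
  rewrite !mul0r M1; have := L_mom 0 LX; rewrite !mul0r => <-.
  by congr mean; apply/funext => w; rewrite mulr1.
have := congr1 (fun q : {poly R} => q`_1) (pM k.+1).
rewrite coefZ coefM !big_ord_recl big_ord0 /= !coef_poly /= !subn0 subn1 /=.
rewrite !bin0 !bin1 !mulr1n addr0.
have -> : (if (1 < k.+1)%N then M (k - 1)%N 1 *+ k else 0) = k%:R * M (k - 1)%N 1.
  by case: k {IH} => [|k] /=; rewrite mulr_natl.
have -> : M 2 0 * (k%:R * M (k - 1)%N 1) = k%:R * M 1 1 * M k 0.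
  case: k IH => [|k] IH /=; first by rewrite !mul0r mulr0.
  rewrite subn1 /= IH 1?ltnW// [M k.+1 0]M0 L_mom// -!M0; ring.
rewrite -[bump 0 0]/1%N -[(2 - 1)%N]/1%N -[(1 - 1)%N]/0%N -[M k.+1 1%N *+ _]mulr_natl -[_ *+ 2]mulr_natl => E.
apply: (@mulfI _ k.+2%:R); first by rewrite pnatr_eq0.
rewrite E -(natr1 k.+1) -(natr1 k); ring.
Qed.

(** [F'] is the derivative of [F] along [X], by the rule that a variable [Y]
    has derivative the mean of [X * Y]. Only combinations of powers of single
    variables are generated, since for these the integration by parts formula
    is [stein_pow]; products are recovered in [stein_pairM]. *)
Inductive stein_pair X : (T -> R) -> (T -> R) -> Prop :=
| stein_pair_pow Y k : L Y -> stein_pair X (fun w => Y w ^+ k)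
    (fun w => k%:R * Ex (fun w => X w * Y w) * Y w ^+ k.-1)
| stein_pair_lin c F F' G G' : stein_pair X F F' -> stein_pair X G G' ->
    stein_pair X (fun w => F w + c * G w) (fun w => F' w + c * G' w).

Lemma stein_pair_integ X F F' : stein_pair X F F' -> integ F /\ integ F'.
Proof.
elim=> [Y k LY|c {}F {}F' G G' _ [iF iF'] _ [iG iG']]; last by split; exact: integ_lin.
split; first exact: L_int.
have := integrableZl measurableT (k%:R * Ex (fun w => X w * Y w)) (L_int k.-1 LY).
by apply: eq_integrable.
Qed.

(** Integration by parts is linear in the pair, and [stein_pow] is the case of
    a power. *)
Lemma stein_identity X F F' : L X -> stein_pair X F F' ->
  integ (fun w => X w * F w) /\ Ex (fun w => X w * F w) = Ex F'.
Proof.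
move=> LX; elim=> [Y k LY|c {}F {}F' G G' SF [iF EF] SG [iG EG]].
  split.
    have := integ_monomial 1 k LX LY; apply: eq_integrable => //.
  rewrite stein_pow// [RHS]RintegralZl//; exact: L_int.
have e : (fun w => X w * (F w + c * G w)) = (fun w => X w * F w + c * (X w * G w)).
  by apply/funext => w; ring.
rewrite e; split; first exact: integ_lin.
have [_ iF'] := stein_pair_integ SF; have [_ iG'] := stein_pair_integ SG.
by rewrite !Ex_lin// EF EG.
Qed.

Lemma stein_pair_sum X I (r : seq I) (p : pred I) (F F' : I -> T -> R) : L X ->
  (forall i, stein_pair X (F i) (F' i)) ->
  stein_pair X (fun w => \sum_(i <- r | p i) F i w) (fun w => \sum_(i <- r | p i) F' i w).
Proof.
move=> LX SF; elim: r => [|i r IH].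
  have /= := stein_pair_lin (-1) (stein_pair_pow X 0 LX) (stein_pair_pow X 0 LX).
  congr stein_pair; apply/funext => w; rewrite big_nil; ring.
under eq_fun do rewrite big_cons; under [X in stein_pair _ _ X]eq_fun do rewrite big_cons.
case: (p i) => //.
have := stein_pair_lin 1 (SF i) IH.
by congr stein_pair; apply/funext => w; rewrite mul1r.
Qed.

(** The Leibniz rule. [monomial_interpolation] writes a product of powers as a
    combination of powers of the variables [Y + i Z]; the same identity for
    the polynomials [Y + e Y * t] and [Z + e Z * t], differentiated at zero,
    identifies the derivative. *)
Lemma stein_pairM X F F' G G' : L X -> stein_pair X F F' -> stein_pair X G G' ->
  stein_pair X (fun w => F w * G w) (fun w => F w * G' w + F' w * G w).
Proof.
move=> LX; elim=> [Y a LY|c {}F {}F' H H' SF IHF SH IHH] SG; last first.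
  have := stein_pair_lin c (IHF SG) (IHH SG).
  by congr stein_pair; apply/funext => w; ring.
elim: SG => [Z b LZ|c {}G {}G' H H' SG IHG SH IHH]; last first.
  have := stein_pair_lin c IHG IHH.
  by congr stein_pair; apply/funext => w; ring.
have [v Hv] := @monomial_interpolation R a b.
pose e Y := Ex (fun w => X w * Y w).
pose N (i : 'I_(a + b).+1) w := Y w + i%:R * Z w.
have LN i : L (N i) by exact: L_lin.
have SN i := stein_pair_pow X (a + b) (LN i).
have L0 : L (fun w => X w + -1 * X w) by exact: L_lin.
have S0 : stein_pair X (fun=> 0) (fun=> 0).
  have /= := stein_pair_lin (-1) (stein_pair_pow X 0 LX) (stein_pair_pow X 0 LX).
  by congr stein_pair; apply/funext => w; ring.
have := stein_pair_sum (index_enum _) xpredT LX (fun i => stein_pair_lin (v i) S0 (SN i)).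
have eN i : e (N i) = e Y + i%:R * e Z.
  rewrite /e -Ex_lin; last 2 first.
  - by have := integ_monomial 1 1 LX LY; apply: eq_integrable.
  - by have := integ_monomial 1 1 LX LZ; apply: eq_integrable.
  by congr mean; apply/funext => w; rewrite /N; ring.
congr stein_pair; apply/funext => w.
- have /(congr1 (horner_eval 0)) := Hv (Y w)%:P (Z w)%:P.
  rewrite /horner_eval !hornerE horner_sum => <-.
  by apply: eq_bigr => i _; rewrite add0r !hornerE.
- have /(congr1 (fun q : {poly R} => q^`().[0])) :=
    Hv ((Y w)%:P + e Y *: 'X) ((Z w)%:P + e Z *: 'X).
  have dl (c g : R) : (c%:P + g *: 'X)^`() = g%:P.
    by rewrite derivD derivC add0r derivZ derivX alg_polyC.
  have hl (c g : R) : (c%:P + g *: 'X).[0] = c by rewrite !hornerE.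
  rewrite derivM !deriv_exp !dl hornerD !hornerM !hornerMn !hornerM !horner_exp !hl !hornerC.
  rewrite -[_ *+ a]mulr_natr -[_ *+ b]mulr_natr => E.
  transitivity (e Y * Y w ^+ a.-1 * a%:R * Z w ^+ b + Y w ^+ a * (e Z * Z w ^+ b.-1 * b%:R)).
    rewrite -E raddf_sum horner_sum; apply: eq_bigr => i _.
    rewrite /= derivZ deriv_exp derivD derivZ !dl hornerZ hornerMn hornerM horner_exp.
    rewrite !hornerD !hornerZ !hl !hornerC -[X in _ = _ * X]mulr_natr.
    rewrite hornerX mulr0 addr0 -[Ex (fun w => X w * N i w)]/(e (N i)) eN /N; ring.
  by rewrite /e; ring.
Qed.

Lemma stein_pairX X F F' n : L X -> stein_pair X F F' ->
  stein_pair X (fun w => F w ^+ n) (fun w => n%:R * F' w * F w ^+ n.-1).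
Proof.
move=> LX SF; elim: n => [|n IH].
  have := stein_pair_pow X 0 LX.
  by congr stein_pair; apply/funext => w; rewrite ?expr0//; ring.
have := stein_pairM LX SF IH.
congr stein_pair; apply/funext => w; first by rewrite exprS.
case: n {IH} => [|n] /=; first by rewrite expr0; ring.
by rewrite -(natr1 n.+1) exprS; ring.
Qed.

Section SumOfSquares.
Context (I : Type) (r : seq I) (Y : I -> T -> R) (LY : forall i, L (Y i)).

Let s i j := Ex (fun w => Y i w * Y j w).
Let W w := \sum_(i <- r) (Y i w ^+ 2 - s i i).
Let Q w := \sum_(i <- r) \sum_(j <- r) s i j * (Y i w * Y j w).

Lemma stein_pair_sumsq i :
  stein_pair (Y i) W (fun w => 2 * \sum_(j <- r) s i j * Y j w).
Proof.
have := stein_pair_sum r xpredT (LY i) (fun j =>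
  stein_pair_lin (- s j j) (stein_pair_pow (Y i) 2 (LY j)) (stein_pair_pow (Y i) 0 (LY j))).
congr stein_pair; apply/funext => w.
  by apply: eq_bigr => j _; rewrite expr0 mulr1.
rewrite mulr_sumr; apply: eq_bigr => j _.
by rewrite -/(s i j) /= expr1; ring.
Qed.

(** The derivative of [W ^+ m] along [Y i]. *)
Let G m i w := m%:R * (2 * \sum_(j <- r) s i j * Y j w) * W w ^+ m.-1.

Let GE m i w : Y i w * G m i w =
  2 * m%:R * ((\sum_(j <- r) s i j * (Y i w * Y j w)) * W w ^+ m.-1).
Proof.
have -> : \sum_(j <- r) s i j * (Y i w * Y j w) = Y i w * \sum_(j <- r) s i j * Y j w.
  by rewrite mulr_sumr; apply: eq_bigr => j _; ring.
rewrite /G; ring.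
Qed.

Lemma sumsq_step m i : [/\ integ (fun w => W w ^+ m), integ (fun w => Y i w ^+ 2 * W w ^+ m),
  integ (fun w => Y i w * G m i w) &
  Ex (fun w => Y i w ^+ 2 * W w ^+ m) =
  Ex (fun w => Y i w * G m i w) + s i i * Ex (fun w => W w ^+ m)].
Proof.
have SW := stein_pairX m (LY i) (stein_pair_sumsq i).
have [iW _] := stein_pair_integ SW.
have SY := stein_pairM (LY i) (stein_pair_pow (Y i) 1 (LY i)) SW.
have [_ iF] := stein_pair_integ SY.
have [iY EY] := stein_identity (LY i) SY.
have e1 : (fun w => Y i w * (Y i w ^+ 1 * W w ^+ m)) = (fun w => Y i w ^+ 2 * W w ^+ m).
  by apply/funext => w; rewrite expr1; ring.
have e2 : (fun w => Y i w * G m i w) = (fun w =>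
    Y i w ^+ 1 * (m%:R * (2 * \sum_(j <- r) s i j * Y j w) * W w ^+ m.-1) +
         1%:R * mean P (fun w0 : T => Y i w0 * Y i w0) * Y i w ^+ 1.-1 * W w ^+ m
    + (- s i i) * W w ^+ m).
  by apply/funext => w; rewrite /G /s /=; ring.
have iG : integ (fun w => Y i w * G m i w) by rewrite e2; exact: integ_lin.
rewrite -e1 EY; split => //.
by rewrite [in RHS]e2 Ex_lin//; ring.
Qed.

Lemma integ_quad m : integ (fun w => Q w * W w ^+ m).
Proof.
have := @integ_sum I r xpredT (fun=> (2 * m.+1%:R)^-1) (fun i w => Y i w * G m.+1 i w)
  (fun i => let: And4 _ _ h _ := sumsq_step m.+1 i in h).
congr (P.-integrable _ _); apply/funext => w /=; congr EFin.
rewrite /Q mulr_suml; apply: eq_bigr => i _.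
by rewrite GE /= mulKf// mulf_neq0// pnatr_eq0.
Qed.

Lemma integ_sumsqX m : integ (fun w => W w ^+ m).
Proof.
case Er: r => [|i r']; last by have [] := sumsq_step m i.
have -> : (fun w => W w ^+ m) = cst (0 ^+ m).
  by apply/funext => w; rewrite /W Er big_nil.
exact: finite_measure_integrable_cst.
Qed.

(** Integration by parts in one factor [Y i] of [Y i ^+ 2 * W ^+ m]:
    differentiating the other factor [Y i] gives the centring term [s i i],
    and differentiating [W ^+ m] leads to [Q]. *)
Lemma sumsq_moment_rec m :
  Ex (fun w => W w ^+ m.+1) = (2 * m%:R) * Ex (fun w => Q w * W w ^+ m.-1).
Proof.
pose S i w := Y i w ^+ 2 * W w ^+ m + (- s i i) * W w ^+ m.
have [iS iG ES] : [/\ forall i, integ (S i), forall i, integ (fun w => Y i w * G m i w) &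
    forall i, Ex (S i) = Ex (fun w => Y i w * G m i w)].
  split => i; have [iW iY iG E] := sumsq_step m i => //; first exact: integ_lin.
  by rewrite Ex_lin// E; ring.
have -> : (fun w => W w ^+ m.+1) = (fun w => \sum_(i <- r) 1 * S i w).
  apply/funext => w; rewrite exprS {1}/W mulr_suml; apply: eq_bigr => i _.
  by rewrite /S; ring.
rewrite Ex_sum// (eq_bigr (fun i => 1 * Ex (fun w => Y i w * G m i w)));
  last by move=> i _; rewrite ES.
rewrite -(Ex_sum r xpredT (fun=> 1) iG).
transitivity (Ex (fun w => 0 + (2 * m%:R) * (Q w * W w ^+ m.-1))).
  congr mean; apply/funext => w; rewrite add0r /Q mulr_suml mulr_sumr.
  by apply: eq_bigr => i _; rewrite mul1r GE.
rewrite (Ex_lin _ (F := fun=> 0)).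
- by rewrite [X in X + _](_ : _ = 0) ?add0r// /mean /Rintegral integral0.
- exact: integrable0.
- exact: integ_quad.
Qed.

Lemma sumsq_variance : Ex (fun w => W w ^+ 2) =
  2 * \sum_(i <- r) \sum_(j <- r) s i j ^+ 2.
Proof.
rewrite sumsq_moment_rec /= mulr1; congr (_ * _).
have iY i j : integ (fun w => Y i w * Y j w).
  by have := integ_monomial 1 1 (LY i) (LY j); apply: eq_integrable.
pose q i w := \sum_(j <- r) s i j * (Y i w * Y j w).
have -> : (fun w => Q w * W w ^+ 0) = (fun w => \sum_(i <- r) 1 * q i w).
  by apply/funext => w; rewrite expr0 mulr1; apply: eq_bigr => i _; rewrite mul1r.
rewrite Ex_sum => [|i]; last exact: integ_sum.
by apply: eq_bigr => i _; rewrite mul1r /q Ex_sum.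
Qed.

(** By Young's inequality [Q] is at most [t * W ^+ 2 + 2 * t * e ^+ 2], where
    [t * e] bounds the Frobenius norm of the covariance matrix. In the moment
    recursion the first term is absorbed by the left-hand side when [t] is
    small, so two more powers of [W] cost a factor of order [t * e ^+ 2]. *)
Lemma sumsq_moment_step (e t : R) q : 0 < t -> \sum_(i <- r) s i i = e ->
  \sum_(i <- r) \sum_(j <- r) s i j ^+ 2 <= t ^+ 2 * e ^+ 2 ->
  4 * (2 * q).+1%:R * t <= 1 ->
  Ex (fun w => W w ^+ (2 * q.+1)) <=
  8 * (2 * q).+1%:R * t * e ^+ 2 * Ex (fun w => W w ^+ (2 * q)).
Proof.
move=> t0 se s2 tq.
have QW w : Q w <= t * W w ^+ 2 + 2 * t * e ^+ 2.
  pose V := \sum_(i <- r) Y i w ^+ 2.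
  have WV : W w = V - e by rewrite /W sumrB se.
  have : 2 * Q w <= t^-1 * (\sum_(i <- r) \sum_(j <- r) s i j ^+ 2) + t * V ^+ 2.
    rewrite expr2 {1}/V mulr_suml !mulr_sumr -big_split/=; apply: ler_sum => i _.
    rewrite /V !mulr_sumr -big_split/=; apply: ler_sum => j _.
    set x := s i j; set y := Y i w; set z := Y j w.
    have := sqr_ge0 (x - t * (y * z)); have ti : 0 < t^-1 by rewrite invr_gt0.
    move=> h; have := mulr_ge0 (ltW ti) h.
    rewrite -subr_ge0 => h1; rewrite -subr_ge0; apply: le_trans h1 _.
    rewrite le_eqVlt; apply/orP; left; apply/eqP; field.
    by rewrite gt_eqF.
  have : t^-1 * (\sum_(i <- r) \sum_(j <- r) s i j ^+ 2) <= t * e ^+ 2.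
    by rewrite ler_pdivrMl// mulrA -expr2.
  have := mulr_ge0 (ltW t0) (sqr_ge0 (W w - e)).
  have -> : V = W w + e by rewrite WV subrK.
  nra.
have WW : (fun w => W w ^+ (2 * q.+1)) = (fun w => W w ^+ (2 * q) * W w ^+ 2).
  by apply/funext => w; rewrite -exprD mulnS addnC.
have : Ex (fun w => Q w * W w ^+ (2 * q)) <=
    t * Ex (fun w => W w ^+ (2 * q.+1)) + 2 * t * e ^+ 2 * Ex (fun w => W w ^+ (2 * q)).
  apply: le_trans (_ : Ex (fun w => (0 + t * W w ^+ (2 * q.+1)) +
     (2 * t * e ^+ 2) * W w ^+ (2 * q)) <= _).
    apply: le_Ex; first exact: integ_quad.
      apply: integ_lin; last exact: integ_sumsqX.
      by apply: integ_lin; [exact: integrable0|exact: integ_sumsqX].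
    move=> w; have h : 0 <= W w ^+ (2 * q) by rewrite exprM exprn_ge0// sqr_ge0.
    have := ler_wpM2r h (QW w); rewrite mulnS addnC exprD; nra.
  rewrite Ex_lin; last 2 first.
  - by apply: integ_lin; [exact: integrable0|exact: integ_sumsqX].
  - exact: integ_sumsqX.
  rewrite Ex_lin; [|exact: integrable0|exact: integ_sumsqX].
  by rewrite [X in X + _ + _](_ : _ = 0) ?add0r// /mean /Rintegral integral0.
have := sumsq_moment_rec (2 * q).+1.
rewrite (_ : (2 * q).+2 = 2 * q.+1)%N; last by rewrite mulnS.
rewrite /=.
have : 0 <= Ex (fun w => W w ^+ (2 * q.+1)).
  by apply: Rintegral_ge0 => w _; rewrite exprM exprn_ge0// sqr_ge0.
set A := Ex _; set B := Ex _; set C := Ex _; set m := (2 * q).+1%:R in tq *.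
move=> A0 AB BA; have m0 : 0 <= 2 * m by rewrite mulr_ge0.
have := ler_wpM2l m0 BA; have := ler_wpM2r A0 tq; nra.
Qed.

Lemma sumsq_moment_le (e t : R) p q : 0 < t -> \sum_(i <- r) s i i = e ->
  \sum_(i <- r) \sum_(j <- r) s i j ^+ 2 <= t ^+ 2 * e ^+ 2 ->
  4 * (2 * p).+1%:R * t <= 1 -> (q <= p)%N ->
  Ex (fun w => W w ^+ (2 * q)) <= (8 * (2 * p).+1%:R * t * e ^+ 2) ^+ q.
Proof.
move=> t0 se s2 tp; elim: q => [|q IH] qp.
  by rewrite muln0 expr0 (_ : (fun w => _) = (fun=> 1)) ?mean_cst.
have qp' : (2 * q).+1%:R <= (2 * p).+1%:R :> R by rewrite ler_nat ltnS leq_mul2l ltnW.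
apply: le_trans (sumsq_moment_step t0 se s2 _) _.
  apply: le_trans tp; rewrite ler_wpM2r ?(ltW t0)//.
  by rewrite ler_wpM2l.
rewrite [leRHS]exprS; apply: ler_pM; last exact/IH/ltnW.
- by rewrite mulr_ge0 ?sqr_ge0// mulr_ge0 ?(ltW t0)// mulr_ge0.
- by apply: Rintegral_ge0 => w _; rewrite exprM exprn_ge0// sqr_ge0.
- by rewrite ler_wpM2r ?sqr_ge0// ler_wpM2r ?(ltW t0)// ler_wpM2l.
Qed.

End SumOfSquares.

End Wick.

(** * Centred combinations of a Gaussian field *)

Section CenteredField.
Context {R : realType} {d : measure_display} {T : measurableType d}
  (P : probability T R) (X : 'rV[R]_2 -> {RV P >-> R}) (mu : R)
  (K : 'rV[R]_2 -> 'rV[R]_2 -> R).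
Hypotheses (hgauss : gaussian_field X) (hcov : has_mean_cov X mu K).
Local Notation Ex := (mean P).

Definition lincomb (s : seq (R * 'rV[R]_2)) (w : T) : R :=
  \sum_(p <- s) p.1 * X p.2 w.

(** With lists of weighted points, closure under combinations is
    concatenation. *)
Definition centered_lincombs : set (T -> R) :=
  [set Y | exists s, Y = (fun w => lincomb s w - \sum_(p <- s) p.1 * mu)].

Lemma measurable_lincomb s : measurable_fun setT (lincomb s).
Proof. by apply: measurable_sum => p; apply: measurable_funM. Qed.

Lemma gaussian_lincomb s : gaussian_rv P (lincomb s).
Proof.
pose p0 : R * 'rV[R]_2 := (0, 0).
have := hgauss (fun i : 'I_(size s) => (nth p0 s i).2) (fun i => (nth p0 s i).1).
congr gaussian_rv; apply/funext => w; rewrite /lincomb.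
by rewrite (big_nth p0) big_mkord.
Qed.

Lemma integrable_lincomb s : P.-integrable setT (EFin \o lincomb s).
Proof.
have [m [v [im _]]] := gaussian_rv_moments (measurable_lincomb s) (gaussian_lincomb s).
have := integ_lin m (im 1%N) (im 0%N); congr (P.-integrable _ _).
by apply/funext => w /=; rewrite expr1 expr0 mulr1 subrK.
Qed.

Lemma integrable_field x : P.-integrable setT (EFin \o X x).
Proof.
have := integrable_lincomb [:: (1, x)]; congr (P.-integrable _ _).
by apply/funext => w /=; rewrite /lincomb big_seq1 mul1r.
Qed.

Lemma mean_field x : Ex (X x) = mu.
Proof. by have [/(_ x)] := hcov; rewrite unlock /mean /Rintegral => ->. Qed.

Lemma mean_lincomb s : Ex (lincomb s) = \sum_(p <- s) p.1 * mu.
Proof.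
rewrite /lincomb (Ex_sum s xpredT (fun p => p.1)) => [|p]; last exact: integrable_field.
by apply: eq_bigr => p _; rewrite mean_field.
Qed.

Lemma centered_lincombs_lin c Y Z : centered_lincombs Y -> centered_lincombs Z ->
  centered_lincombs (fun w => Y w + c * Z w).
Proof.
move=> [s ->] [s' ->]; exists (s ++ [seq (c * p.1, p.2) | p <- s']).
apply/funext => w; rewrite /lincomb !big_cat !big_map/= mulrBr !mulr_sumr.
rewrite [X in _ = _ + X - _](eq_bigr (fun p => c * (p.1 * X p.2 w))) => [|p _]; last ring.
rewrite [X in _ = _ - (_ + X)](eq_bigr (fun p => c * (p.1 * mu))) => [|p _]; last ring.
ring.
Qed.

(** The recursion at [k = 0] forces the centre of the law to be the mean of
    the combination. *)
Lemma centered_lincombs_moments Y : centered_lincombs Y ->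
  (forall k, P.-integrable setT (EFin \o (fun w => Y w ^+ k))) /\
  (forall k, Ex (fun w => Y w ^+ k.+1) =
     k%:R * Ex (fun w => Y w ^+ 2) * Ex (fun w => Y w ^+ k.-1)).
Proof.
move=> [s ->].
have [m [v [im rm]]] := gaussian_rv_moments (measurable_lincomb s) (gaussian_lincomb s).
have m0 : m = \sum_(p <- s) p.1 * mu.
  have := rm 0%N; rewrite !mul0r -[LHS]/(Ex _).
  have -> : (fun w => (lincomb s w - m) ^+ 1) = (fun w => lincomb s w + (- m) * 1).
    by apply/funext => w; rewrite expr1 mulr1.
  rewrite Ex_lin ?mean_lincomb ?mean_cst; last 2 first.
  - exact: integrable_lincomb.
  - exact: (im 0%N).
  by rewrite mulr1 => /eqP; rewrite subr_eq0 => /eqP.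
rewrite -m0.
have ev : Ex (fun w => (lincomb s w - m) ^+ 2) = v.
  have := rm 1%N; rewrite mul1r /= -[X in X = _]/(Ex _) => ->.
  by rewrite -[X in _ * X]/(Ex _) (_ : (fun w => _) = fun=> 1) ?mean_cst ?mulr1.
by split=> // k; rewrite ev; exact: rm.
Qed.

Lemma centered_field x : centered_lincombs (fun w => X x w - mu).
Proof.
exists [:: (1, x)]; apply/funext => w.
by rewrite /lincomb !big_seq1 !mul1r.
Qed.

Lemma integrable_cov_field x y :
  P.-integrable setT (EFin \o (fun w => (X x w - mu) * (X y w - mu))).
Proof.
have i Y k (LY : centered_lincombs Y) := (centered_lincombs_moments LY).1 k.
by have := integ_monomial i 1 1 (centered_field x) (centered_field y).
Qed.

Lemma mean_cov_field x y : Ex (fun w => (X x w - mu) * (X y w - mu)) = K x y.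
Proof.
have [m c] := hcov; have := c x y; rewrite unlock !m /= unlock.
by rewrite /mean /Rintegral => ->.
Qed.

(** The weights sum to zero, so that the unknown mean [mu] cancels. *)
Lemma mean_contrast (I : finType) (c c' : I -> R) (x y : I -> 'rV[R]_2) :
  \sum_i c i = 0 -> \sum_i c' i = 0 ->
  Ex (fun w => (\sum_i c i * X (x i) w) * (\sum_i c' i * X (y i) w)) =
  \sum_i \sum_j c i * c' j * K (x i) (y j).
Proof.
move=> c0 c'0.
have cc (a : I -> R) (z : I -> 'rV[R]_2) w : \sum_i a i = 0 ->
    \sum_i a i * X (z i) w = \sum_i a i * (X (z i) w - mu).
  move=> a0; under [RHS]eq_bigr do rewrite mulrBr.
  by rewrite sumrB -mulr_suml a0 mul0r subr0.
pose F i w := \sum_j c' j * ((X (x i) w - mu) * (X (y j) w - mu)).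
have iF i : P.-integrable setT (EFin \o F i).
  by apply: integ_sum => j; exact: integrable_cov_field.
transitivity (Ex (fun w => \sum_i c i * F i w)).
  congr mean; apply/funext => w; rewrite !cc// mulr_suml; apply: eq_bigr => i _.
  by rewrite -mulrA /F mulr_sumr; congr (_ * _); apply: eq_bigr => j _; ring.
rewrite Ex_sum//; apply: eq_bigr => i _.
rewrite /F Ex_sum => [|j]; last exact: integrable_cov_field.
by rewrite mulr_sumr; apply: eq_bigr => j _; rewrite mean_cov_field mulrA.
Qed.

Lemma contrast_centered (I : finType) (c : I -> R) (x : I -> 'rV[R]_2) :
  \sum_i c i = 0 -> centered_lincombs (fun w => \sum_i c i * X (x i) w).
Proof.
move=> c0; exists [seq (c i, x i) | i <- index_enum I].
by apply/funext => w; rewrite /lincomb !big_map -mulr_suml c0 mul0r subr0.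
Qed.

End CenteredField.

(** * Strict differentiability in the plane *)

Section Plane.
Context {R : realType}.
Implicit Types (x y z : 'rV[R]_2) (f : 'rV[R]_2 -> R).

Lemma rV2_norm x : `|x| = Num.max `|x 0 0| `|x 0 1|.
Proof.
rewrite -[LHS]/(mx_norm x) mx_normrE; apply/eqP; rewrite eq_le; apply/andP; split.
  apply/bigmax_leP; split => [|[i j] _] /=; first by rewrite le_max normr_ge0.
  rewrite ord1 le_max; case: j => -[|[|//]] hj; apply/orP; [left|right];
    by rewrite le_eqVlt; apply/orP; left; apply/eqP; congr (`|x _ _|); apply/val_inj.
rewrite ge_max; apply/andP; split.
  exact: (le_bigmax _ (fun i : 'I_1 * 'I_2 => `|x i.1 i.2|) (0, 0)).
exact: (le_bigmax _ (fun i : 'I_1 * 'I_2 => `|x i.1 i.2|) (0, 1)).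
Qed.

Lemma le_coord_norm x i : `|x 0 i| <= `|x|.
Proof.
rewrite rV2_norm le_max; case: i => -[|[|//]] hi; apply/orP; [left|right];
  by rewrite le_eqVlt; apply/orP; left; apply/eqP; congr (`|x _ _|); apply/val_inj.
Qed.

Lemma ord2P (Q : 'I_2 -> Prop) : Q 0 -> Q 1 -> forall i, Q i.
Proof.
move=> Q0 Q1 [[|[|//]] hi]; [move: Q0|move: Q1]; congr Q; exact/val_inj.
Qed.

Lemma is_derive_line f x (j : 'I_2) (s : R) :
  derivable f (x + s *: delta_mx 0 j) (delta_mx 0 j) ->
  is_derive s 1 (fun t : R => f (x + t *: delta_mx 0 j))
    (partial j f (x + s *: delta_mx 0 j)).
Proof.
move=> df.
have e : (fun h : R => h^-1 *: (((fun t : R => f (x + t *: delta_mx 0 j)) \o shift s) (h *: 1) -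
    f (x + s *: delta_mx 0 j))) =
  (fun h : R => h^-1 *: ((f \o shift (x + s *: delta_mx 0 j)) (h *: delta_mx 0 j) -
    f (x + s *: delta_mx 0 j))).
  apply/funext => h /=; congr (_ *: (f _ - _)).
  by rewrite scalerDl [h *: 1]mulr1 addrCA.
by split; rewrite /derivable /partial /derive e.
Qed.

Lemma sum_ord2 (F : 'I_2 -> R) : \sum_j F j = F 0 + F 1.
Proof. by rewrite big_ord_recl big_ord1; congr (_ + F _); exact/val_inj. Qed.

Lemma MVT_line f x (j : 'I_2) (t : R) :
  (forall k, 0 <= k <= 1 ->
     derivable f (x + (k * t) *: delta_mx 0 j) (delta_mx 0 j)) ->
  exists2 k, 0 <= k <= 1 &
    f (x + t *: delta_mx 0 j) - f x = t * partial j f (x + (k * t) *: delta_mx 0 j).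
Proof.
move=> df; pose g (k : R) := f (x + (k * t) *: delta_mx 0 j).
have dg (k : R) : 0 <= k <= 1 ->
    is_derive k 1 g (partial j f (x + (k * t) *: delta_mx 0 j) * t).
  move=> /df/is_derive_line dk.
  have dt : is_derive k 1 (fun k : R => k * t) t.
    have /= := @is_deriveM R _ (fun k : R => k) (fun=> t) k 1 1 0 _ _.
    by rewrite scaler0 add0r /GRing.scale/= mulr1; apply.
  exact: (@is_derive1_comp R (fun s : R => f (x + s *: delta_mx 0 j)) (fun k => k * t)).
have [||k k01] := @MVT_segment R g (fun k => partial j f (x + (k * t) *: delta_mx 0 j) * t) 0 1 ler01.
- by move=> k /subset_itv_oo_cc; rewrite in_itv/=; exact: dg.
- apply: derivable_within_continuous => k; rewrite in_itv/= => k01.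
  by have [] := dg k k01.
rewrite subr0 mulr1 /g mul1r mul0r scale0r addr0 mulrC => E.
by exists k => //; move: k01; rewrite in_itv.
Qed.

(** The increment is split along the two coordinates, and the mean value
    theorem evaluates each partial derivative near [y]. Both endpoints are
    free to move because the increments of interest join two corners of a cell
    close to [y], and neither has to be [y]. *)
Lemma strict_differentiability (U : set 'rV[R]_2) f y (e : R) :
  open U -> U y -> (forall j, has_partial U j f) ->
  (forall j, {for y, continuous (partial j f)}) -> 0 < e ->
  exists2 r, 0 < r & forall a b, `|a - y| < r -> `|b - y| < r ->
    `|f a - f b - \sum_j partial j f y * (a 0 j - b 0 j)| <= e * `|a - b|.
Proof.
move=> oU Uy df cf e0.
have [r r0 Hr] : exists2 r, 0 < r & forall z, `|z - y| < r ->
    U z /\ forall j, `|partial j f z - partial j f y| <= e / 2.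
  have /nbhs_ballP[r /= r0 Hr] : \forall z \near y, U z /\
      forall j, `|partial j f z - partial j f y| <= e / 2.
    have c j : \forall z \near y, `|partial j f z - partial j f y| <= e / 2.
      by have /cvgr_distC_le := cf j; apply; rewrite divr_gt0.
    have oUy : \forall z \near y, U z by exact: open_nbhs_nbhs.
    apply: filterS3 oUy (c 0) (c 1) => z Uz c0 c1; split; first exact: Uz.
    exact: (@ord2P (fun j => `|partial j f z - partial j f y| <= e / 2) c0 c1).
  exists r => // z zr; apply: Hr; rewrite -ball_normE /ball_/=.
  by rewrite distrC.
exists r => // a b ar br.
pose c := b + (a 0 0 - b 0 0) *: delta_mx 0 0 : 'rV[R]_2.
have ac : a = c + (a 0 1 - b 0 1) *: delta_mx 0 1.
  apply/rowP; apply: ord2P; rewrite !mxE /= ?mulr0 ?mulr1 ?addr0; ring.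
have in01 (k p q : R) : 0 <= k <= 1 -> `|p| < r -> `|q| < r -> `|p + k * (q - p)| < r.
  move=> /andP[k0 k1] pr qr; pose m := Num.max `|p| `|q|.
  have mr : m < r by rewrite gt_max pr.
  have : `|p| <= m by rewrite le_max lexx.
  have : `|q| <= m by rewrite le_max lexx orbT.
  rewrite !ler_norml => /andP[q1 q2] /andP[p1 p2].
  apply: le_lt_trans mr; rewrite ler_norml; apply/andP; split; nra.
have ar' j : `|a 0 j - y 0 j| < r.
  by apply: le_lt_trans ar; have := le_coord_norm (a - y) j; rewrite !mxE.
have br' j : `|b 0 j - y 0 j| < r.
  by apply: le_lt_trans br; have := le_coord_norm (b - y) j; rewrite !mxE.
have near1 k : 0 <= k <= 1 -> `|b + (k * (a 0 0 - b 0 0)) *: delta_mx 0 0 - y| < r.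
  move=> k01; rewrite rV2_norm gt_max !mxE /= mulr1 mulr0 addr0 br' andbT.
  by rewrite addrAC (_ : a 0 0 - b 0 0 = a 0 0 - y 0 0 - (b 0 0 - y 0 0)) ?in01//; ring.
have near2 k : 0 <= k <= 1 -> `|c + (k * (a 0 1 - b 0 1)) *: delta_mx 0 1 - y| < r.
  move=> k01; rewrite rV2_norm gt_max !mxE /= !mulr1 !mulr0 !addr0.
  apply/andP; split; first by rewrite (_ : _ + _ - _ = a 0 0 - y 0 0) //; ring.
  by rewrite addrAC (_ : a 0 1 - b 0 1 = a 0 1 - y 0 1 - (b 0 1 - y 0 1)) ?in01//; ring.
have [k k01 Ek] : exists2 k, 0 <= k <= 1 & f c - f b = _ :=
  MVT_line (fun k k01 => df 0 _ (Hr _ (near1 k k01)).1).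
have [k' k01' Ek'] : exists2 k', 0 <= k' <= 1 & f (c + _) - f c = _ :=
  MVT_line (fun k k01 => df 1 _ (Hr _ (near2 k k01)).1).
have -> : f a - f b = (f a - f c) + (f c - f b) by ring.
rewrite {1}ac Ek' Ek sum_ord2.
have d1 := (Hr _ (near1 k k01)).2 0; have d2 := (Hr _ (near2 k' k01')).2 1.
move: d1 d2; set D1 := partial 0 f _; set D2 := partial 1 f _.
set E1 := partial 0 f y; set E2 := partial 1 f y => d1 d2.
clearbody D1 D2 E1 E2.
have a0 := le_coord_norm (a - b) 0; have a1 := le_coord_norm (a - b) 1.
move: a0 a1; rewrite !mxE => a0 a1.
set p := a 0 0 - b 0 0 in a0 *; set q := a 0 1 - b 0 1 in a1 *.
have -> : q * D2 + p * D1 - (E1 * p + E2 * q) =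
  (D1 - E1) * p + (D2 - E2) * q by ring.
apply: le_trans (ler_normD _ _) _; rewrite !normrM.
rewrite (splitr e) mulrDl; apply: lerD; apply: ler_pM => //.
Qed.
End Plane.

(** * Diffeomorphisms along a shrinking mesh *)

Section StrictDerivative.
Context {R : realType}.
Implicit Types (x y z v w : 'rV[R]_2) (f : 'rV[R]_2 -> R).

Definition C1_at (U : set 'rV[R]_2) f y :=
  [/\ open U, U y, (forall j, has_partial U j f) &
    forall j, {for y, continuous (partial j f)}].

Lemma near_box (y : 'rV[R]_2) (r : R) : 0 < r -> \forall z \near y, `|z - y| < r.
Proof.
move=> r0; apply/nbhs_ballP; exists r => // z; rewrite -ball_normE /ball_/=.
by rewrite distrC.
Qed.

Lemma C1_at_lipschitz U f y : C1_at U f y -> exists2 C : R, 0 < C &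
  exists2 r, 0 < r & forall a b, `|a - y| < r -> `|b - y| < r ->
    `|f a - f b| <= C * `|a - b|.
Proof.
move=> [oU Uy df cf].
have [r r0 H] := strict_differentiability oU Uy df cf ltr01.
exists (1 + (`|partial 0 f y| + `|partial 1 f y|)).
  by rewrite ltr_wpDr// addr_ge0.
exists r => // a b ar br; have := H a b ar br; rewrite sum_ord2.
have := le_coord_norm (a - b) 0; have := le_coord_norm (a - b) 1; rewrite !mxE.
move: (partial 0 f y) (partial 1 f y) (a 0 0 - b 0 0) (a 0 1 - b 0 1) => D1 D2 p q hq hp h.
rewrite -[f a - f b](subrK (D1 * p + D2 * q)) mulrDl; apply: le_trans (ler_normD _ _) _.
apply: lerD => //; apply: le_trans (ler_normD _ _) _; rewrite !normrM mulrDl.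
by apply: lerD; apply: ler_wpM2l.
Qed.

(** Mesh points close to [y] together with small mesh sizes: convergence in
    both at once is what compactness turns into bounds uniform in the mesh
    point. *)
Definition mesh_filter y : set_system ('rV[R]_2 * R) :=
  filter_prod (nbhs y) (0 : R)^'+.

Global Instance mesh_filter_proper y : ProperFilter (mesh_filter y).
Proof. exact: filter_prod_proper. Qed.

Lemma cvg_mesh_filter y : (fun h : R => (y, h)) @ (0 : R)^'+ --> mesh_filter y.
Proof.
rewrite /mesh_filter.
have F1 : Filter (0 : R)^'+ by exact: at_right_proper_filter.
apply: (@cvg_pair _ _ _ _ (nbhs y) (0 : R)^'+ _ _ _ (fun=> y) id).
  exact: cvg_cst.
exact: cvg_id.
Qed.

Lemma near_mesh y v (r : R) : 0 < r ->
  \forall ph \near mesh_filter y, 0 < ph.2 /\ `|ph.1 + ph.2 *: v - y| < r.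
Proof.
move=> r0; have r2 : 0 < r / 2 by rewrite divr_gt0.
have v1 : 0 < `|v| + 1 by rewrite ltr_wpDl.
exists ([set p | `|p - y| < r / 2], [set h | 0 < h /\ h * (`|v| + 1) < r / 2]).
  split => /=; first exact: near_box.
  near=> h; split; first by near: h; exact: nbhs_right_gt.
  rewrite -ltr_pdivlMr//; near: h; apply: nbhs_right_lt.
  by rewrite divr_gt0.
move=> [p h] /= [py [h0 hv]]; split => //.
rewrite addrAC; apply: le_lt_trans (ler_normD _ _) _; rewrite normrZ gtr0_norm//.
rewrite (splitr r); apply: ltr_leD => //; apply: le_trans (ltW hv).
by rewrite ler_wpM2l ?(ltW h0)// lerDl.
Unshelve. all: by end_near. Qed.

Lemma diff_quotient_cvg U f y v w : C1_at U f y ->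
  (fun ph : 'rV[R]_2 * R => (f (ph.1 + ph.2 *: w) - f (ph.1 + ph.2 *: v)) / ph.2)
    @ mesh_filter y --> (\sum_j partial j f y * (w 0 j - v 0 j) : R).
Proof.
move=> [oU Uy df cf]; apply/cvgrPdist_le => e e0.
have w1 : 0 < `|w - v| + 1 by rewrite ltr_wpDl.
have e1 : 0 < e / (`|w - v| + 1) by rewrite divr_gt0.
have [r r0 H] := strict_differentiability oU Uy df cf e1.
apply: filterS2 (near_mesh y v r0) (near_mesh y w r0) => -[p h]/= [h0 bv] [_ bw].
have := H _ _ bw bv.
set S := \sum_j _; have -> : S = h * \sum_j partial j f y * (w 0 j - v 0 j).
  rewrite /S mulr_sumr; apply: eq_bigr => j _; rewrite !mxE; ring.
have -> : p + h *: w - (p + h *: v) = h *: (w - v).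
  by rewrite opprD addrACA subrr add0r scalerBr.
rewrite normrZ gtr0_norm// mulrCA => hh.
rewrite distrC -(ler_pM2l h0) -[X in X * `|_|](gtr0_norm h0) -normrM mulrBr.
rewrite mulrCA divff ?gt_eqF// mulr1; apply: le_trans hh _.
rewrite ler_wpM2l ?(ltW h0)// mulrAC ler_pdivrMr// ler_wpM2l ?(ltW e0)//.
by rewrite lerDl.
Unshelve. all: by end_near. Qed.

End StrictDerivative.

Section Diffeo.
Context {R : realType} (Om : set 'rV[R]_2) (phi : 'rV[R]_2 -> 'rV[R]_2).
Hypotheses (oOm : open Om) (hphi : C1_diffeo Om phi).

Lemma diffeo_C1_at y j : Om y -> C1_at Om (comp_fun phi j) y.
Proof.
move=> Oy; have [_ dphi _ _] := hphi.
by split => // i; have [d c] := dphi i j => //; exact: c.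
Qed.

Lemma diffeo_inverse : exists2 psi : 'rV[R]_2 -> 'rV[R]_2,
  (forall y, Om y -> psi (phi y) = y) &
  (forall y j, Om y -> C1_at (phi @` Om) (comp_fun psi j) (phi y)).
Proof.
have [_ _ oR [psi [psiK dpsi]]] := hphi; exists psi => // y j Oy.
have Ry : (phi @` Om) (phi y) by exists y.
by split => // i; have [d c] := dpsi i j => //; exact: c.
Qed.

Lemma norm_comp_fun (chi : 'rV[R]_2 -> 'rV[R]_2) (C : R) a b : 
  (forall j, `|comp_fun chi j a - comp_fun chi j b| <= C) -> `|chi a - chi b| <= C.
Proof.
move=> H; rewrite rV2_norm ge_max !mxE; apply/andP; split.
  exact: (H 0).
exact: (H 1).
Qed.

Lemma C1_map_lipschitz (U : set 'rV[R]_2) (chi : 'rV[R]_2 -> 'rV[R]_2) y :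
  (forall j, C1_at U (comp_fun chi j) y) -> exists2 C : R, 0 < C &
  exists2 r, 0 < r & forall a b, `|a - y| < r -> `|b - y| < r ->
    `|chi a - chi b| <= C * `|a - b|.
Proof.
move=> dchi.
have [C0 C0p [r0 r0p H0]] := C1_at_lipschitz (dchi 0).
have [C1 C1p [r1 r1p H1]] := C1_at_lipschitz (dchi 1).
exists (C0 + C1); first exact: addr_gt0.
exists (Num.min r0 r1) => [|a b]; rewrite !lt_min ?r0p//.
move=> /andP[a0 a1] /andP[b0 b1].
apply: norm_comp_fun; apply: ord2P.
  apply: le_trans (H0 a b a0 b0) _; rewrite ler_wpM2r// lerDl ltW//.
apply: le_trans (H1 a b a1 b1) _; rewrite ler_wpM2r// lerDr ltW//.
Qed.

Lemma C1_map_continuous (U : set 'rV[R]_2) (chi : 'rV[R]_2 -> 'rV[R]_2) y :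
  (forall j, C1_at U (comp_fun chi j) y) -> {for y, continuous chi}.
Proof.
move=> /C1_map_lipschitz[C C0 [r r0 H]].
suff : chi @ nbhs y --> chi y by [].
apply/cvgrPdist_le => e e0.
near=> z; rewrite distrC; apply: le_trans (H z y _ _) _.
- by near: z; exact: near_box.
- by rewrite subrr normr0.
- rewrite -ler_pdivlMl// ltW//; near: z; apply: near_box.
  by rewrite mulr_gt0// invr_gt0.
Unshelve. all: by end_near. Qed.

Lemma diffeo_continuous y : Om y -> {for y, continuous phi}.
Proof. by move=> Oy; apply: (@C1_map_continuous Om) => j; exact: diffeo_C1_at. Qed.

(** A lower bound on the increments of [phi] is a Lipschitz bound for its
    inverse. *)
Lemma diffeo_inverse_lipschitz y : Om y -> exists2 C : R, 0 < C &
  \forall a \near y & b \near y, `|a - b| <= C * `|phi a - phi b|.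
Proof.
move=> Oy; have [psi psiK dpsi] := diffeo_inverse.
have [C C0 [r r0 H]] := C1_map_lipschitz (fun j => dpsi y j Oy).
exists C => //.
have N : \forall a \near y, Om a /\ `|phi a - phi y| < r.
  apply: filterI; first exact: open_nbhs_nbhs.
  have := diffeo_continuous Oy; rewrite /prop_for /continuous_at.
  by move/cvgr_distC_lt; apply.
exists ([set a | Om a /\ `|phi a - phi y| < r], [set a | Om a /\ `|phi a - phi y| < r]) => //.
move=> [a b] /= [[Oa ar] [Ob br]].
by rewrite -{1}(psiK a Oa) -{1}(psiK b Ob); exact: H.
Qed.

Definition jacobian_det y : R :=
  partial 0 (comp_fun phi 0) y * partial 1 (comp_fun phi 1) y -
  partial 0 (comp_fun phi 1) y * partial 1 (comp_fun phi 0) y.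

(** Differentiating [psi (phi y) = y] along the axes shows that the two
    Jacobian matrices are inverse to each other. The limit of one and the same
    quotient [F] is computed in two ways, in place of a chain rule for
    functions that are only known to have partial derivatives. *)
Lemma jacobian_det_neq0 y : Om y -> jacobian_det y != 0.
Proof.
move=> Oy; have [psi psiK dpsi] := diffeo_inverse.
pose D k i := \sum_j partial j (comp_fun psi k) (phi y) * partial i (comp_fun phi j) y.
have DE k i : D k i = (k == i)%:R.
  pose F (h : R) := \sum_j partial j (comp_fun psi k) (phi y) *
     ((comp_fun phi j (y + h *: delta_mx 0 i) - comp_fun phi j y) / h).
  have near_line r : 0 < r -> \forall h \near (0 : R)^'+,
      0 < h /\ `|y + h *: delta_mx 0 i - y| < r.
    move=> r0; exact: (cvg_mesh_filter (near_mesh y (delta_mx 0 i) r0)).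
  have c1 : F @ (0 : R)^'+ --> D k i.
    have cj j : (fun h : R => (comp_fun phi j (y + h *: delta_mx 0 i) - comp_fun phi j y) / h)
        @ (0 : R)^'+ --> partial i (comp_fun phi j) y.
      have := cvg_comp _ _ (@cvg_mesh_filter R y) (diff_quotient_cvg (v := 0) (w := delta_mx 0 i) (diffeo_C1_at j Oy)).
      rewrite (bigD1 i)//= big1 => [|i' /negbTE i'i]; last by rewrite !mxE i'i subr0 mulr0.
      have -> : (delta_mx 0 i : 'rV[R]_2) 0 i - (0 : 'rV[R]_2) 0 i = 1.
        by rewrite !mxE !eqxx subr0.
      rewrite mulr1 addr0; apply: cvg_trans; apply: near_eq_cvg; near=> h.
      by rewrite /= scaler0 addr0.
    rewrite /F /D sum_ord2; under eq_fun do rewrite sum_ord2.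
    by apply: cvgD; (apply: cvgM; [exact: cvg_cst|exact: cj]).
  have c2 : F @ (0 : R)^'+ --> ((k == i)%:R : R).
    have [C C0 [r r0 Hr]] := C1_map_lipschitz (fun j => diffeo_C1_at j Oy).
    apply/cvgrPdist_le => e e0; have eC : 0 < e / C by rewrite divr_gt0.
    have [oR Ry dpsik cpsik] := dpsi y k Oy.
    have [q q0 Hq] := strict_differentiability oR Ry dpsik cpsik eC.
    have [s s0 Hs] : exists2 s, 0 < s & forall a, `|a - y| < s -> Om a.
      have /nbhs_ballP[s s0 Hs] : nbhs y Om by exact: open_nbhs_nbhs.
      exists s => // a ay; apply: Hs; rewrite -ball_normE /ball_/= distrC//.
    apply: filterS3 (near_line _ r0) (near_line _ s0) (near_line _ (divr_gt0 q0 C0)).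
    move=> h [h0 hr] [_ hs] [_ hq]; set a := y + h *: delta_mx 0 i in hr hs hq *.
    have yr : `|y - y| < r by rewrite subrr normr0.
    have lip := Hr a y hr yr.
    have ay : `|a - y| <= h.
      rewrite /a addrAC subrr add0r normrZ gtr0_norm// ler_piMr ?(ltW h0)//.
      rewrite rV2_norm ge_max !mxE; apply/andP; split; by case: (_ && _); rewrite ?normr1 ?normr0.
    have := Hq (phi a) (phi y) _ _; rewrite subrr normr0 => /(_ _ q0).
    rewrite /comp_fun psiK ?psiK//; last exact: Hs.
    have -> : a 0 k - y 0 k = h * (k == i)%:R.
      by rewrite !mxE addrAC subrr add0r eq_sym.
    set S := \sum_j _; have -> : S = h * F h.
      rewrite /F mulr_sumr; apply: eq_bigr => j _.
      by rewrite mulrCA -/a [h * _]mulrC divfK ?gt_eqF.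
    have hq' : `|phi a - phi y| < q.
      by apply: le_lt_trans lip _; rewrite mulrC -ltr_pdivlMr.
    move=> /(_ hq') H; rewrite -(ler_pM2l h0) -[X in X * `|_|](gtr0_norm h0) -normrM mulrBr.
    apply: le_trans H _; rewrite mulrAC ler_pdivrMr// -mulrA [leRHS]mulrCA ler_wpM2l ?(ltW e0)//.
    by apply: le_trans lip _; rewrite mulrC ler_wpM2r ?(ltW C0).
  exact: (cvg_unique _ c1 c2).
have e00 := DE 0 0; have e01 := DE 0 1; have e10 := DE 1 0; have e11 := DE 1 1.
have : D 0 0 * D 1 1 - D 0 1 * D 1 0 = 1.
  by rewrite e00 e01 e10 e11 /= mulr1 mulr0 subr0.
rewrite /D !sum_ord2 => E; apply/eqP => J0; move: J0 E; rewrite /jacobian_det.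
move: (partial 0 (comp_fun phi 0) y) (partial 1 (comp_fun phi 0) y)
  (partial 0 (comp_fun phi 1) y) (partial 1 (comp_fun phi 1) y) => a b c d.
move: (partial 0 (comp_fun psi 0) _) (partial 1 (comp_fun psi 0) _)
  (partial 0 (comp_fun psi 1) _) (partial 1 (comp_fun psi 1) _) => p q s t J0 E.
have : (1 : R) = (p * t - q * s) * (a * d - c * b) by rewrite -E; ring.
by rewrite J0 mulr0 => /eqP; rewrite oner_eq0.
Unshelve. all: by end_near. Qed.

End Diffeo.

(** * Affine contrasts *)

Section Contrast.
Context {R : realType}.
Implicit Types (x y z v w : 'rV[R]_2).

Lemma enorm_ge0 x : 0 <= enorm x. Proof. exact: sqrtr_ge0. Qed.

Lemma enorm_sqr x : enorm x ^+ 2 = x 0 0 ^+ 2 + x 0 1 ^+ 2.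
Proof. by rewrite /enorm sqr_sqrtr ?sum_ord2// addr_ge0 ?sqr_ge0. Qed.

Lemma enorm0 : enorm (0 : 'rV[R]_2) = 0.
Proof. by rewrite /enorm sum_ord2 !mxE expr0n addr0 sqrtr0. Qed.

Lemma norm_le_enorm x : `|x| <= enorm x.
Proof.
rewrite rV2_norm ge_max -!sqrtr_sqr /enorm sum_ord2.
by rewrite !ler_wsqrtr// ?lerDl ?lerDr sqr_ge0.
Qed.

Definition quad (I : finType) (c : I -> R) (q : I -> 'rV[R]_2)
    (F : 'rV[R]_2 -> 'rV[R]_2 -> R) : R :=
  \sum_k \sum_m c k * c m * F (q k) (q m).

(** The weights annihilate affine functions, as those of a second difference
    do. *)
Definition affine_contrast (I : finType) (c : I -> R) (q : I -> 'rV[R]_2) :=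
  \sum_k c k = 0 /\ forall j, \sum_k c k * q k 0 j = 0.

(** Expanded, the squared distance is a sum of terms each of which is affine
    in one of the two points. *)
Lemma quad_sqr_dist (I : finType) (c : I -> R) (q : I -> 'rV[R]_2) :
  affine_contrast c q -> quad c q (fun x y => enorm (x - y) ^+ 2) = 0.
Proof.
move=> [c0 c1]; rewrite /quad.
have e k : \sum_m c k * c m * enorm (q k - q m) ^+ 2 =
    c k * \sum_m (c m * (q m 0 0 ^+ 2 + q m 0 1 ^+ 2)).
  transitivity (c k * ((q k 0 0 ^+ 2 + q k 0 1 ^+ 2) * \sum_m c m
    - 2 * q k 0 0 * \sum_m c m * q m 0 0 - 2 * q k 0 1 * \sum_m c m * q m 0 1
    + \sum_m c m * (q m 0 0 ^+ 2 + q m 0 1 ^+ 2))).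
    rewrite !mulr_sumr -!sumrB -big_split/= mulr_sumr; apply: eq_bigr => m _.
    by rewrite enorm_sqr !mxE; ring.
  by rewrite c0 !c1 !mulr0 !subr0 add0r.
by under eq_bigr do rewrite e; rewrite -mulr_suml c0 mul0r.
Qed.

Lemma quad_cst (I : finType) (c : I -> R) (q : I -> 'rV[R]_2) (a : R) :
  affine_contrast c q -> quad c q (fun _ _ => a) = 0.
Proof.
move=> [c0 _]; rewrite /quad; under eq_bigr do rewrite -mulr_suml -mulr_sumr c0 mulr0 mul0r.
by rewrite big1.
Qed.

Lemma quad_lin (I : finType) (c : I -> R) (q : I -> 'rV[R]_2) (a : R) F G :
  quad c q (fun x y => F x y + a * G x y) = quad c q F + a * quad c q G.
Proof.
rewrite /quad mulr_sumr -big_split/=; apply: eq_bigr => k _.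
rewrite mulr_sumr -big_split/=; apply: eq_bigr => m _; ring.
Qed.

Lemma truncn_lt2 (nu : R) : 0 < nu < 2 ->
  Num.truncn nu = 0%N \/ Num.truncn nu = 1%N.
Proof.
move=> /andP[n0 n2].
have /andP[h _] : (Num.truncn nu)%:R <= nu < (Num.truncn nu).+1%:R.
  by rewrite truncn_itv// ltW.
have : (Num.truncn nu)%:R < 2%:R :> R by apply: le_lt_trans n2.
by rewrite ltr_nat; case: (Num.truncn nu) => [|[|]]; auto.
Qed.

(** The even polynomial part of the covariance has degree at most two because
    [nu < 2], and is therefore invisible to affine contrasts. *)
Lemma quad_model (I : finType) (c : I -> R) (q : I -> 'rV[R]_2) (nu : R)
    (beta : nat -> R) (bstar : R) (K r : 'rV[R]_2 -> 'rV[R]_2 -> R) :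
  0 < nu < 2 -> affine_contrast c q ->
  (forall x y, K x y =
     \sum_(j < (Num.truncn nu).+1) beta j * enorm (x - y) ^+ (2 * j)
     + bstar * Gnu nu (enorm (x - y)) + r x y) ->
  quad c q K = bstar * quad c q (fun x y => Gnu nu (enorm (x - y))) + quad c q r.
Proof.
move=> nu2 cq KE.
have e : quad c q (fun x y =>
    \sum_(j < (Num.truncn nu).+1) beta j * enorm (x - y) ^+ (2 * j)) = 0.
  have [->|->] := truncn_lt2 nu2.
    by rewrite (_ : (fun x y => _) = fun _ _ => beta 0%N) ?quad_cst//;
      apply/funext => x; apply/funext => y; rewrite big_ord1 expr0 mulr1.
  rewrite (_ : (fun x y => _) = fun x y => beta 0%N + beta 1%N * enorm (x - y) ^+ 2).
    by rewrite quad_lin quad_cst// quad_sqr_dist// mulr0 addr0.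
  by apply/funext => x; apply/funext => y; rewrite big_ord_recl big_ord1 expr0 mulr1.
rewrite (_ : K = fun x y => (\sum_(j < (Num.truncn nu).+1) beta j * enorm (x - y) ^+ (2 * j)
     + bstar * Gnu nu (enorm (x - y))) + 1 * r x y).
  by rewrite !quad_lin e add0r mul1r.
by apply/funext => x; apply/funext => y; rewrite KE mul1r.
Qed.

Lemma int_lt2 (nu : R) : 0 < nu < 2 -> nu \is a Num.int -> nu = 1.
Proof.
move=> /andP[n0 n2] /intrP[z zE]; move: n0 n2; rewrite zE.
rewrite -[0]/(0%:~R) -[2]/(2%:~R) !ltr_int => z0 z2.
by have -> : z = 1 by lia.
Qed.

(** [Gnu] is homogeneous up to a multiple of the square, which is present only
    for [nu = 1]. *)
Lemma Gnu_scale (nu h s : R) : 0 < nu < 2 -> 0 < h -> 0 <= s ->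
  Gnu nu (h * s) = h `^ (2 * nu) * (Gnu nu s + (if nu \is a Num.int then ln h else 0) * s ^+ 2).
Proof.
move=> nu2 h0 s0; rewrite /Gnu mulf_eq0 (gt_eqF h0)/=.
have [->|s1] := eqVneq s 0; first by rewrite expr0n mulr0 addr0 mulr0.
have sp : 0 < s by rewrite lt_neqAle eq_sym s1.
case: ifPn => [/(int_lt2 nu2) ->|_]; last by rewrite mul0r addr0 powRM// ltW.
rewrite lnM// mulr1 !powR_mulrn ?mulr_ge0 ?(ltW h0)//.
by ring.
Qed.

(** For integer [nu] the logarithm of the mesh size multiplies the squared
    distance and so drops out. *)
Lemma quad_Gnu_scale (I : finType) (c : I -> R) (q : I -> 'rV[R]_2) (nu h : R) :
  0 < nu < 2 -> 0 < h -> affine_contrast c q ->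
  quad c q (fun x y => Gnu nu (enorm (x - y))) =
  h `^ (2 * nu) * quad c q (fun x y => Gnu nu (enorm (x - y) / h)).
Proof.
move=> nu2 h0 cq; pose a := (if nu \is a Num.int then ln h else 0) / h ^+ 2.
rewrite (_ : (fun x y => Gnu nu (enorm (x - y))) = fun x y => 0 + h `^ (2 * nu) *
    (Gnu nu (enorm (x - y) / h) + a * enorm (x - y) ^+ 2)).
  by rewrite !quad_lin quad_sqr_dist// quad_cst// mulr0 addr0 add0r.
apply/funext => x; apply/funext => y; rewrite add0r.
set e := enorm (x - y); have e0 : 0 <= e / h.
  by rewrite divr_ge0 ?enorm_ge0// ltW.
have -> : Gnu nu e = Gnu nu (h * (e / h)) by rewrite mulrC divfK// gt_eqF.
rewrite (Gnu_scale nu2 h0 e0); congr (_ * (_ + _)).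
by rewrite /a; field; rewrite gt_eqF.
Qed.

End Contrast.

(** * Local limits of the contrasts of a cell *)

Section Coefficients.
Context {R : realType}.

Definition cvec (k : bool * bool) : 'rV[R]_2 := pt k.1%:R k.2%:R.

Definition corner (p : 'rV[R]_2) (h : R) k := p + h *: cvec k.

Lemma sum_bool2 (F : bool * bool -> R) :
  \sum_k F k = F (true, true) + F (true, false) + (F (false, true) + F (false, false)).
Proof.
rewrite (eq_bigr (fun k : bool * bool => F (k.1, k.2))); last by case.
by rewrite -(pair_bigA _ (fun a b => F (a, b))) /= !big_bool.
Qed.

(** [fwd_mx], [bwd_mx] and [coef] are [Amx], [Bmx] and [ccoef] as functions of
    the four corners of a cell. *)
Definition fwd_mx (q : bool * bool -> 'rV[R]_2) : 'M[R]_2 :=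
  \matrix_(i < 2) (if i == 0 then q (true, false) - q (false, false)
                   else q (false, true) - q (false, false)).

Definition bwd_mx (q : bool * bool -> 'rV[R]_2) : 'M[R]_2 :=
  \matrix_(i < 2) (if i == 0 then q (true, false) - q (true, true)
                   else q (false, true) - q (true, true)).

Definition coef (q : bool * bool -> 'rV[R]_2) (l : 'I_2) (k : bool * bool) : R :=
  let al := invmx (fwd_mx q) l in
  let be := invmx (bwd_mx q) l in
  match k with
  | (false, false) => al 0 + al 1
  | (true, false) => be 0 - al 0
  | (false, true) => be 1 - al 1
  | (true, true) => - (be 0 + be 1)
  end.

Definition det2 (A : 'M[R]_2) : R := A 0 0 * A 1 1 - A 0 1 * A 1 0.

Lemma invmx2 (A : 'M[R]_2) : det2 A != 0 -> A \in unitmx /\ forall l i,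
  invmx A l i = (if l == i then 1 else -1) * A (rev_ord i) (rev_ord l) / det2 A.
Proof.
move=> D0; have r0 : rev_ord (0 : 'I_2) = 1 by exact/val_inj.
have r1 : rev_ord (1 : 'I_2) = 0 by exact/val_inj.
pose N : 'M[R]_2 := \matrix_(l, i)
  ((if l == i then 1 else -1) * A (rev_ord i) (rev_ord l) / det2 A).
have NA : N *m A = 1%:M.
  apply/matrixP; apply: ord2P; apply: ord2P;
    by rewrite !mxE sum_ord2 !mxE ?r0 ?r1 /= /det2; field.
have [_ uA] := mulmx1_unit NA; split => // l i.
suff -> : invmx A = N by rewrite mxE.
by rewrite -[RHS]mulmx1 -(mulmxV uA) mulmxA NA mul1mx.
Qed.

(** The backward and the forward differences both recover the slope of a
    linear function in coordinate [l], and their difference cancels it. *)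
Lemma coef_affine (q : bool * bool -> 'rV[R]_2) l :
  det2 (fwd_mx q) != 0 -> det2 (bwd_mx q) != 0 -> affine_contrast (coef q l) q.
Proof.
move=> /invmx2[uA _] /invmx2[uB _]; split => [|j].
  by rewrite sum_bool2 /coef; ring.
have /matrixP/(_ l j) := mulVmx uA; have /matrixP/(_ l j) := mulVmx uB.
rewrite !mxE !sum_ord2 !mxE /= => <- E.
rewrite sum_bool2 /coef; move/eqP: E; rewrite -subr_eq0 => /eqP E.
by rewrite -[RHS]oppr0 -E; ring.
Qed.

End Coefficients.

Lemma ord2_cases (i : 'I_2) : i = 0 \/ i = 1.
Proof. by case: i => -[|[|//]] hi; [left|right]; exact/val_inj. Qed.

Lemma rev_ord2_0 : rev_ord (0 : 'I_2) = 1. Proof. exact/val_inj. Qed.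
Lemma rev_ord2_1 : rev_ord (1 : 'I_2) = 0. Proof. exact/val_inj. Qed.

Lemma Gnu_continuous {R : realType} (nu x : R) : 0 < x -> {for x, continuous (Gnu nu)}.
Proof.
move=> x0; have nx : \forall t \near x, 0 < t by apply: open_nbhs_nbhs; split; [exact: open_gt|].
have cp : {for x, continuous (fun t : R => t `^ (2 * nu))}.
  apply: differentiable_continuous; apply/derivable1_diffP.
  by have [] := is_derive1_powR (2 * nu) x0.
suff : Gnu nu @ nbhs x --> Gnu nu x by [].
case: (boolP (nu \is a Num.int)) => inu.
- have c2 : (fun t => t `^ (2 * nu) * ln t) @ nbhs x --> x `^ (2 * nu) * ln x.
    by apply: cvgM; [exact: cp|exact: continuous_ln].
  rewrite {2}/Gnu (gt_eqF x0) inu; apply: cvg_trans c2; apply: near_eq_cvg.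
  by apply: filterS nx => t t0; rewrite /Gnu (gt_eqF t0) inu.
- rewrite {2}/Gnu (gt_eqF x0) (negbTE inu); apply: cvg_trans cp; apply: near_eq_cvg.
  by apply: filterS nx => t t0; rewrite /Gnu (gt_eqF t0) (negbTE inu).
Qed.

(** Limits of the contrast coefficients along shrinking cells whose scaled
  edges converge: [d i j] is the limiting derivative of coordinate [j] in
  direction [i]. *)
Section CoefficientLimits.
Context {R : realType} {S : Type} (F : set_system S) {FF : ProperFilter F}.
Variables (q : S -> bool * bool -> 'rV[R]_2) (h : S -> R) (d : 'I_2 -> 'I_2 -> R).
Local Notation "f ~~> a" := (f @ F --> (a : R)) (at level 70).

Let dir (k m : bool * bool) j : R :=
  d 0 j * (k.1%:R - m.1%:R) + d 1 j * (k.2%:R - m.2%:R).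

Hypothesis near_h : \forall t \near F, 0 < h t.
Hypothesis q_cvg : forall k m j,
  (fun t => (q t k 0 j - q t m 0 j) / h t) ~~> dir k m j.
Let J := d 0 0 * d 1 1 - d 0 1 * d 1 0.
Hypothesis J0 : J != 0.

Lemma cvg_near_ext (f g : S -> R) (a b : R) :
  f ~~> a -> (\forall t \near F, f t = g t) -> a = b -> g ~~> b.
Proof.
by move=> fa fg <-; apply: cvg_trans fa; exact: near_eq_cvg.
Qed.

Lemma cvg_ext (f g : S -> R) (a b : R) : f ~~> a -> f =1 g -> a = b -> g ~~> b.
Proof. by move=> fa /funext <- <-. Qed.

Lemma cvg_finite_sum (I : Type) (r : seq I) (f : I -> S -> R) (a : I -> R) :
  (forall i, f i ~~> a i) ->
  (fun t => \sum_(i <- r) f i t) ~~> \sum_(i <- r) a i.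
Proof.
move=> fa; elim: r => [|i r IH].
  by rewrite big_nil; under eq_fun do rewrite big_nil; exact: cvg_cst.
rewrite big_cons; under eq_fun do rewrite big_cons.
by apply: cvgD; [exact: fa|exact: IH].
Qed.

Lemma cvg_near_bounded (f : S -> R) (a : R) : f ~~> a ->
  exists2 C : R, 0 < C & \forall t \near F, `|f t| <= C.
Proof.
move=> fa; exists (`|a| + 1); first by rewrite ltr_wpDl.
by apply: (cvgr_le _ (cvg_norm fa)); rewrite ltrDl ltr01.
Qed.

Lemma fwd_mx_cvg i j : (fun t => fwd_mx (q t) i j / h t) ~~> d i j.
Proof.
have [->|->] := ord2_cases i.
- apply: (cvg_ext (@q_cvg (true, false) (false, false) j)) => [t|].
    by rewrite !mxE /= ?mxE.
  by rewrite /dir /=; ring.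
- apply: (cvg_ext (@q_cvg (false, true) (false, false) j)) => [t|].
    by rewrite !mxE /= ?mxE.
  by rewrite /dir /=; ring.
Qed.

Lemma bwd_mx_cvg i j : (fun t => bwd_mx (q t) i j / h t) ~~> - d (rev_ord i) j.
Proof.
have [->|->] := ord2_cases i; rewrite ?rev_ord2_0 ?rev_ord2_1.
- apply: (cvg_ext (@q_cvg (true, false) (true, true) j)) => [t|].
    by rewrite !mxE /= ?mxE.
  by rewrite /dir /=; ring.
- apply: (cvg_ext (@q_cvg (false, true) (true, true) j)) => [t|].
    by rewrite !mxE /= ?mxE.
  by rewrite /dir /=; ring.
Qed.

Lemma det2_cvg (A : S -> 'M[R]_2) (N : 'M[R]_2) :
  (forall i j, (fun t => A t i j / h t) ~~> N i j) ->
  (fun t => det2 (A t) / h t ^+ 2) ~~> det2 N.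
Proof.
move=> AN.
apply: (cvg_ext (cvgB (cvgM (AN 0 0) (AN 1 1)) (cvgM (AN 0 1) (AN 1 0)))) => // t.
rewrite /det2 -exprVn.
by rewrite -[LHS]/(_ * _ - _ * _); ring.
Qed.

Let s (l i : 'I_2) : R := if l == i then 1 else -1.

Lemma invmx_cvg (A : S -> 'M[R]_2) (N : 'M[R]_2) :
  (forall i j, (fun t => A t i j / h t) ~~> N i j) -> det2 N != 0 ->
  (\forall t \near F, det2 (A t) != 0) /\
  forall l i, (fun t => h t * invmx (A t) l i) ~~>
    s l i * N (rev_ord i) (rev_ord l) / det2 N.
Proof.
move=> AN N0; have cD := det2_cvg AN.
have nD : \forall t \near F, det2 (A t) != 0.
  have nD : \forall t \near F, det2 (A t) / h t ^+ 2 != 0 by apply: cvgr_neq0 cD N0.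
  by apply: filterS nD => t; apply: contraNneq => ->; rewrite mul0r.
split => // l i.
apply: (cvg_near_ext (cvgM (cvgM (cvg_cst (s l i)) (AN (rev_ord i) (rev_ord l)))
  (cvgV N0 cD))) => //.
apply: filterS2 near_h nD => t h0 D0; have [_ ->] := invmx2 D0.
rewrite -[LHS]/(_ * _ * _^-1) /s; field.
by rewrite D0 gt_eqF.
Qed.

Let gam (l : 'I_2) := s l 0 * (d 1 (rev_ord l) - d 0 (rev_ord l)) / J.

Definition checker (k : bool * bool) : R := if k.1 == k.2 then 1 else -1.

(** A cell degenerates to a parallelogram, on which the affine contrasts are
    the multiples of the mixed second difference; hence the checkerboard of
    signs. *)
Lemma coef_cvg l :
  (\forall t \near F, affine_contrast (coef (q t) l) (q t)) /\
  forall k, (fun t => h t * coef (q t) l k) ~~> gam l * checker k.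
Proof.
pose M : 'M[R]_2 := \matrix_(i, j) d i j.
pose M' : 'M[R]_2 := \matrix_(i, j) - d (rev_ord i) j.
have dM : det2 M = J by rewrite /det2 !mxE.
have dM' : det2 M' = - J by rewrite /det2 !mxE rev_ord2_0 rev_ord2_1 /J; ring.
have cM i j : (fun t => fwd_mx (q t) i j / h t) ~~> M i j.
  by rewrite mxE; exact: fwd_mx_cvg.
have cM' i j : (fun t => bwd_mx (q t) i j / h t) ~~> M' i j.
  by rewrite mxE; exact: bwd_mx_cvg.
have nJ : - J != 0 by rewrite oppr_eq0.
have [nA cA] := invmx_cvg cM (eq_ind_r (fun x => x != 0) J0 dM).
have [nB cB] := invmx_cvg cM' (eq_ind_r (fun x => x != 0) nJ dM').
split; first by apply: filterS2 nA nB => t; exact: coef_affine.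
have {}cA i : (fun t => h t * invmx (fwd_mx (q t)) l i) ~~> s l i * d (rev_ord i) (rev_ord l) / J.
  by have := cA l i; rewrite dM mxE.
have {}cB i : (fun t => h t * invmx (bwd_mx (q t)) l i) ~~> s l i * d i (rev_ord l) / J.
  have := cB l i; rewrite dM' mxE rev_ordK.
  by rewrite (_ : _ * - _ / - J = s l i * d i (rev_ord l) / J)//; field.
have s1 : s l 1 = - s l 0.
  by have [->|->] := ord2_cases l; rewrite /s /= ?opprK.
have cA0 := cA 0; have cA1 := cA 1; have cB0 := cB 0; have cB1 := cB 1.
rewrite rev_ord2_0 in cA0; rewrite rev_ord2_1 s1 in cA1; rewrite s1 in cB1.
case=> [[] []]; rewrite /checker /gam /=.
- apply: (cvg_ext (cvgN (cvgD cB0 cB1))) => [t|]; last by field.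
  by rewrite -[LHS]/(- (_ * _ + _ * _)) /coef; ring.
- apply: (cvg_ext (cvgB cB0 cA0)) => [t|]; last by field.
  by rewrite -[LHS]/(_ * _ - _ * _) /coef; ring.
- apply: (cvg_ext (cvgB cB1 cA1)) => [t|]; last by field.
  by rewrite -[LHS]/(_ * _ - _ * _) /coef; ring.
- apply: (cvg_ext (cvgD cA0 cA1)) => [t|]; last by field.
  by rewrite -[LHS]/(_ * _ + _ * _) /coef; ring.
Qed.

Lemma cell_dist_cvg k m : (fun t => enorm (q t k - q t m) / h t) ~~>
  Num.sqrt (\sum_j dir k m j ^+ 2).
Proof.
have c : (fun t => ((q t k 0 0 - q t m 0 0) / h t) ^+ 2 + ((q t k 0 1 - q t m 0 1) / h t) ^+ 2)
    ~~> dir k m 0 ^+ 2 + dir k m 1 ^+ 2.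
  apply: cvgD; (apply: (@cvg_comp _ _ _ _ (fun x : R => x ^+ 2)); [exact: q_cvg|exact: exprn_continuous]).
apply: (cvg_near_ext (cvg_comp _ _ c (@sqrt_continuous _ _))); last by rewrite sum_ord2.
apply: filterS near_h => t h0.
rewrite -[LHS]/(Num.sqrt (_ + _)) /enorm sum_ord2 !mxE !expr_div_n -mulrDl.
by rewrite sqrtrM ?addr_ge0 ?sqr_ge0// sqrtrV ?sqr_ge0// sqrtr_sqr gtr0_norm.
Qed.

(** Because the Jacobian matrix is invertible, distinct corners stay apart in
    the limit, where [Gnu] is continuous. *)
Lemma dir_neq0 k m : k != m -> 0 < Num.sqrt (\sum_j dir k m j ^+ 2).
Proof.
move=> km; rewrite sqrtr_gt0 sum_ord2 lt_neqAle addr_ge0 ?sqr_ge0// andbT eq_sym.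
apply: contraNneq km => /eqP; rewrite paddr_eq0 ?sqr_ge0// !sqrf_eq0 => /andP[/eqP e0 /eqP e1].
have u0 : k.1%:R - m.1%:R = 0 :> R.
  have : d 1 1 * dir k m 0 - d 1 0 * dir k m 1 = 0 by rewrite e0 e1 !mulr0 subrr.
  by rewrite /dir => E; apply: (mulfI J0); rewrite mulr0 -E /J; ring.
have u1 : k.2%:R - m.2%:R = 0 :> R.
  have : d 0 0 * dir k m 1 - d 0 1 * dir k m 0 = 0 by rewrite e0 e1 !mulr0 subrr.
  by rewrite /dir => E; apply: (mulfI J0); rewrite mulr0 -E /J; ring.
by case: k m {e0 e1} u0 u1 => [[] []] [[] []] //= /eqP; rewrite ?subr0 ?sub0r ?oppr_eq0 ?oner_eq0 //
  => _ /eqP; rewrite ?subr0 ?sub0r ?oppr_eq0 ?oner_eq0.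
Qed.

Lemma quad_Gnu_cvg l nu :
  (fun t => quad (fun k => h t * coef (q t) l k) (q t)
     (fun x y => Gnu nu (enorm (x - y) / h t))) ~~>
  \sum_k \sum_m gam l * checker k * (gam l * checker m) *
     Gnu nu (Num.sqrt (\sum_j dir k m j ^+ 2)).
Proof.
have cG k m : (fun t => Gnu nu (enorm (q t k - q t m) / h t)) ~~>
    Gnu nu (Num.sqrt (\sum_j dir k m j ^+ 2)).
  have [<-|km] := eqVneq k m.
    rewrite big1 ?sqrtr0 => [|j _]; last by rewrite /dir !subrr !mulr0 addr0 expr0n.
    under eq_fun do rewrite subrr enorm0 mul0r.
    exact: cvg_cst.
  have c := Gnu_continuous (nu := nu) (dir_neq0 km).
  by apply: (@continuous_cvg _ _ _ F _ _ (Gnu nu) _ c); exact: cell_dist_cvg.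
have [_ cc] := coef_cvg l.
apply: cvg_finite_sum => k; apply: cvg_finite_sum => m; apply: cvgM; last exact: cG.
by apply: cvgM; exact: cc.
Qed.

End CoefficientLimits.

Section CellAlgebra.
Context {R : realType}.

(** The four diagonal terms vanish and the other twelve are grouped by the
    edges and the diagonals of the limiting parallelogram. *)
Lemma cell_sum (nu g : R) (d : 'I_2 -> 'I_2 -> R) :
  \sum_k \sum_m g * checker k * (g * checker m) *
    Gnu nu (Num.sqrt (\sum_j (d 0 j * (k.1%:R - m.1%:R) + d 1 j * (k.2%:R - m.2%:R)) ^+ 2)) =
  2 * (g ^+ 2 * (- 2 * Gnu nu (Num.sqrt (\sum_j d 1 j ^+ 2))
     - 2 * Gnu nu (Num.sqrt (\sum_j d 0 j ^+ 2))
     + Gnu nu (Num.sqrt (\sum_j (d 0 j + d 1 j) ^+ 2))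
     + Gnu nu (Num.sqrt (\sum_j (d 1 j - d 0 j) ^+ 2)))).
Proof.
pose n a b := Gnu nu (Num.sqrt (\sum_j (d 0 j * a + d 1 j * b) ^+ 2)).
have nN a b : n (- a) (- b) = n a b.
  by rewrite /n; congr (Gnu _ (Num.sqrt _)); apply: eq_bigr => j _; ring.
have n0 : n 0 0 = 0.
  by rewrite /n big1 => [|j _]; [rewrite sqrtr0 /Gnu eqxx|rewrite !mulr0 addr0 expr0n].
have nE F a b : (forall j, F j = (d 0 j * a + d 1 j * b) ^+ 2) ->
    Gnu nu (Num.sqrt (\sum_j F j)) = n a b.
  by move=> FE; rewrite /n; congr (Gnu _ (Num.sqrt _)); apply: eq_bigr => j _; exact: FE.
rewrite (nE (fun j => d 1 j ^+ 2) 0 1) => [|j]; last by ring.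
rewrite (nE (fun j => d 0 j ^+ 2) 1 0) => [|j]; last by ring.
rewrite (nE (fun j => (d 0 j + d 1 j) ^+ 2) 1 1) => [|j]; last by ring.
rewrite (nE (fun j => (d 1 j - d 0 j) ^+ 2) (-1) 1) => [|j]; last by ring.
clear nE.
have e (k m : bool * bool) : Gnu nu (Num.sqrt (\sum_j (d 0 j * (k.1%:R - m.1%:R) +
   d 1 j * (k.2%:R - m.2%:R)) ^+ 2)) = n (k.1%:R - m.1%:R) (k.2%:R - m.2%:R) by [].
under eq_bigr do under eq_bigr do rewrite e.
clear e; clearbody n.
rewrite !sum_bool2 /= /checker /= !subrr !subr0 !sub0r n0.
have := nN 1 0; have := nN 0 1; have := nN 1 1; have := nN (-1) 1.
rewrite !oppr0 opprK => -> -> -> ->; ring.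
Qed.

End CellAlgebra.

Section MeshLimits.
Context {R : realType} (Om : set 'rV[R]_2) (phi : 'rV[R]_2 -> 'rV[R]_2).
Hypotheses (oOm : open Om) (hphi : C1_diffeo Om phi).

Definition cell (ph : 'rV[R]_2 * R) (k : bool * bool) : 'rV[R]_2 :=
  phi (corner ph.1 ph.2 k).

Section At.
Variables (y : 'rV[R]_2) (Oy : Om y).
Let d i j := partial i (comp_fun phi j) y.
Let dir (k m : bool * bool) j : R :=
  d 0 j * (k.1%:R - m.1%:R) + d 1 j * (k.2%:R - m.2%:R).

Lemma cell_quotient_cvg k m j :
  (fun ph => (cell ph k 0 j - cell ph m 0 j) / ph.2) @ mesh_filter y --> (dir k m j : R).
Proof.
have := @diff_quotient_cvg _ Om _ y (cvec m) (cvec k) (diffeo_C1_at oOm hphi j Oy).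
by rewrite sum_ord2 !mxE.
Qed.

Lemma near_h_mesh : \forall ph \near mesh_filter y, 0 < ph.2.
Proof. by apply: filterS (near_mesh y 0 ltr01) => ph []. Qed.

Lemma det_partial_neq0 : d 0 0 * d 1 1 - d 0 1 * d 1 0 != 0.
Proof. exact: (jacobian_det_neq0 oOm hphi Oy). Qed.

End At.

Definition scaled_quad nu l (ph : 'rV[R]_2 * R) : R :=
  quad (fun k => ph.2 * coef (cell ph) l k) (cell ph)
     (fun x y => Gnu nu (enorm (x - y) / ph.2)).

(** The factor [2] stands for the two orders of a pair of distinct corners. *)
Lemma scaled_quad_cvg nu l (u v : R) : Om (pt u v) ->
  scaled_quad nu l @ mesh_filter (pt u v) --> (2 * Jfun phi nu l u v : R).
Proof.
move=> Oy.
have c := @quad_Gnu_cvg _ _ (mesh_filter (pt u v)) (mesh_filter_proper _) cell snd _ (near_h_mesh _)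
  (cell_quotient_cvg Oy) (det_partial_neq0 Oy) l nu.
rewrite (cell_sum nu _ (fun i j => partial i (comp_fun phi j) (pt u v))) in c.
apply: (cvg_ext c) => //; congr (2 * _); rewrite /Jfun.
have dn := det_partial_neq0 Oy.
congr (_ * _); rewrite /pderiv /=.
move: dn; set a := partial 0 (comp_fun phi 0) _; set b := partial 1 (comp_fun phi 1) _.
set e := partial 0 (comp_fun phi 1) _; set f := partial 1 (comp_fun phi 0) _.
set g := partial 1 (comp_fun phi (rev_ord l)) _; set g' := partial 0 (comp_fun phi (rev_ord l)) _.
clearbody a b e f g g' => dn.
have -> : a * b - f * e = a * b - e * f by ring.
by case: (l == 0); field.
Qed.

End MeshLimits.

(** * Uniform bounds on the unit square *)

Section UniformBounds.
Context {R : realType}.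

(** A pointwise-local bound whose constant may be enlarged is uniform on
  compact sets: constants tending to infinity are treated as one more
  parameter of the filter in the covering characterisation of compactness. *)
Lemma compact_uniform_bound (X : topologicalType) (K : set X) (I : Type)
    (F : set_system I) (FF : Filter F) (A : X -> I -> R -> Prop) :
  compact K -> (forall x i C C', A x i C -> C <= C' -> A x i C') ->
  (forall x, K x -> exists C, \forall x' \near x & i \near F, A x' i C) ->
  exists2 C, 0 < C & \forall i \near F, forall x, K x -> A x i C.
Proof.
move=> /compact_near_coveringP cK mono loc.
have FP : Filter (filter_prod F (+oo : set_system R)) by exact: filter_prod_filter.
have [|[U V] /= [FU FV] UV] := cK _ _ (fun (j : I * R) x => A x j.1 j.2) FP.
  move=> x /loc[C [[S1 S2] /= [xS1 FS2] S12]].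
  exists (S1, [set j : I * R | S2 j.1 /\ C <= j.2]) => /=.
    split => //; exists (S2, [set r | C <= r]) => /=; last by move=> [].
    by split; [exact: FS2|exists C; split; [exact: num_real|move=> r /ltW]].
  by move=> [x' [i r]] /= [Sx [Si Cr]]; apply: mono Cr; exact: (S12 (x', i)).
have [C [C0 VC]] : exists C, 0 < C /\ V C.
  have [M [_ MV]] := FV; exists (`|M| + 1).
  by split; [rewrite ltr_wpDl|apply: MV; rewrite ltr_pwDr// ler_norm].
exists C => //; apply: filterS FU => i Ui x Kx; exact: (UV (i, C)).
Qed.

Lemma cvg_comp_fst (U V W : topologicalType) (f : U -> W) (a : U) (b : V) :
  {for a, continuous f} -> (fun x : U * V => f x.1) @ nbhs (a, b) --> f a.
Proof. by move=> cf; apply: (@continuous_cvg _ _ _ _ _ fst f a cf); exact: cvg_fst. Qed.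

Lemma cvg_comp_snd (U V W : topologicalType) (f : V -> W) (a : U) (b : V) :
  {for b, continuous f} -> (fun x : U * V => f x.2) @ nbhs (a, b) --> f b.
Proof. by move=> cf; apply: (@continuous_cvg _ _ _ _ _ snd f b cf); exact: cvg_snd. Qed.

Lemma unit_square_compact : compact (@unit_square R).
Proof.
have := @rV_compact R 2 (fun=> `[0, 1]%classic) (fun=> @segment_compact R 0 1).
by congr compact; apply/seteqP; split => x H j; have := H j; rewrite /= ?in_itv/=.
Qed.

Context (Om : set 'rV[R]_2) (phi : 'rV[R]_2 -> 'rV[R]_2).
Hypotheses (oOm : open Om) (hphi : C1_diffeo Om phi) (hsq : @unit_square R `<=` Om).

(** One constant serves for all bounds, so that a single compactness argument
    makes them uniform. *)
Record cell_control (nu : R) (l : 'I_2) (C h : R) (p : 'rV[R]_2) : Prop := {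
  cell_affine : affine_contrast (coef (cell phi (p, h)) l) (cell phi (p, h));
  cell_coef : forall k, `|coef (cell phi (p, h)) l k| <= C / h;
  cell_diam : forall k m, enorm (cell phi (p, h) k - cell phi (p, h) m) <= C * h;
  cell_scaled_quad : `|scaled_quad phi nu l (p, h)| <= C }.

Lemma cell_control_near nu l y : Om y -> exists C,
  \forall ph \near mesh_filter y, cell_control nu l C ph.2 ph.1.
Proof.
move=> Oy; have nh := near_h_mesh y; pose d i j := partial i (comp_fun phi j) y.
have qc := cell_quotient_cvg oOm hphi Oy.
have J0 := det_partial_neq0 oOm hphi Oy.
have FP := mesh_filter_proper y.
have ypt : y = pt (y 0 0) (y 0 1).
  by apply/rowP; apply: ord2P; rewrite mxE.
have c3 : (scaled_quad phi nu l) @ mesh_filter y --> (2 * Jfun phi nu l (y 0 0) (y 0 1) : R).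
  by rewrite [in mesh_filter _]ypt; apply: (scaled_quad_cvg oOm hphi); rewrite -ypt.
have c1 := cvg_finite_sum (F := mesh_filter y) (r := index_enum _) (fun k => cvg_norm ((coef_cvg (d := d) nh qc J0 l).2 k)).
have c2 := cvg_finite_sum (F := mesh_filter y) (r := index_enum _) (fun k => cvg_finite_sum (F := mesh_filter y) (r := index_enum _)
  (fun m => cvg_norm (cell_dist_cvg (d := d) nh qc (k := k) (m := m)))).
have [C1 C1p n1] := cvg_near_bounded (F := mesh_filter y) (c1 FP (@filter_filter _ _ FP) FP).
have [C2 C2p n2] := cvg_near_bounded (F := mesh_filter y) (c2 FP FP (@filter_filter _ _ FP) FP).
have [C3 C3p n3] := cvg_near_bounded (F := mesh_filter y) c3.
exists (C1 + C2 + C3).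
have na := (coef_cvg (d := d) nh qc J0 l).1.
have FF : Filter (mesh_filter y) by exact: filter_filter.
have := @filterI _ _ FF _ _ (na FP) (@filterI _ _ FF _ _ (@filterI _ _ FF _ _ n1 nh)
  (@filterI _ _ FF _ _ n2 n3)).
apply: (@filterS _ (mesh_filter y) FF) => -[p h] /= [aff [[b1 h0] [b2 b3]]].
split => // [k|k m|].
- rewrite ler_pdivlMr//.
  have -> : `|coef (cell phi (p, h)) l k| * h = `|h * coef (cell phi (p, h)) l k|.
    by rewrite normrM gtr0_norm// mulrC.
  apply: le_trans (_ : C1 <= _); last by rewrite -addrA lerDl addr_ge0// ltW.
  apply: le_trans b1; apply: le_trans (ler_norm _).
  by rewrite (bigD1 k)//= lerDl sumr_ge0.
- rewrite -ler_pdivrMr//.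
  apply: le_trans (_ : C2 <= _); last by rewrite -addrA addrCA lerDl addr_ge0// ltW.
  apply: le_trans b2; apply: le_trans (ler_norm _); apply: le_trans (ler_norm _) _.
  rewrite (bigD1 k)//= (bigD1 m)//= -addrA lerDl addr_ge0//.
    by rewrite sumr_ge0.
  by apply: sumr_ge0 => i _; rewrite sumr_ge0.
- by apply: le_trans b3 _; rewrite lerDr addr_ge0// ltW.
Qed.

Lemma cell_control_uniform nu l : exists2 C, 0 < C & \forall h \near (0 : R)^'+,
  forall p, unit_square p -> cell_control nu l C h p.
Proof.
have F0 : Filter (0 : R)^'+ by exact: at_right_proper_filter.
have [||C C0 H] := @compact_uniform_bound _ _ _ (0 : R)^'+ F0
  (fun p h C => 0 < h /\ cell_control nu l C h p) unit_square_compact.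
- move=> p h C C' [h0 [a b c e]] CC'; split => //; split => // [k|k m|].
  + by apply: le_trans (b k) _; rewrite ler_pM2r// invr_gt0.
  + by apply: le_trans (c k m) _; rewrite ler_pM2r.
  + exact: le_trans e CC'.
- move=> p /hsq /(cell_control_near nu l)[C H]; exists C.
  by apply: filterS2 (near_h_mesh p) H => -[].
- by exists C => //; apply: filterS H => h H p /H[].
Qed.

(** Separated points have uniformly comparable quotients by injectivity;
  near the diagonal the local bound applies. *)
Lemma inverse_lipschitz_uniform : exists2 C : R, 0 < C &
  forall a b, unit_square a -> unit_square b -> `|a - b| <= C * `|phi a - phi b|.
Proof.
have FT : ProperFilter (globally [set: unit]) by exact: (@globally_properfilter _ _ tt).
have [||C C0 H] := @compact_uniform_bound ('rV[R]_2 * 'rV[R]_2)%type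
  (@unit_square R `*` @unit_square R) unit (globally setT) FT
  (fun ab _ C => `|ab.1 - ab.2| <= C * `|phi ab.1 - phi ab.2|)
  (compact_setX unit_square_compact unit_square_compact).
- by move=> ab _ C C' h CC'; apply: le_trans h _; rewrite ler_wpM2r.
- move=> [a b] [/= /hsq Oa /hsq Ob].
  have [eab|nab] := eqVneq a b.
    rewrite -{}eab {Ob b}; have [C C0 [[U V] /= [nU nV] UV]] := diffeo_inverse_lipschitz oOm hphi Oa.
    exists C; exists ((U `*` V), setT) => /=.
      by split; [exists (U, V)|exact: filterT].
    by move=> [[x y] []] /= [[Ux Vy] _]; exact: (UV (x, y)).
  have npq : 0 < `|phi a - phi b|.
    rewrite normr_gt0 subr_eq0; apply: contra_neq nab => pab.
    by have [psi psiK _] := diffeo_inverse hphi; rewrite -(psiK a)// -(psiK b)// pab.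
  have ca : (fun x : 'rV[R]_2 * 'rV[R]_2 => phi x.1) @ nbhs (a, b) --> phi a.
    by exact: (@cvg_comp_fst _ _ _ phi a b (diffeo_continuous oOm hphi Oa)).
  have cb : (fun x : 'rV[R]_2 * 'rV[R]_2 => phi x.2) @ nbhs (a, b) --> phi b.
    by exact: (@cvg_comp_snd _ _ _ phi a b (diffeo_continuous oOm hphi Ob)).
  have c1 : (fun x : 'rV[R]_2 * 'rV[R]_2 => `|x.1 - x.2| / `|phi x.1 - phi x.2|)
      @ nbhs (a, b) --> (`|a - b| / `|phi a - phi b| : R).
    apply: cvgM; first by apply: cvg_norm; apply: cvgB; [exact: cvg_fst|exact: cvg_snd].
    apply: cvgV; first by rewrite gt_eqF.
    by apply: cvg_norm; apply: cvgB.
  have n0 : \forall x \near nbhs (a, b), 0 < `|phi x.1 - phi x.2|.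
    by apply: (cvgr_gt _ (cvg_norm (cvgB ca cb))).
  have [C C0 n1] := cvg_near_bounded (F := nbhs (a, b)) c1.
  exists C; exists ([set x | 0 < `|phi x.1 - phi x.2| /\
     `|(`|x.1 - x.2| / `|phi x.1 - phi x.2|)| <= C], setT) => /=.
    by split; [exact: filterI|exact: filterT].
  move=> [[x y] []] /= [[p0 h] _].
  by rewrite -ler_pdivrMr//; apply: le_trans (ler_norm _) h.
- exists C => // a b Qa Qb; exact: (H tt Logic.I (a, b)).
Qed.

End UniformBounds.

(** * Variances of the contrasts of a cell *)

Section QuadraticForms.
Context {R : realType}.

Lemma sumr_const2 (I : finType) (x : R) : \sum_(k : I) \sum_(m : I) x = #|I|%:R ^+ 2 * x.
Proof. by rewrite !sumr_const -mulrnA -[LHS]mulr_natl natrM expr2. Qed.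

Lemma quad_le (I : finType) (c : I -> R) (q : I -> 'rV[R]_2) F (A B : R) :
  (forall k, `|c k| <= A) -> (forall k m, `|F (q k) (q m)| <= B) ->
  `|quad c q F| <= #|I|%:R ^+ 2 * (A ^+ 2 * B).
Proof.
move=> cA FB; apply: le_trans (ler_norm_sum _ _ _) _.
apply: le_trans (_ : \sum_(k : I) \sum_(m : I) A ^+ 2 * B <= _).
  apply: ler_sum => k _; apply: le_trans (ler_norm_sum _ _ _) _.
  by apply: ler_sum => m _; rewrite !normrM expr2 !ler_pM ?mulr_ge0.
by rewrite sumr_const2.
Qed.

Lemma quad_scale (I : finType) (a : R) (c : I -> R) (q : I -> 'rV[R]_2) F :
  quad (fun k => a * c k) q F = a ^+ 2 * quad c q F.
Proof.
rewrite /quad mulr_sumr; apply: eq_bigr => k _; rewrite mulr_sumr.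
by apply: eq_bigr => m _; ring.
Qed.

Lemma powR_near0 (a e : R) : 0 < a -> 0 < e -> \forall h \near (0 : R)^'+, h `^ a <= e.
Proof.
move=> a0 e0; near=> h.
have h0 : 0 < h by near: h; exact: nbhs_right_gt.
have -> : e = (e `^ a^-1) `^ a by rewrite -powRrM mulVf ?gt_eqF// powRr1// ltW.
apply: ge0_ler_powR; rewrite ?nnegrE ?powR_ge0 ?(ltW a0) ?(ltW h0)//.
by near: h; apply: nbhs_right_le; rewrite powR_gt0.
Unshelve. all: by end_near. Qed.

Lemma powR_split2 (h a : R) : 0 < h -> h `^ (a - 2) = h `^ a / h ^+ 2.
Proof.
move=> h0; rewrite powRB ?(gt_eqF h0) ?implybT//.
by have -> := powR_mulrn 2 (ltW h0).
Qed.

Lemma gt0_powRD (h a b : R) : 0 < h -> h `^ (a + b) = h `^ a * h `^ b.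
Proof. by move=> h0; rewrite powRD// (gt_eqF h0) implybT. Qed.

Context (Om : set 'rV[R]_2) (phi : 'rV[R]_2 -> 'rV[R]_2).
Hypotheses (oOm : open Om) (hphi : C1_diffeo Om phi) (hsq : @unit_square R `<=` Om).
Context (nu : R) (l : 'I_2) (beta : nat -> R) (bstar tau : R)
  (K r : 'rV[R]_2 -> 'rV[R]_2 -> R).
Hypotheses (hnu : 0 < nu < 2) (b0 : bstar != 0) (tau0 : 0 < tau).
Hypothesis hr : exists C delta : R, 0 < delta /\ forall x y,
  enorm (x - y) < delta -> `|r x y| <= C * enorm (x - y) `^ (2 * nu + tau).
Hypothesis hK : forall x y, K x y =
  \sum_(j < (Num.truncn nu).+1) beta j * enorm (x - y) ^+ (2 * j)
  + bstar * Gnu nu (enorm (x - y)) + r x y.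
Hypothesis K_pos : forall (I : finType) (c : I -> R) (q : I -> 'rV[R]_2),
  \sum_i c i = 0 -> 0 <= quad c q K.

Definition cell_quad (F : 'rV[R]_2 -> 'rV[R]_2 -> R) (p : 'rV[R]_2) (h : R) : R :=
  quad (coef (cell phi (p, h)) l) (cell phi (p, h)) F.

Lemma cell_quad_Gnu p h : 0 < h ->
  affine_contrast (coef (cell phi (p, h)) l) (cell phi (p, h)) ->
  cell_quad (fun x y => Gnu nu (enorm (x - y))) p h =
  h `^ (2 * nu - 2) * scaled_quad phi nu l (p, h).
Proof.
move=> h0 aff; rewrite /cell_quad (quad_Gnu_scale hnu h0 aff) /scaled_quad quad_scale /=.
by rewrite powR_split2//; field; rewrite gt_eqF.
Qed.

(** The polynomial part is annihilated, and what the remainder contributes is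
    smaller by a factor [h `^ tau] than the contribution of [Gnu]. *)
Lemma cell_quad_model : exists2 C : R, 0 < C & \forall h \near (0 : R)^'+,
  forall p, unit_square p ->
  `|cell_quad K p h - bstar * cell_quad (fun x y => Gnu nu (enorm (x - y))) p h| <=
    C * h `^ (2 * nu + tau - 2) /\
  `|cell_quad K p h| <= C * h `^ (2 * nu - 2).
Proof.
have [C C0 HC] := cell_control_uniform oOm hphi hsq nu l.
have [Cr [delta [d0 Hr]]] := hr; have Cd : 0 < delta / C by rewrite divr_gt0.
(* [16] is the number of ordered pairs of corners. *)
pose D := 16 * (C ^+ 2 * (`|Cr| * C `^ (2 * nu + tau))).
have D0 : 0 <= D by rewrite !mulr_ge0// ?exprn_ge0 ?(ltW C0)// powR_ge0.
exists (D + `|bstar| * C + 1).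
  by rewrite ltr_wpDl// addr_ge0// mulr_ge0// ltW.
near=> h.
have h0 : 0 < h by near: h; exact: nbhs_right_gt.
have hd : C * h < delta by rewrite mulrC -ltr_pdivlMr//; near: h; exact: nbhs_right_lt.
have ht : h `^ tau <= 1 by near: h; exact: powR_near0.
have H : forall p, unit_square p -> cell_control phi nu l C h p by near: h.
move=> p /H[aff cc cd cq].
have n0 : 0 < 2 * nu + tau by rewrite addr_gt0// mulr_gt0//; case/andP: hnu.
have rem : `|cell_quad K p h - bstar * cell_quad (fun x y => Gnu nu (enorm (x - y))) p h| <=
    D * h `^ (2 * nu + tau - 2).
  rewrite /cell_quad (quad_model hnu aff hK) addrAC subrr add0r.
  apply: le_trans (quad_le cc (_ : forall k m, _ <= `|Cr| * (C * h) `^ (2 * nu + tau))) _.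
    move=> k m; have e := le_lt_trans (cd k m) hd.
    apply: le_trans (Hr _ _ e) _; apply: le_trans (_ : `|Cr| * _ <= _).
      by apply: ler_wpM2r (ler_norm _); exact: powR_ge0.
    apply: ler_wpM2l => //.
    by apply: ge0_ler_powR; rewrite ?nnegrE ?enorm_ge0 ?mulr_ge0 ?(ltW n0) ?(ltW C0) ?(ltW h0).
  rewrite (powR_split2 (2 * nu + tau) h0) powRM ?(ltW C0) ?(ltW h0)// card_prod card_bool /D.
  rewrite le_eqVlt; apply/orP; left; apply/eqP; field.
  by rewrite gt_eqF.
split.
  by apply: le_trans rem _; rewrite ler_wpM2r ?powR_ge0// -addrA lerDl addr_ge0// mulr_ge0// ltW.
rewrite -[cell_quad K p h](subrK (bstar * cell_quad (fun x y => Gnu nu (enorm (x - y))) p h)).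
apply: le_trans (ler_normD _ _) _; rewrite 2!mulrDl; apply: le_trans (_ : _ <= D * h `^ (2 * nu - 2) +
    `|bstar| * C * h `^ (2 * nu - 2)) _; last by rewrite lerDl mul1r powR_ge0.
apply: lerD.
  apply: le_trans rem _; rewrite ler_wpM2l// addrAC (gt0_powRD _ _ h0).
  by rewrite ler_piMr ?powR_ge0.
rewrite cell_quad_Gnu// !normrM -mulrA ler_wpM2l// mulrC [`|h `^ _|]ger0_norm ?powR_ge0//.
by rewrite ler_wpM2r ?powR_ge0.
Unshelve. all: by end_near. Qed.

(** Variances are nonnegative, and after scaling they tend to a positive
    multiple of [bstar * Jfun]. *)
Lemma bstar_Jfun_gt0 (u v : R) : unit_square (pt u v) -> Jfun phi nu l u v != 0 ->
  0 < bstar * Jfun phi nu l u v.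
Proof.
move=> Qy J0; have Oy := hsq Qy; rewrite ltNge; apply/negP => bJ.
have {}bJ : bstar * Jfun phi nu l u v < 0 by rewrite lt_neqAle bJ mulf_neq0.
have [C C0 HC] := cell_quad_model.
have [C' _ HC'] := cell_control_uniform oOm hphi hsq nu l.
have c : (fun h => bstar * scaled_quad phi nu l (pt u v, h)) @ (0 : R)^'+ -->
    bstar * (2 * Jfun phi nu l u v).
  apply: cvgM; first exact: cvg_cst.
  exact: (cvg_comp _ _ (@cvg_mesh_filter R (pt u v)) (scaled_quad_cvg oOm hphi Oy)).
have n1 : \forall h \near (0 : R)^'+, bstar * scaled_quad phi nu l (pt u v, h) <=
    bstar * Jfun phi nu l u v.
  by apply: (cvgr_le _ c); nra.
have alg x y a b : C * a <= - (bstar * Jfun phi nu l u v) / 2 -> 0 < b ->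
    x - b * y <= C * (b * a) -> y <= bstar * Jfun phi nu l u v -> 0 <= x -> False.
  move: (bstar * _) bJ => j bJ ht b0' hh hy hx.
  have : x <= b * (y + C * a) by rewrite mulrDr; lra.
  by nra.
have [h] : exists h : R, False.
  apply: (@filter_ex _ (0 : R)^'+); near=> h.
  have h0 : 0 < h by near: h; exact: nbhs_right_gt.
  have ht : C * h `^ tau <= - (bstar * Jfun phi nu l u v) / 2.
    rewrite -ler_pdivlMl//; near: h; apply: powR_near0 => //.
    by rewrite mulr_gt0 ?invr_gt0// divr_gt0// oppr_gt0.
  have [aff _ _ _] : cell_control phi nu l C' h (pt u v) by near: h; apply: filterS HC' => h; apply.
  have [] : _ /\ _ := (near HC h _) (pt u v) Qy; first by [].
  rewrite cell_quad_Gnu// ler_norml => /andP[_ hh] _.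
  have : 0 <= cell_quad K (pt u v) h by apply: K_pos; exact: aff.1.
  have : bstar * scaled_quad phi nu l (pt u v, h) <= bstar * Jfun phi nu l u v by near: h.
  move: hh; rewrite (addrAC (2 * nu)) (gt0_powRD (2 * nu - 2) tau h0) (mulrCA bstar).
  have := powR_gt0 (2 * nu - 2) h0; exact: alg ht.
by [].
Unshelve. all: by end_near. Qed.

Lemma cell_quad_lower (u v : R) : unit_square (pt u v) -> Jfun phi nu l u v != 0 ->
  exists2 k : R, 0 < k & exists2 e : R, 0 < e & \forall h \near (0 : R)^'+,
  forall p, unit_square p -> `|p - pt u v| < e -> k * h `^ (2 * nu - 2) <= cell_quad K p h.
Proof.
move=> Qy J0; have Oy := hsq Qy; have bJ := bstar_Jfun_gt0 Qy J0.
have [C C0 HC] := cell_quad_model.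
have [C' _ HC'] := cell_control_uniform oOm hphi hsq nu l.
set j := bstar * Jfun phi nu l u v in bJ *.
have c : (fun ph => bstar * scaled_quad phi nu l ph) @ mesh_filter (pt u v) -->
    bstar * (2 * Jfun phi nu l u v).
  by apply: cvgM; [exact: cvg_cst|exact: (scaled_quad_cvg oOm hphi Oy)].
have [[U V] /= [nU nV] UV] : \forall ph \near mesh_filter (pt u v), j <= bstar * scaled_quad phi nu l ph.
  by apply: (cvgr_ge _ c); rewrite /j in bJ *; nra.
have [e e0 He] : exists2 e : R, 0 < e & forall p, `|p - pt u v| < e -> U p.
  have /nbhs_ballP[e e0 He] := nU.
  by exists e => // p pe; apply: He; rewrite -ball_normE /ball_/= distrC.
exists (j / 2); first by rewrite divr_gt0.
have alg x y a b : C * a <= j / 2 -> 0 < b ->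
    - (C * (b * a)) <= x - b * y -> j <= y -> j / 2 * b <= x.
  clearbody j => ht b0' hh hy.
  have : b * (y - C * a) <= x by rewrite mulrBr; lra.
  by nra.
exists e => //; near=> h => p Qp pe.
have h0 : 0 < h by near: h; exact: nbhs_right_gt.
have ht : C * h `^ tau <= j / 2.
  by rewrite -ler_pdivlMl//; near: h; apply: powR_near0 => //; rewrite mulr_gt0 ?invr_gt0// divr_gt0.
have [aff _ _ _] : cell_control phi nu l C' h p by apply: (near HC' h).
have [] : _ /\ _ := (near HC h _) p Qp; first by [].
rewrite cell_quad_Gnu// ler_norml => /andP[hh _] _.
have : j <= bstar * scaled_quad phi nu l (p, h) by apply: (UV (p, h)); split => /=; [exact: He|near: h].
move: hh; rewrite (addrAC (2 * nu)) (gt0_powRD (2 * nu - 2) tau h0) (mulrCA bstar).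
have := powR_gt0 (2 * nu - 2) h0; exact: alg ht.
Unshelve. all: by end_near. Qed.

End QuadraticForms.

(** * Cubic Taylor polynomials in the plane *)

Section Taylor.
Context {R : realType}.

Lemma is_derive_taylor_poly N (a : nat -> R) (s : R) :
  is_derive s 1 (fun s : R => \sum_(k < N.+1) s ^+ k / k`!%:R * a k)
    (\sum_(k < N) s ^+ k / k`!%:R * a k.+1).
Proof.
elim: N => [|N IH].
  rewrite big_ord0 (_ : (fun s : R => _) = cst (a 0%N)); first exact: is_derive_cst.
  by apply/funext => x; rewrite big_ord1 expr0 fact0 divr1 mul1r.
have dX : is_derive s 1 (fun s : R => s ^+ N.+1) (N.+1%:R * s ^+ N).
  have := @is_deriveX R R id N.+1 s 1 1 (is_derive_id s 1).
  by rewrite exprfctE /GRing.scale /= mulr1.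
have := is_deriveD IH (is_deriveZ (a N.+1 / N.+1`!%:R) dX).
congr (is_derive s 1 _ _).
  apply/funext => x; rewrite [RHS]big_ord_recr /= -[LHS]/(_ + (_ * x ^+ N.+1)).
  by congr (_ + _); ring.
rewrite [RHS]big_ord_recr /= /GRing.scale /= factS natrM; congr (_ + _).
have n0 : N.+1%:R != 0 :> R by rewrite pnatr_eq0.
by rewrite invfM -!mulrA (mulrCA _^-1 N.+1%:R) mulKf//; ring.
Qed.

(** The derivative of the remainder is the remainder of the derivative, so
    that one use of the mean value theorem lowers the order by one. The factor
    [1 / N`!] is given up. *)
Lemma taylor_unit N (G : nat -> R -> R) (M : R) :
  (forall k (s : R), (k < N)%N -> 0 <= s <= 1 -> is_derive s 1 (G k) (G k.+1 s)) ->
  (forall s : R, 0 <= s <= 1 -> `|G N s| <= M) ->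
  forall s : R, 0 <= s <= 1 -> `|G 0%N s - \sum_(k < N) s ^+ k / k`!%:R * G k 0| <= M.
Proof.
elim: N G => [|N IH] G dG GM s s01; first by rewrite big_ord0 subr0 GM.
have {}IH := IH (fun k => G k.+1) (fun k s kN => dG k.+1 s kN) GM.
have /andP[s0 s1] := s01.
pose D (s : R) := G 0%N s - \sum_(k < N.+1) s ^+ k / k`!%:R * G k 0.
pose D' (s : R) := G 1%N s - \sum_(k < N) s ^+ k / k`!%:R * G k.+1 0.
have dD (x : R) : 0 <= x <= 1 -> is_derive x 1 D (D' x).
  move=> x01; exact: is_deriveB (dG 0%N x (ltn0Sn N) x01) (is_derive_taylor_poly N (G^~ 0) x).
have D0 : D 0 = 0.
  by rewrite /D big_ord_recl big1 => [|i _]; rewrite ?expr0 ?fact0 ?divr1 ?mul1r ?addr0 ?subrr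
    ?expr0n ?mul0r.
have sub (x : R) : x \in `[0, s] -> 0 <= x <= 1.
  by rewrite in_itv/= => /andP[-> xs] /=; exact: le_trans xs s1.
have [||x xs] := @MVT_segment R D D' 0 s s0.
- by move=> x /subset_itv_oo_cc/sub; exact: dD.
- by apply: derivable_within_continuous => x /sub /dD[].
rewrite D0 !subr0 -/(D s) => ->.
have M0 : 0 <= M by apply: le_trans (GM s s01).
rewrite normrM; apply: le_trans (_ : M * 1 <= _); last by rewrite mulr1.
by apply: ler_pM => //; [exact/IH/sub|rewrite ger0_norm].
Qed.

Lemma taylor_line (N : nat) (F : 'rV[R]_2 -> R) x (j : 'I_2) (t M : R) :
  (forall k s, (k < N)%N -> 0 <= s <= 1 ->
    derivable (iter k (partial j) F) (x + (s * t) *: delta_mx 0 j) (delta_mx 0 j)) ->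
  (forall s, 0 <= s <= 1 -> `|iter N (partial j) F (x + (s * t) *: delta_mx 0 j)| <= M) ->
  `|F (x + t *: delta_mx 0 j) - \sum_(k < N) t ^+ k / k`!%:R * iter k (partial j) F x|
    <= `|t| ^+ N * M.
Proof.
move=> dF FM; pose G k (s : R) := t ^+ k * iter k (partial j) F (x + (s * t) *: delta_mx 0 j).
have H1 : 0 <= (1 : R) <= 1 by rewrite ler01 lexx.
have : forall k (s : R), (k < N)%N -> 0 <= s <= 1 -> is_derive s 1 (G k) (G k.+1 s).
  move=> k s kN s01; have dk := is_derive_line (dF k s kN s01).
  have dt : is_derive s 1 (fun s : R => s * t) t.
    have /= := @is_deriveM R _ (fun s : R => s) (fun=> t) s 1 1 0 _ _.
    by rewrite scaler0 add0r /GRing.scale/= mulr1; apply.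
  have dc := @is_derive1_comp R (fun s : R => iter k (partial j) F (x + s *: delta_mx 0 j))
    (fun s => s * t) s _ _ dk dt.
  have := is_deriveZ (t ^+ k) dc; congr (is_derive s 1 _ _).
  by rewrite /G /= exprSr /GRing.scale /= -mulrA; congr (_ * _); rewrite mulrC.
move=> dG; apply: le_trans (@taylor_unit N G (`|t| ^+ N * M) dG _ 1 H1); last first.
  by move=> s s01; rewrite /G normrM normrX ler_wpM2l ?exprn_ge0// FM.
rewrite /G mul1r expr0 mul1r le_eqVlt; apply/orP; left; apply/eqP; congr (`|_ - _|).
by apply: eq_bigr => k _; rewrite expr1n mul0r scale0r addr0 mul1r; ring.
Qed.

Definition taylor3 (F : 'rV[R]_2 -> R) (z h : 'rV[R]_2) : R :=
  \sum_(b < 4) h 0 1 ^+ b / b`!%:R *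
    \sum_(a < 4 - b) h 0 0 ^+ a / a`!%:R * pderiv a b F z.

(** The derivatives whose existence is asserted are those met on the way when
    [F] is expanded first in the second coordinate and then in the first. *)
Definition quartic_at (F : 'rV[R]_2 -> R) (M : R) (w : 'rV[R]_2) : Prop :=
  [/\ (forall b, (b < 4)%N -> derivable (pderiv 0 b F) w (delta_mx 0 1)),
      (forall a b, (a + b < 4)%N -> derivable (pderiv a b F) w (delta_mx 0 0)) &
      forall a b, (a + b = 4)%N -> `|pderiv a b F w| <= M].

(** The increment in the second coordinate is expanded at the displaced first
    coordinate, so that only derivatives taken in the second coordinate first
    occur. The constant [5] counts one remainder in the second coordinate and
    four in the first. *)
Lemma taylor_plane (F : 'rV[R]_2 -> R) z (rho M : R) :
  (forall w, `|w - z| <= rho -> quartic_at F M w) ->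
  forall h, `|h| <= rho -> `|F (z + h) - taylor3 F z h| <= 5 * rho ^+ 4 * M.
Proof.
move=> reg h hrho.
have rho0 : 0 <= rho by apply: le_trans hrho.
have h0 : `|h 0 0| <= rho by apply: le_trans hrho; exact: le_coord_norm.
have h1 : `|h 0 1| <= rho by apply: le_trans hrho; exact: le_coord_norm.
have M0 : 0 <= M.
  have [|_ _ /(_ 0%N 4%N erefl)] := reg z; first by rewrite subrr normr0.
  exact: le_trans.
pose y := z + h 0 0 *: delta_mx 0 0.
have zh : z + h = y + h 0 1 *: delta_mx 0 1.
  by apply/rowP; apply: ord2P; rewrite !mxE /= ?mulr0 ?mulr1 ?addr0.
have sc (s t : R) : 0 <= s <= 1 -> `|t| <= rho -> `|s * t| <= rho.
  move=> /andP[s0 s1] tr; rewrite normrM ger0_norm//; apply: le_trans tr.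
  by rewrite ler_piMl.
have in1 s : 0 <= s <= 1 -> `|y + (s * h 0 1) *: delta_mx 0 1 - z| <= rho.
  move=> s01; rewrite rV2_norm ge_max !mxE /= !mulr1 !mulr0 !addr0.
  by apply/andP; split; rewrite addrAC subrr add0r//; exact: sc.
have in0 s : 0 <= s <= 1 -> `|z + (s * h 0 0) *: delta_mx 0 0 - z| <= rho.
  move=> s01; rewrite rV2_norm ge_max !mxE /= !mulr1 !mulr0 !addr0.
  by rewrite addrAC !subrr add0r normr0 rho0 andbT; exact: sc.
have t1 : `|F (y + h 0 1 *: delta_mx 0 1) - \sum_(b < 4) h 0 1 ^+ b / b`!%:R * pderiv 0 b F y|
    <= `|h 0 1| ^+ 4 * M.
  apply: (@taylor_line 4 F y 1) => [k s k4 /in1/reg[d _ _]|s /in1/reg[_ _ d]]; first exact: d.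
  exact: (d 0%N 4%N).
have t0 (b : 'I_4) : `|pderiv 0 b F y - \sum_(a < 4 - b) h 0 0 ^+ a / a`!%:R * pderiv a b F z|
    <= `|h 0 0| ^+ (4 - b) * M.
  apply: (@taylor_line (4 - b) (pderiv 0 b F) z 0) => [k s k4 /in0/reg[_ d _]|s /in0/reg[_ _ d]].
    by apply: d; rewrite addnC -ltn_subRL.
  by apply: (d (4 - b)%N b); rewrite subnK// ltnW.
rewrite zh; set A := F _ in t1 *; set B := \sum_(b < 4) _ in t1.
have t2 : `|B - taylor3 F z h| <= \sum_(b < 4) rho ^+ 4 * M.
  rewrite /taylor3 /B -sumrB; apply: le_trans (ler_norm_sum _ _ _) _.
  apply: ler_sum => b _; rewrite -mulrBr normrM.
  apply: le_trans (_ : rho ^+ b * (rho ^+ (4 - b) * M) <= _); last first.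
    by rewrite mulrA -exprD subnKC// ltnW.
  apply: ler_pM => //.
    rewrite normrM normrX; apply: le_trans (_ : _ <= `|h 0 1| ^+ b * 1) _.
      rewrite ler_wpM2l ?exprn_ge0// normfV ger0_norm// invf_le1 ?ltr0n ?fact_gt0//.
      by rewrite ler1n fact_gt0.
    by rewrite mulr1 lerXn2r.
  by apply: le_trans (t0 b) _; rewrite ler_wpM2r// lerXn2r.
rewrite -[A - _](subrKA B); apply: le_trans (ler_normD _ _) _.
have -> : 5 * rho ^+ 4 * M = rho ^+ 4 * M + \sum_(b < 4) rho ^+ 4 * M.
  by rewrite sumr_const card_ord; ring.
by apply: lerD t2; apply: le_trans t1 _; rewrite ler_wpM2r// lerXn2r.
Qed.

Lemma cubic_split (D : nat -> nat -> R) : exists A0 A1 A2 B0 B1 B2 : R -> R -> R,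
  forall u0 u1 v0 v1, \sum_(b < 4) (u1 - v1) ^+ b / b`!%:R *
    \sum_(a < 4 - b) (u0 - v0) ^+ a / a`!%:R * D a b =
  A0 v0 v1 + A1 v0 v1 * u0 + A2 v0 v1 * u1 + (B0 u0 u1 + B1 u0 u1 * v0 + B2 u0 u1 * v1).
Proof.
pose p a b : R := D a b / (a`!%:R * b`!%:R).
(* The first three functions collect the monomials that are affine in [u],
   the last three the remaining ones, which are affine in [v]. *)
exists (fun x y => p 2 0 * x ^+ 2 + p 1 1 * (x * y) + p 0 2 * y ^+ 2
    - p 3 0 * x ^+ 3 - p 2 1 * (x ^+ 2 * y) - p 1 2 * (x * y ^+ 2) - p 0 3 * y ^+ 3),
  (fun x y => 3 * p 3 0 * x ^+ 2 + 2 * p 2 1 * (x * y) + p 1 2 * y ^+ 2),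
  (fun x y => 3 * p 0 3 * y ^+ 2 + 2 * p 1 2 * (x * y) + p 2 1 * x ^+ 2),
  (fun x y => p 0 0 + p 1 0 * x + p 0 1 * y + p 2 0 * x ^+ 2 + p 1 1 * (x * y) + p 0 2 * y ^+ 2
    + p 3 0 * x ^+ 3 + p 2 1 * (x ^+ 2 * y) + p 1 2 * (x * y ^+ 2) + p 0 3 * y ^+ 3),
  (fun x y => - p 1 0 - 2 * p 2 0 * x - p 1 1 * y - 3 * p 3 0 * x ^+ 2
    - 2 * p 2 1 * (x * y) - p 1 2 * y ^+ 2),
  (fun x y => - p 0 1 - 2 * p 0 2 * y - p 1 1 * x - 3 * p 0 3 * y ^+ 2
    - 2 * p 1 2 * (x * y) - p 2 1 * x ^+ 2) => u0 u1 v0 v1.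
rewrite /p !big_ord_recr !big_ord0 /=.
rewrite (_ : 3`! = 6)%N// (_ : 2`! = 2)%N// (_ : 1`! = 1)%N// (_ : 0`! = 1)%N//.
by field.
Qed.

(** A monomial of degree at most three in two points is affine in one of them. *)
Lemma affine_contrasts_taylor3 (I J : finType) (c : I -> R) (c' : J -> R) x y z F :
  affine_contrast c x -> affine_contrast c' y ->
  \sum_k \sum_m c k * c' m * taylor3 F z (x k - y m - z) = 0.
Proof.
move=> [c0 c1] [c0' c1'].
pose P (u v : 'rV[R]_2) := taylor3 F z (u - v).
have [A0 [A1 [A2 [B0 [B1 [B2 PE]]]]]] : exists A0 A1 A2 B0 B1 B2 : 'rV[R]_2 -> R, forall u v,
    P u v = A0 v + A1 v * u 0 0 + A2 v * u 0 1 + (B0 u + B1 u * v 0 0 + B2 u * v 0 1).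
  have [A0 [A1 [A2 [B0 [B1 [B2 H]]]]]] := cubic_split (fun a b => pderiv a b F z).
  exists (fun v => A0 (v 0 0) (v 0 1)), (fun v => A1 (v 0 0) (v 0 1)), (fun v => A2 (v 0 0) (v 0 1)),
    (fun u => B0 (u 0 0) (u 0 1)), (fun u => B1 (u 0 0) (u 0 1)), (fun u => B2 (u 0 0) (u 0 1)).
  by move=> u v; rewrite -H /P /taylor3 !mxE.
pose s k := x k - z.
have -> : \sum_k \sum_m c k * c' m * taylor3 F z (x k - y m - z) =
  \sum_k \sum_m c k * c' m * P (s k) (y m).
  by apply: eq_bigr => k _; apply: eq_bigr => m _; rewrite /P /s addrAC.
have s1 j : \sum_k c k * s k 0 j = 0.
  transitivity (\sum_k c k * x k 0 j - (\sum_k c k) * z 0 j).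
    by rewrite mulr_suml -sumrB; apply: eq_bigr => k _; rewrite !mxE mulrBr.
  by rewrite c0 c1 mul0r subr0.
clearbody s P; clear c1.
transitivity (\sum_k \sum_m c k * c' m * (A0 (y m) + A1 (y m) * s k 0 0 + A2 (y m) * s k 0 1)
  + \sum_k \sum_m c k * c' m * (B0 (s k) + B1 (s k) * y m 0 0 + B2 (s k) * y m 0 1)).
  rewrite -big_split; apply: eq_bigr => k _; rewrite -big_split; apply: eq_bigr => m _.
  by rewrite PE mulrDr.
rewrite exchange_big /= !big1 ?addr0// => [k _|m _].
  transitivity (c k * B0 (s k) * (\sum_m c' m) + c k * B1 (s k) * (\sum_m c' m * y m 0 0)
     + c k * B2 (s k) * (\sum_m c' m * y m 0 1)).
    by rewrite !mulr_sumr -!big_split; apply: eq_bigr => m _ /=; ring.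
  by rewrite c0' !c1'; ring.
transitivity (c' m * A0 (y m) * (\sum_k c k) + c' m * A1 (y m) * (\sum_k c k * s k 0 0)
     + c' m * A2 (y m) * (\sum_k c k * s k 0 1)).
  by rewrite !mulr_sumr -!big_split; apply: eq_bigr => k _ /=; ring.
by rewrite c0 !s1; ring.
Qed.

End Taylor.

(** * Decay of the covariances of distant contrasts *)

Section CovarianceDecay.
Context {R : realType}.

Lemma ler_npowR (e x y : R) : e <= 0 -> 0 < x -> x <= y -> y `^ e <= x `^ e.
Proof.
move=> e0 x0 xy; have y0 := lt_le_trans x0 xy.
have -> : e = - - e by rewrite opprK.
rewrite !(powRN _ (- e)) lef_pV2 ?posrE ?powR_gt0//.
by apply: ge0_ler_powR; rewrite ?oppr_ge0 ?nnegrE ?(ltW x0) ?(ltW y0).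
Qed.

Lemma quartic_at_le (F : 'rV[R]_2 -> R) M M' w : M <= M' -> quartic_at F M w -> quartic_at F M' w.
Proof. by move=> MM [a b c]; split => // i j /c/le_trans; apply. Qed.

(** The two contrasts annihilate the cubic Taylor polynomial of [F] at [z], so
    that only its remainder counts. *)
Lemma cov_contrasts_le (I J : finType) (c : I -> R) (c' : J -> R) x y z F (A A' rho M : R) :
  affine_contrast c x -> affine_contrast c' y ->
  (forall k, `|c k| <= A) -> (forall m, `|c' m| <= A') ->
  (forall k m, `|x k - y m - z| <= rho) ->
  (forall w, `|w - z| <= rho -> quartic_at F M w) ->
  `|\sum_k \sum_m c k * c' m * F (x k - y m)| <=
  (#|I| * #|J|)%:R * (A * A' * (5 * rho ^+ 4 * M)).
Proof.
move=> cx cy cA cA' xy reg.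
rewrite -[X in `|X|]subr0 -[X in `|_ - X|](affine_contrasts_taylor3 z F cx cy) -sumrB.
have t k m := taylor_plane reg (xy k m).
apply: le_trans (ler_norm_sum _ _ _) _.
apply: le_trans (_ : \sum_(k : I) \sum_(m : J) A * A' * (5 * rho ^+ 4 * M) <= _).
  apply: ler_sum => k _; rewrite -sumrB; apply: le_trans (ler_norm_sum _ _ _) _.
  apply: ler_sum => m _; rewrite -mulrBr 2!normrM.
  have := t k m; rewrite [z + _]addrC subrK => tkm.
  by apply: ler_pM => //; apply: ler_pM.
by rewrite !sumr_const -mulrnA -[leLHS]mulr_natl mulnC lexx.
Qed.

Definition smooth_differences (D : set 'rV[R]_2) (F : 'rV[R]_2 -> R) : Prop :=
  forall a1 a2 : nat, (a1 + a2 = 4)%N -> exists U : set 'rV[R]_2,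
    [/\ open U, (forall x y, D x -> D y -> x != y -> U (x - y)),
        has_pderiv U a1 a2 F & continuous_on U (pderiv a1 a2 F)].

Definition bounded_differences (nu : R) (D : set 'rV[R]_2) (F : 'rV[R]_2 -> R) : Prop :=
  exists Ct : R, forall a1 a2 : nat, (a1 + a2 = 4)%N ->
    forall x y, D x -> D y -> x != y ->
      `|pderiv a1 a2 F (x - y)| <= Ct * enorm (x - y) `^ (2 * nu - 4).

Context (Om : set 'rV[R]_2) (phi : 'rV[R]_2 -> 'rV[R]_2).
Hypotheses (oOm : open Om) (hphi : C1_diffeo Om phi) (hsq : @unit_square R `<=` Om).
Context (nu : R) (l : 'I_2) (Kt : 'rV[R]_2 -> R).
Hypothesis hnu : 0 < nu < 2.
Let Delta := phi @` @unit_square R.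
Hypothesis Kt_smooth : smooth_differences Delta Kt.
Hypothesis Kt_bound : bounded_differences nu Delta Kt.

(** Each of the five derivatives of order four comes with its own open set, on
    which the lower derivatives leading to it exist as well. *)
Lemma near_quartic x y : Delta x -> Delta y -> x != y ->
  exists C : R, \forall w \near x - y, quartic_at Kt C w.
Proof.
move=> Dx Dy xy; set z := x - y.
pose C := \sum_(b < 5) (`|pderiv (4 - b) b Kt z| + 1).
exists C.
pose Q (b : 'I_5) w :=
   [/\ (b = 4%N :> nat -> forall k, (k < 4)%N -> derivable (pderiv 0 k Kt) w (delta_mx 0 1)),
       (forall a, (a + b < 4)%N -> derivable (pderiv a b Kt) w (delta_mx 0 0)) &
       `|pderiv (4 - b) b Kt w| <= C].
have H : \forall w \near z, forall b, Q b w.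
  apply: (@filter_forall _ _ Q (nbhs z)) => b; have b4 : (4 - b + b = 4)%N by rewrite subnK// -ltnS.
  have [U [oU DU [d1 d0] cU]] := Kt_smooth b4.
  have Uz : U z by exact: DU.
  have nU : \forall w \near z, U w by exact: open_nbhs_nbhs.
  have nC : \forall w \near z, `|pderiv (4 - b) b Kt w| <= C.
    have n1 : \forall w \near z, `|pderiv (4 - b) b Kt w - pderiv (4 - b) b Kt z| <= 1.
      by move: (cU z Uz); rewrite /prop_for /continuous_at => /cvgr_distC_le; apply.
    apply: filterS n1 => w wz; apply: le_trans (_ : `|pderiv (4 - b) b Kt z| + 1 <= _).
      have := ler_normD (pderiv (4 - b) b Kt w - pderiv (4 - b) b Kt z) (pderiv (4 - b) b Kt z).
      by rewrite subrK => h; apply: le_trans h _; rewrite addrC lerD2l.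
    by rewrite /C (bigD1 b)//= lerDl sumr_ge0// => i _; rewrite addr_ge0.
  apply: filterS2 nU nC => w Uw Cw; split => // [b4' k k4|a ab].
    by apply: (d1 k) => //; rewrite b4'.
  by apply: (d0 a) => //; rewrite ltn_subRL addnC.
apply: filterS H => w H; split.
- by move=> b b4; have [h _ _] := H ord_max; exact: h.
- move=> a b ab; have b5 : (b < 5)%N by apply: ltn_trans (leq_ltn_trans (leq_addl _ _) ab) _.
  by have [_ h _] := H (Ordinal b5); exact: h.
- move=> a b ab; have b5 : (b < 5)%N by rewrite ltnS -ab leq_addl.
  have ea : (4 - b)%N = a by rewrite -ab addnK.
  by have [_ _] := H (Ordinal b5); rewrite /= ea.
Qed.

(** The image of the square has interior points, so that all small increments
    are realised in it and the bound on the derivatives holds on a punctured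
    ball. *)
Lemma small_increments : exists2 r : R, 0 < r & forall w, 0 < `|w| -> `|w| < r ->
  exists x y, [/\ Delta x, Delta y, x != y & w = x - y].
Proof.
pose c : 'rV[R]_2 := pt (1 / 2) (1 / 2).
have Qc : unit_square c by apply: ord2P; rewrite mxE /=; apply/andP; split; lra.
have Oc := hsq Qc; have [psi psiK dpsi] := diffeo_inverse hphi.
have cpsi : {for phi c, continuous psi}.
  by apply: (@C1_map_continuous _ (phi @` Om)) => j; exact: dpsi.
have [_ _ oR _] := hphi.
have n1 : \forall y \near phi c, (phi @` Om) y by apply: open_nbhs_nbhs; split => //; exists c.
have n2 : \forall y \near phi c, `|psi y - c| < 1 / 2.
  move: cpsi; rewrite /prop_for /continuous_at psiK// => /cvgr_distC_lt; apply.
  by rewrite divr_gt0.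
have n12 : \forall y \near phi c, (phi @` Om) y /\ `|psi y - c| < 1 / 2 by exact: filterI n1 n2.
have [r /= r0 Hr] := iffLR (nbhs_ballP _ _) n12.
have inD y : `|y - phi c| < r -> Delta y.
  move=> yr; have [] : (phi @` Om) y /\ `|psi y - c| < 1 / 2.
    by apply: Hr; rewrite -ball_normE /ball_/= distrC.
  move=> [x Ox <-]; rewrite psiK// => xc; exists x => //.
  move=> j; have := le_lt_trans (le_coord_norm (x - c) j) xc.
  by rewrite !mxE if_same ltr_norml => /andP[h1 h2]; apply/andP; split; lra.
exists r => // w w0 wr; exists (phi c + w), (phi c); split.
- by apply: inD; rewrite addrAC subrr add0r.
- by exists c.
- by rewrite -subr_eq0 addrAC subrr add0r -normr_gt0.
- by rewrite addrAC subrr add0r.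
Qed.

(** Increments shorter than [r / 2] stay in the punctured ball on which the
    derivatives are bounded explicitly. The longer ones form a compact set
    away from the origin, on which the derivatives are bounded and the power
    of [|x - y|] is bounded below. *)
Lemma regular_increments : exists2 C : R, 0 < C & exists2 eta : R, 0 < eta &
  forall x y, Delta x -> Delta y -> x != y -> forall w, `|w - (x - y)| <= eta ->
  `|w - (x - y)| <= `|x - y| / 2 -> quartic_at Kt (C * `|x - y| `^ (2 * nu - 4)) w.
Proof.
have e0 : 2 * nu - 4 <= 0 by case/andP: hnu => _ ?; lra.
have [r r0 Hr] := small_increments.
have [Ct HCt] := Kt_bound.
have small w : 0 < `|w| -> `|w| < r -> quartic_at Kt (`|Ct| * `|w| `^ (2 * nu - 4)) w.
  move=> w0 wr; have [x [y [Dx Dy xy wE]]] := Hr w w0 wr.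
  have [C /nbhs_singleton] := near_quartic Dx Dy xy; rewrite -wE => -[h1 h0 _].
  split => // a b ab; have := HCt a b ab x y Dx Dy xy; rewrite -wE => H.
  apply: le_trans H _; apply: le_trans (_ : `|Ct| * enorm w `^ (2 * nu - 4) <= _).
    by rewrite ler_wpM2r ?powR_ge0// ler_norm.
  by rewrite ler_wpM2l// ler_npowR// norm_le_enorm.
have F0 : Filter (0 : R)^'+ by exact: at_right_proper_filter.
have [||C C0 H] := @compact_uniform_bound _ ('rV[R]_2 * 'rV[R]_2)%type
  (@unit_square R `*` @unit_square R) R (0 : R)^'+ F0
  (fun st h C => `|phi st.1 - phi st.2| <= C /\
    (r / 2 <= `|phi st.1 - phi st.2| -> forall w, `|w - (phi st.1 - phi st.2)| <= h ->
     quartic_at Kt C w))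
  (compact_setX (@unit_square_compact R) (@unit_square_compact R)).
- move=> st h C C' [h1 h2] CC'; split; first exact: le_trans h1 CC'.
  by move=> h3 w hw; apply: quartic_at_le CC' _; exact: h2.
- move=> [s t] [/= Qs Qt]; set z := phi s - phi t.
  have cs : (fun x : 'rV[R]_2 * 'rV[R]_2 => phi x.1) @ nbhs (s, t) --> phi s.
    by exact: (@cvg_comp_fst _ _ _ phi s t (diffeo_continuous oOm hphi (hsq Qs))).
  have ct : (fun x : 'rV[R]_2 * 'rV[R]_2 => phi x.2) @ nbhs (s, t) --> phi t.
    by exact: (@cvg_comp_snd _ _ _ phi s t (diffeo_continuous oOm hphi (hsq Qt))).
  have cz : (fun x : 'rV[R]_2 * 'rV[R]_2 => phi x.1 - phi x.2) @ nbhs (s, t) --> z by exact: cvgB cs ct.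
  have n0 : \forall x \near (s, t), `|phi x.1 - phi x.2| <= `|z| + 1.
    by apply: (cvgr_le _ (cvg_norm cz)); rewrite ltrDl.
  have [zr|zr] := ltP `|z| (r / 2).
    have n1 : \forall x \near (s, t), `|phi x.1 - phi x.2| < r / 2.
      by apply: (cvgr_lt _ (cvg_norm cz)).
    exists (`|z| + 1); exists ([set x | `|phi x.1 - phi x.2| <= `|z| + 1 /\
      `|phi x.1 - phi x.2| < r / 2], setT) => /=; first by split; [exact: filterI|exact: filterT].
    by move=> [x h] /= [[h1 h2] _]; split => //; rewrite leNgt h2.
  have xy : phi s != phi t.
    by rewrite -subr_eq0 -normr_gt0 -/z; apply: lt_le_trans zr; rewrite divr_gt0.
  have [C /nbhs_ballP[e /= e0' HC]] := near_quartic (imageP _ Qs) (imageP _ Qt) xy.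
  have n1 : \forall x \near (s, t), `|phi x.1 - phi x.2 - z| < e / 2.
    by move: cz => /cvgr_distC_lt; apply; rewrite divr_gt0.
  exists (`|z| + 1 + `|C|); exists ([set x | `|phi x.1 - phi x.2| <= `|z| + 1 /\
    `|phi x.1 - phi x.2 - z| < e / 2], [set h | h < e / 2]) => /=.
    by split; [exact: filterI|apply: nbhs_right_lt; rewrite divr_gt0].
  move=> [x h] /= [[h1 h2] h3]; split; first by apply: le_trans h1 _; rewrite lerDl.
  move=> _ w hw; apply: (@quartic_at_le _ C).
    by apply: le_trans (ler_norm _) _; rewrite lerDr addr_ge0.
  apply: HC; rewrite -ball_normE /ball_/= distrC -(subrKA (phi x.1 - phi x.2)).
  apply: le_lt_trans (ler_normD _ _) _; rewrite (splitr e); apply: ltrD => //.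
  exact: le_lt_trans hw h3.
- have [eta [eta0 Heta]] : exists eta : R, 0 < eta /\ forall st : 'rV[R]_2 * 'rV[R]_2,
     (@unit_square R `*` @unit_square R) st -> `|phi st.1 - phi st.2| <= C /\
    (r / 2 <= `|phi st.1 - phi st.2| -> forall w, `|w - (phi st.1 - phi st.2)| <= eta ->
     quartic_at Kt C w).
    apply: (@filter_ex _ (0 : R)^'+); apply: filterI H; exact: nbhs_right_gt.
  pose C' := C * C `^ (4 - 2 * nu) + `|Ct| * 2^-1 `^ (2 * nu - 4).
  exists C'; first by rewrite ltr_pwDl// ?mulr_ge0 ?powR_ge0// mulr_gt0 ?powR_gt0.
  exists eta => // x y [s Qs <-] [t Qt <-] xy w weta wz.
  have [zC far] := Heta (s, t) (conj Qs Qt); rewrite /= in zC far.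
  move: xy zC far weta wz; set z := phi s - phi t => xy zC far weta wz.
  have z0 : 0 < `|z| by rewrite normr_gt0 subr_eq0.
  have [zr|zr] := leP (r / 2) `|z|.
    apply: quartic_at_le (far zr w weta); rewrite /C' (mulrDl (C * _) _ (`|z| `^ _)).
    apply: le_trans (_ : C * C `^ (4 - 2 * nu) * `|z| `^ (2 * nu - 4) <= _); last first.
      by rewrite lerDl !mulr_ge0 ?powR_ge0.
    rewrite -mulrA ler_pMr//; apply: le_trans (_ : C `^ (4 - 2 * nu) * C `^ (2 * nu - 4) <= _).
      by rewrite -gt0_powRD// addrC subrKA subrr powRr0.
    by rewrite ler_wpM2l ?powR_ge0// ler_npowR.
  have w1 : `|z| / 2 <= `|w|.
    have h : `|z| <= `|w - z| + `|w| by have := ler_normD (z - w) w; rewrite subrK (distrC z w).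
    by have := le_trans h (lerD wz (lexx _)); rewrite {1}(splitr `|z|) lerD2l.
  have w2 : `|w| < r.
    have h : `|w| <= `|w - z| + `|z| by have := ler_normD (w - z) z; rewrite subrK.
    apply: le_lt_trans (le_trans h (lerD wz (lexx _))) _; rewrite (splitr r); apply: ltrD => //.
    by apply: le_lt_trans zr; rewrite ler_pdivrMr// ler_peMr// ler1n.
  apply: quartic_at_le (small w _ w2); last by apply: lt_le_trans w1; rewrite divr_gt0.
  rewrite /C' (mulrDl (C * _) _ (`|z| `^ _)); apply: le_trans (_ : `|Ct| * 2^-1 `^ (2 * nu - 4) * `|z| `^ (2 * nu - 4) <= _);
    last first.
    by rewrite lerDr !mulr_ge0 ?powR_ge0// ltW.
  rewrite -mulrA ler_wpM2l// -powRM// (mulrC 2^-1).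
  by rewrite ler_npowR// divr_gt0.
Qed.

(** The coefficients contribute [h ^- 2] and the Taylor remainder [h ^+ 4];
    distances between images are compared with distances between mesh points
    by [inverse_lipschitz_uniform]. *)
Lemma cov_decay : exists2 C : R, 0 < C & exists2 L : R, 0 < L & \forall h \near (0 : R)^'+,
  forall p p', unit_square p -> unit_square p' -> L * h <= `|p - p'| ->
  `|\sum_k \sum_m coef (cell phi (p, h)) l k * coef (cell phi (p', h)) l m *
     Kt (cell phi (p, h) k - cell phi (p', h) m)| <= C * h ^+ 2 * `|p - p'| `^ (2 * nu - 4).
Proof.
have e0 : 2 * nu - 4 <= 0 by case/andP: hnu => _ ?; lra.
have [C1 C10 H1] := cell_control_uniform oOm hphi hsq nu l.
have [C2 C20 H2] := inverse_lipschitz_uniform oOm hphi hsq.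
have [C3 C30 [eta eta0 H3]] := regular_increments.
exists (16 * (C1 ^+ 2 * (5 * (2 * C1) ^+ 4 * (C3 * C2^-1 `^ (2 * nu - 4))))).
  by rewrite !mulr_gt0 ?exprn_gt0 ?powR_gt0 ?invr_gt0// mulr_gt0.
(* At this separation the displacement of the corners, [2 * C1 * h], is at
   most half of the distance between the images of the mesh points. *)
exists (4 * C1 * C2); first by rewrite !mulr_gt0.
near=> h.
have h0 : 0 < h by near: h; exact: nbhs_right_gt.
have heta : 2 * C1 * h <= eta.
  by rewrite -ler_pdivlMl ?mulr_gt0//; near: h; apply: nbhs_right_le; rewrite !mulr_gt0 ?invr_gt0 ?mulr_gt0.
have H : forall p, unit_square p -> cell_control phi nu l C1 h p by near: h.
move=> p p' Qp Qp' pp'.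
have pp0 : 0 < `|p - p'| by apply: lt_le_trans pp'; rewrite !mulr_gt0.
set z := phi p - phi p'; have zlow : `|p - p'| <= C2 * `|z| by exact: H2.
have z0 : 0 < `|z| by rewrite -(pmulr_rgt0 _ C20); exact: lt_le_trans zlow.
have [aff1 cc1 cd1 _] := H p Qp; have [aff2 cc2 cd2 _] := H p' Qp'.
have base q : cell phi (q, h) (false, false) = phi q.
  by rewrite /cell /corner /= (_ : cvec _ = 0) ?scaler0 ?addr0//; apply/rowP => j; rewrite !mxE if_same.
have near1 k m : `|cell phi (p, h) k - cell phi (p', h) m - z| <= 2 * C1 * h.
  have -> : cell phi (p, h) k - cell phi (p', h) m - z =
    (cell phi (p, h) k - cell phi (p, h) (false, false)) -
    (cell phi (p', h) m - cell phi (p', h) (false, false)).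
    by rewrite !base /z !opprD !opprK addrACA.
  apply: le_trans (ler_normB _ _) _; rewrite -mulrA [2 * _]mulr_natl mulr2n.
  by apply: lerD; apply: le_trans (norm_le_enorm _) _.
have hz : 2 * C1 * h <= `|z| / 2.
  have : 4 * C1 * C2 * h <= C2 * `|z| by apply: le_trans pp' zlow.
  rewrite (_ : 4 * C1 * C2 * h = C2 * (2 * (2 * C1 * h))); last by ring.
  by rewrite ler_pM2l// => hz; lra.
have xy : phi p != phi p' by rewrite -subr_eq0 -normr_gt0.
have reg w : `|w - z| <= 2 * C1 * h -> quartic_at Kt (C3 * `|z| `^ (2 * nu - 4)) w.
  move=> wz; apply: H3 => //; try exact: imageP.
    exact: le_trans wz heta.
  exact: le_trans wz hz.
apply: le_trans (cov_contrasts_le aff1 aff2 cc1 cc2 near1 reg) _.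
rewrite !card_prod card_bool.
apply: le_trans (_ : 16 * (C1 / h * (C1 / h) * (5 * (2 * C1 * h) ^+ 4 *
  (C3 * (C2^-1 * `|p - p'|) `^ (2 * nu - 4)))) <= _).
  rewrite ler_wpM2l// ler_wpM2l ?mulr_ge0 ?invr_ge0 ?(ltW C10) ?(ltW h0)//.
  rewrite ler_wpM2l ?mulr_ge0 ?exprn_ge0 ?mulr_ge0 ?(ltW C10) ?(ltW h0)//.
  rewrite ler_wpM2l ?(ltW C30)// ler_npowR ?mulr_gt0 ?invr_gt0//.
  by rewrite ler_pdivrMl.
rewrite powRM ?invr_ge0 ?(ltW C20)// le_eqVlt; apply/orP; left; apply/eqP; field.
by rewrite gt_eqF.
Unshelve. all: by end_near. Qed.

End CovarianceDecay.

(** * Counting grid points and shells *)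

Section GridSums.
Context {R : realType}.

(** A fixed subinterval of the unit interval contains a positive proportion of
    the grid points. Phrased for sums, this applies to one coordinate after
    the other. *)
Lemma grid_proportion (a b : R) theta : 0 <= a -> a < b -> b < 1 ->
  exists2 c : R, 0 < c & \forall n \near \oo, forall (F : nat -> R) (m : R),
  (forall i, (1 <= i <= n - theta)%N -> 0 <= F i) ->
  (forall i, (1 <= i <= n - theta)%N -> a <= i%:R / n%:R <= b -> m <= F i) -> 0 <= m ->
  c * n%:R * m <= \sum_(1 <= i < (n - theta).+1) F i.
Proof.
move=> a0 ab b1; exists ((b - a) / 2); first by rewrite divr_gt0// subr_gt0.
near=> n => F m F0 Fm m0.
have n0 : 0 < n%:R :> R by rewrite ltr0n; near: n; exact: nbhs_infty_gt.
have n1 : 2 / (b - a) <= n%:R by near: n; exact: nbhs_infty_ger.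
have n2 : theta%:R / (1 - b) <= n%:R by near: n; exact: nbhs_infty_ger.
rewrite ler_pdivrMr ?subr_gt0// in n1; rewrite ler_pdivrMr ?subr_gt0// in n2.
have nt : (theta <= n)%N.
  by rewrite -(ler_nat R); apply: le_trans n2 _; rewrite ler_piMr ?(ltW n0)// gerBl ltW// (le_lt_trans a0).
pose A := (Num.truncn (n%:R * a)).+1; pose B := (Num.truncn (n%:R * b)).+1.
have /andP[A1 A2] : (Num.truncn (n%:R * a))%:R <= n%:R * a < A%:R.
  by rewrite truncn_itv// mulr_ge0// ltW.
have /andP[B1 B2] : (Num.truncn (n%:R * b))%:R <= n%:R * b < B%:R.
  by rewrite truncn_itv// mulr_ge0 ?(ltW n0)// (le_trans a0)// ltW.
have AB : (A <= B)%N by rewrite ltnS le_truncn// ler_pM2l// ltW.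
have Bn : (B <= (n - theta).+1)%N.
  by rewrite ltnS -(ler_nat R) natrB// (le_trans B1)//; lra.
have A0 : (1 <= A)%N by [].
rewrite (big_cat_nat A0 (leq_trans AB Bn)) (big_cat_nat AB Bn) /=.
apply: le_trans (_ : \sum_(A <= i < B) F i <= _); last first.
  rewrite addrCA lerDl addr_ge0// big_nat sumr_ge0// => i /andP[i1 i2]; apply: F0.
    by rewrite i1 -ltnS (leq_trans i2)// (leq_trans AB).
  by rewrite -[(i <= _)%N]ltnS i2 (leq_trans _ i1).
apply: le_trans (_ : \sum_(A <= i < B) m <= _); last first.
  rewrite [leLHS]big_nat [leRHS]big_nat; apply: ler_sum => i /andP[i1 i2]; apply: Fm.
    by rewrite (leq_trans A0)// -ltnS (leq_trans i2).
  rewrite ler_pdivlMr// ler_pdivrMr// ![_ * n%:R]mulrC; apply/andP; split.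
    by apply: le_trans (ltW A2) _; rewrite ler_nat.
  by apply: le_trans B1; rewrite ler_nat.
rewrite sumr_const_nat -[leRHS]mulr_natl ler_wpM2r// natrB//.
have A3 : A%:R <= n%:R * a + 1 by rewrite -natr1 lerD2r.
move: (A%:R : R) (B%:R : R) (n%:R : R) A3 B2 n1 => A' B' n' h1 h2 h3; lra.
Unshelve. all: by end_near. Qed.

Definition distn (i j : nat) : nat := (i - j) + (j - i).

Lemma sum_distn_le N i (f : nat -> R) : (forall k, 0 <= f k) -> (i < N)%N ->
  \sum_(1 <= j < N) f (distn i j) <= 2 * \sum_(0 <= k < N) f k.
Proof.
move=> f0 iN.
apply: le_trans (_ : \sum_(0 <= j < N) f (distn i j) <= _).
  by rewrite [leRHS]big_ltn ?lerDr ?f0// (leq_ltn_trans _ iN).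
rewrite mulr_natl mulr2n (big_cat_nat (leq0n i) (ltnW iN)) /=; apply: lerD.
  have -> : \sum_(0 <= j < i) f (distn i j) = \sum_(0 <= k < i) f k.+1.
    rewrite big_nat_rev /= add0n; rewrite big_nat [RHS]big_nat; apply: eq_bigr => k /andP[_ ki].
    by congr f; rewrite /distn; lia.
  rewrite -(big_add1 _ _ 0 i.+1 xpredT f) (big_cat_nat (n := i.+1) (leq0n _) iN) /=.
  by rewrite [X in _ <= X + _]big_ltn// -addrA addrCA lerDl addr_ge0// sumr_ge0.
have -> : \sum_(i <= j < N) f (distn i j) = \sum_(0 <= k < N - i) f k.
  rewrite -{1}(add0n i) big_addn big_nat [RHS]big_nat; apply: eq_bigr => k _.
  by congr f; rewrite /distn; lia.
by rewrite (big_cat_nat (leq0n _) (leq_subr i N)) /= lerDl sumr_ge0.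
Qed.

Lemma sum_if_le N a (x : R) : 0 <= x ->
  \sum_(0 <= b < N) (if (b <= a)%N then x else 0) <= a.+1%:R * x.
Proof.
move=> x0; apply: le_trans (_ : (minn N a.+1)%:R * x <= _); last first.
  by rewrite ler_wpM2r// ler_nat geq_minr.
elim: N => [|N IH]; first by rewrite big_geq// min0n mul0r.
rewrite big_nat_recr//=; case: ifPn => Na.
  have -> : minn N.+1 a.+1 = (minn N a.+1).+1 by lia.
  by rewrite -natr1 mulrDl mul1r lerD2r.
have -> : minn N.+1 a.+1 = minn N a.+1 by lia.
by rewrite addr0.
Qed.

(** Points at sup-distance [k] from a given grid point number [O(k)]. *)
Lemma shell_sum_le N i1 i2 (f : nat -> R) : (forall k, 0 <= f k) -> (i1 < N)%N -> (i2 < N)%N ->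
  \sum_(1 <= j1 < N) \sum_(1 <= j2 < N) f (maxn (distn i1 j1) (distn i2 j2)) <=
  8 * \sum_(0 <= k < N) k.+1%:R * f k.
Proof.
move=> f0 i1N i2N.
apply: le_trans (_ : \sum_(1 <= j1 < N) 2 * \sum_(0 <= b < N) f (maxn (distn i1 j1) b) <= _).
  by apply: ler_sum => j1 _; exact: (sum_distn_le (f := fun b => f (maxn (distn i1 j1) b))).
apply: le_trans (sum_distn_le (f := fun a => 2 * \sum_(0 <= b < N) f (maxn a b)) _ i1N) _.
  by move=> k; rewrite mulr_ge0// sumr_ge0.
rewrite -mulr_sumr.
have H : \sum_(0 <= a < N) \sum_(0 <= b < N) f (maxn a b) <=
    2 * \sum_(0 <= k < N) k.+1%:R * f k.
  apply: le_trans (_ : \sum_(0 <= a < N) \sum_(0 <= b < N)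
    ((if (b <= a)%N then f a else 0) + (if (a <= b)%N then f b else 0)) <= _).
    apply: ler_sum => a _; apply: ler_sum => b _.
    have [ba|ab] := leqP b a; first by rewrite lerDl; case: ifP.
    by rewrite (ltnW ab) add0r.
  under eq_bigr do rewrite big_split; rewrite big_split /= [X in _ + X <= _]exchange_big /=.
  rewrite mulr_natl mulr2n; apply: lerD; apply: ler_sum => a _; exact: sum_if_le.
rewrite mulrA; apply: le_trans (_ : 2 * 2 * (2 * \sum_(0 <= k < N) k.+1%:R * f k) <= _).
  by rewrite ler_wpM2l.
by rewrite mulrA le_eqVlt; apply/orP; left; apply/eqP; congr (_ * _); ring.
Qed.

End GridSums.

Section PowerSums.
Context {R : realType}.

Lemma powR_diff_ge (e x : R) : e != 0 -> e <= 1 -> 0 < x ->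
  (x + 1) `^ (e - 1) <= ((x + 1) `^ e - x `^ e) / e.
Proof.
move=> e0 e1 x0; have x1 : x < x + 1 by rewrite ltrDl.
have d t : t \in `[x, x + 1] -> is_derive t 1 (fun y : R => y `^ e) (e * t `^ (e - 1)).
  rewrite in_itv/= => /andP[xt _]; apply: is_derive1_powR; exact: lt_le_trans xt.
have dd t : t \in `]x, (x + 1)[ -> is_derive t 1 (fun y : R => y `^ e) (e * t `^ (e - 1)).
  by move=> /subset_itv_oo_cc; exact: d.
have cc : {within `[x, x + 1], continuous (fun y : R => y `^ e)}.
  by apply: derivable_within_continuous => t /d[].
have [t] := MVT_segment (ltW x1) dd cc.
rewrite in_itv/= => /andP[xt tx] ->.
rewrite (_ : x + 1 - x = 1) ?mulr1; last by ring.
rewrite mulrC mulKf// ler_npowR ?subr_le0//; exact: lt_le_trans xt.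
Qed.

(** Comparison with an integral, in the form of a telescoping sum of powers. *)
Lemma sum_powR_telescope (e : R) N : e != 0 -> e <= 1 -> (0 < N)%N ->
  \sum_(0 <= k < N) k.+1%:R `^ (e - 1) <= 1 + (N%:R `^ e - 1) / e.
Proof.
move=> e0 e1 N0; rewrite big_ltn// powR1 lerD2l.
apply: le_trans (_ : \sum_(1 <= k < N) (k.+1%:R `^ e - k%:R `^ e) / e <= _).
  rewrite big_nat [leRHS]big_nat; apply: ler_sum => k /andP[k1 _].
  by rewrite -natr1; apply: powR_diff_ge => //; rewrite ltr0n.
by rewrite -mulr_suml (@telescope_sumr _ 1 N (fun k => k%:R `^ e))// powR1.
Qed.

Lemma sum_powR_bounded (a : R) : a < -1 -> exists2 C : R, 0 < C &
  forall N, \sum_(0 <= k < N) k.+1%:R `^ a <= C.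
Proof.
move=> a1; pose e := a + 1; have e0 : e < 0 by rewrite /e; lra.
have Vpos : 0 < - e^-1 by rewrite oppr_gt0 invr_lt0.
exists (1 + - e^-1); first by rewrite addr_gt0.
case=> [|N]; first by rewrite big_geq// ltW// addr_gt0.
have -> : a = e - 1 by rewrite /e addrK.
apply: le_trans (sum_powR_telescope (ltr0_neq0 e0) _ (ltn0Sn N)) _; first by lra.
by rewrite lerD2l mulrBl mul1r gerDr pmulr_rle0 ?powR_gt0// invr_le0 ltW.
Qed.

Lemma sum_powR_le (a : R) : -1 < a -> exists2 C : R, 0 < C &
  forall N, (0 < N)%N -> \sum_(0 <= k < N) k.+1%:R `^ a <= C * N%:R `^ (a + 1).
Proof.
move=> a1; pose e := a + 1; have e0 : 0 < e by rewrite /e; lra.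
have ae : a = e - 1 by rewrite /e addrK.
have V0 : 0 < e^-1 by rewrite invr_gt0.
exists (1 + e^-1) => [|N N0]; first by rewrite addr_gt0.
have N1 : 1 <= N%:R `^ e.
  by rewrite -[leLHS](powRr0 N%:R) ler_powR ?ler1n// ltW.
have Ngt0 : 0 < N%:R :> R by rewrite ltr0n.
have [e1|e1] := leP e 1.
  rewrite {1}ae; apply: le_trans (sum_powR_telescope (lt0r_neq0 e0) e1 N0) _.
  by rewrite -/e; move: (N%:R `^ e) (e^-1) N1 V0 => E V E1 V0; lra.
apply: le_trans (_ : \sum_(0 <= k < N) N%:R `^ a <= _).
  rewrite big_nat [leRHS]big_nat; apply: ler_sum => k /andP[_ kN].
  by apply: ge0_ler_powR; rewrite ?nnegrE ?ler_nat// ae subr_ge0 ltW.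
rewrite sumr_const_nat subn0 -[leLHS]mulr_natl (gt0_powRD a 1 Ngt0) (powRr1 (ltW Ngt0)) [leRHS]mulrCA mulrC.
by rewrite ler_wpM2l ?powR_ge0// (ler_peMl (ltW Ngt0))// lerDl ltW.
Qed.

Lemma sum_inv_le N : (0 < N)%N -> \sum_(0 <= k < N) (k.+1%:R : R)^-1 <= 1 + ln N%:R.
Proof.
case: N => // N _; elim: N => [|N IH]; first by rewrite big_nat1 invr1 ln1 addr0.
rewrite big_nat_recr//=.
apply: le_trans (lerD IH (lexx _)) _; rewrite -addrA lerD2l.
have N1 : 0 < N.+1%:R :> R by rewrite ltr0n.
have N2 : 0 < N.+2%:R :> R by rewrite ltr0n.
have : N.+1%:R / N.+2%:R <= expR (- N.+2%:R^-1) :> R.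
  apply: le_trans (expR_ge1Dx _).
  by rewrite (_ : N.+1%:R = N.+2%:R - 1) ?mulrBl ?divff ?gt_eqF ?mul1r// -(natr1 N.+1) addrK.
move=> L; have {}L : ln (N.+1%:R / N.+2%:R) <= - N.+2%:R^-1 :> R.
  by rewrite -[leRHS]expRK ler_ln ?posrE ?divr_gt0 ?expR_gt0.
by rewrite ln_div ?posrE// in L; move: (ln N.+1%:R) (ln N.+2%:R) (N.+2%:R^-1) L => p q v; lra.
Qed.

End PowerSums.

(** * The quadratic variation as a sum of squared increments *)

Section Mean.
Context {R : realType} {d : measure_display} {T : measurableType d} (P : probability T R).

Lemma expectation_mean (F : T -> R) : P.-integrable setT (EFin \o F) ->
  'E_P[F]%E = (mean P F)%:E.
Proof.
by move=> iF; rewrite unlock /mean /Rintegral fineK// (integrable_fin_num measurableT).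
Qed.

Lemma meanZ (c : R) (F : T -> R) : P.-integrable setT (EFin \o F) ->
  mean P (fun w => c * F w) = c * mean P F.
Proof.
move=> iF; have i0 : P.-integrable setT (EFin \o (fun _ : T => 0 : R)).
  exact: finite_measure_integrable_cst.
have := Ex_lin c i0 iF; rewrite mean_cst add0r => <-.
by congr mean; apply/funext => w; rewrite add0r.
Qed.

End Mean.

Section GridContrasts.
Context {R : realType} (phi : 'rV[R]_2 -> 'rV[R]_2) (theta : nat) (l : 'I_2).

Definition node (n : nat) (q : nat * nat) : 'rV[R]_2 := pt (q.1%:R / n%:R) (q.2%:R / n%:R).

Definition mesh (n : nat) : R := theta%:R / n%:R.

Definition nodes (n : nat) : seq (nat * nat) :=
  [seq (i1, i2) | i1 <- index_iota 1 (n - theta).+1, i2 <- index_iota 1 (n - theta).+1].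

Lemma sum_nodes n (F : nat -> nat -> R) :
  \sum_(1 <= i1 < (n - theta).+1) \sum_(1 <= i2 < (n - theta).+1) F i1 i2 =
  \sum_(q <- nodes n) F q.1 q.2.
Proof. by rewrite /nodes big_allpairs_dep. Qed.

Lemma mem_nodes n q : q \in nodes n ->
  (1 <= q.1 <= n - theta)%N /\ (1 <= q.2 <= n - theta)%N.
Proof.
by move=> /allpairsP[[i j] [/=]]; rewrite !mem_index_iota !ltnS => hi hj ->.
Qed.

Lemma node_unit_square n q : q \in nodes n -> unit_square (node n q).
Proof.
move=> /mem_nodes[/andP[a1 a2] /andP[b1 b2]].
have n0 : (0 < n)%N by lia.
by apply: ord2P; rewrite mxE /= divr_ge0//= ler_pdivrMr ?ltr0n// mul1r ler_nat;
  [apply: leq_trans a2 _|apply: leq_trans b2 _]; exact: leq_subr.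
Qed.

Lemma grid_cell n q (k : bool * bool) : grid phi n (q.1 + theta * k.1) (q.2 + theta * k.2) =
  cell phi (node n q, mesh n) k.
Proof.
rewrite /grid /cell /corner /=; congr phi; apply/rowP; apply: ord2P;
  by rewrite !mxE /= natrD mulrDl natrM /mesh; ring.
Qed.

Lemma ccoef_cell n q : ccoef phi theta l n q.1 q.2 = coef (cell phi (node n q, mesh n)) l.
Proof.
have g a b := grid_cell n q (a, b); rewrite /= in g.
have g00 := g false false; have g10 := g true false; have g01 := g false true; have g11 := g true true.
rewrite !muln0 !addn0 in g00; rewrite muln1 muln0 addn0 in g10; rewrite muln1 muln0 addn0 in g01.
rewrite !muln1 in g11.
have eA : Amx phi theta n q.1 q.2 = fwd_mx (cell phi (node n q, mesh n)).
  by rewrite /Amx /fwd_mx g00 g10 g01.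
have eB : Bmx phi theta n q.1 q.2 = bwd_mx (cell phi (node n q, mesh n)).
  by rewrite /Bmx /bwd_mx g11 g10 g01.
by apply/funext => k; rewrite /ccoef /coef eA eB.
Qed.

Lemma nabla_cell n q (Z : 'rV[R]_2 -> R) :
  nabla phi theta l n (fun j1 j2 => Z (grid phi n j1 j2)) q.1 q.2 =
  \sum_k coef (cell phi (node n q, mesh n)) l k * Z (cell phi (node n q, mesh n) k).
Proof.
by rewrite nablaE; apply: eq_bigr => k _; rewrite ccoef_cell grid_cell.
Qed.

(** The diagonal pairs left out of [fbar] contribute nothing, as [Gnu nu] is
    zero at zero. *)
Lemma fbar_cells n bstar nu : fbar phi theta l n bstar nu =
  \sum_(q <- nodes n)
    bstar * cell_quad phi l (fun x y => Gnu nu (enorm (x - y))) (node n q) (mesh n).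
Proof.
rewrite /fbar -mulr_sumr (sum_nodes n (fun i1 i2 => \sum_(k : bool * bool)
  \sum_(m : bool * bool | k != m) ccoef phi theta l n i1 i2 k * ccoef phi theta l n i1 i2 m *
  Gnu nu (enorm (grid phi n (i1 + theta * k.1) (i2 + theta * k.2)
    - grid phi n (i1 + theta * m.1) (i2 + theta * m.2))))).
apply: (f_equal (fun x => bstar * x)); apply: eq_bigr => q _.
have G0 : Gnu nu (0 : R) = 0 by rewrite /Gnu eqxx.
apply: eq_bigr => k _; rewrite [RHS](bigD1 k)//= subrr enorm0 G0 mulr0 add0r.
apply: eq_big => [m|m _]; first by rewrite eq_sym.
by rewrite ccoef_cell !grid_cell.
Qed.

Lemma coef_sum0 (q : bool * bool -> 'rV[R]_2) : \sum_k coef q l k = 0.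
Proof. by rewrite sum_bool2 /coef; ring. Qed.

Lemma near_mesh_size (Q : R -> Prop) : (0 < theta)%N ->
  (\forall h \near (0 : R)^'+, Q h) -> \forall n \near \oo, Q (mesh n).
Proof.
move=> t0 [e /= e0 He]; near=> n.
have n0 : 0 < n%:R :> R by rewrite ltr0n; near: n; exact: nbhs_infty_gt.
have m0 : 0 < mesh n by rewrite divr_gt0// ltr0n.
apply: He => //=; rewrite sub0r normrN gtr0_norm// ltr_pdivrMr//.
by rewrite mulrC -ltr_pdivrMr//; near: n; exact: nbhs_infty_gtr.
Unshelve. all: by end_near. Qed.

Context {d : measure_display} {T : measurableType d}
  (P : probability T R) (X : 'rV[R]_2 -> {RV P >-> R}) (mu : R)
  (K : 'rV[R]_2 -> 'rV[R]_2 -> R).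
Hypotheses (hgauss : gaussian_field X) (hcov : has_mean_cov X mu K).

Definition increment n (q : nat * nat) (w : T) : R :=
  \sum_k coef (cell phi (node n q, mesh n)) l k * X (cell phi (node n q, mesh n) k) w.

Definition increment_cov n (q q' : nat * nat) : R :=
  mean P (fun w => increment n q w * increment n q' w).

Lemma Vbar_increments n : Vbar phi theta l n X =
  (fun w => \sum_(q <- nodes n) increment n q w ^+ 2).
Proof.
apply/funext => w; rewrite /Vbar sum_nodes; apply: eq_bigr => q _; congr (_ ^+ 2).
exact: (nabla_cell n q (fun x => X x w)).
Qed.

Lemma increment_centered n q : centered_lincombs X mu (increment n q).
Proof. exact: contrast_centered (coef_sum0 _). Qed.

Lemma increment_covE n q q' : increment_cov n q q' =
  \sum_k \sum_m coef (cell phi (node n q, mesh n)) l k * coef (cell phi (node n q', mesh n)) l m *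
     K (cell phi (node n q, mesh n) k) (cell phi (node n q', mesh n) m).
Proof. exact: (mean_contrast hgauss hcov _ _ (coef_sum0 _) (coef_sum0 _)). Qed.

Lemma increment_var n q : increment_cov n q q = cell_quad phi l K (node n q) (mesh n).
Proof. exact: increment_covE. Qed.

Lemma quad_cov_ge0 (I : finType) (c : I -> R) (x : I -> 'rV[R]_2) :
  \sum_i c i = 0 -> 0 <= quad c x K.
Proof.
move=> c0; rewrite /quad -(mean_contrast hgauss hcov _ _ c0 c0).
by apply: Rintegral_ge0 => w _; rewrite -expr2 sqr_ge0.
Qed.

Let LC := centered_lincombs X mu.
Let L_lin c Y Z (LY : LC Y) (LZ : LC Z) := centered_lincombs_lin c LY LZ.
Let L_int Y k (LY : LC Y) := (centered_lincombs_moments hgauss hcov LY).1 k.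
Let L_mom Y k (LY : LC Y) := (centered_lincombs_moments hgauss hcov LY).2 k.

Lemma increment_integrable n q q' :
  P.-integrable setT (EFin \o (fun w => increment n q w * increment n q' w)).
Proof.
have := @integ_monomial _ _ _ P LC (@L_int) _ _ 1 1
  (increment_centered n q) (increment_centered n q').
by apply: eq_integrable.
Qed.

(** The squares of the sum and of the difference of two increments have
    nonnegative means. *)
Lemma increment_cov_le n q q' :
  `|increment_cov n q q'| <= (increment_cov n q q + increment_cov n q' q') / 2.
Proof.
have iq := increment_integrable n q q; have iq' := increment_integrable n q' q'.
have iqq := increment_integrable n q q'.
have key (e : R) : e ^+ 2 = 1 -> 2 * (e * increment_cov n q q') <=
    increment_cov n q q + increment_cov n q' q'.
  move=> e1.
  have i0 : P.-integrable setT (EFin \o (fun _ : T => 0 : R)).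
    exact: finite_measure_integrable_cst.
  have := le_Ex (integ_lin (2 * e) i0 iqq) (integ_lin 1 iq iq').
  rewrite !Ex_lin// mean_cst add0r mul1r -mulrA; apply=> w.
  have := sqr_ge0 (increment n q w - e * increment n q' w).
  rewrite sqrrB exprMn e1 => h; lra.
rewrite ler_pdivlMr// mulrC; case: (ger0P (increment_cov n q q')) => _.
  by have := key 1 (expr1n _ _); rewrite mul1r.
by have := key (-1); rewrite sqrrN expr1n mulN1r; apply.
Qed.

Lemma mean_Vbar n : fine 'E_P[Vbar phi theta l n X]%E = \sum_(q <- nodes n) increment_cov n q q.
Proof.
rewrite unlock -[LHS]/(mean P _) Vbar_increments.
have -> : (fun w => \sum_(q <- nodes n) increment n q w ^+ 2) =
    (fun w => \sum_(q <- nodes n) 1 * (increment n q w * increment n q w)).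
  by apply/funext => w; apply: eq_bigr => q _; rewrite mul1r expr2.
rewrite Ex_sum => [|q]; last exact: increment_integrable.
by apply: eq_bigr => q _; rewrite mul1r.
Qed.

Definition centered_Vbar n (w : T) : R :=
  \sum_(q <- nodes n) (increment n q w ^+ 2 - increment_cov n q q).

Lemma centered_VbarE n w :
  centered_Vbar n w = Vbar phi theta l n X w - \sum_(q <- nodes n) increment_cov n q q.
Proof. by rewrite Vbar_increments /centered_Vbar sumrB. Qed.

Lemma centered_Vbar_moment_integrable n m :
  P.-integrable setT (EFin \o (fun w => centered_Vbar n w ^+ m)).
Proof.
exact: (@integ_sumsqX _ _ _ P LC (@L_lin) (@L_int) (@L_mom) _ (nodes n) _ (increment_centered n)).
Qed.

Lemma centered_Vbar_variance n : mean P (fun w => centered_Vbar n w ^+ 2) =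
  2 * \sum_(q <- nodes n) \sum_(q' <- nodes n) increment_cov n q q' ^+ 2.
Proof.
exact: (@sumsq_variance _ _ _ P LC (@L_lin) (@L_int) (@L_mom) _ (nodes n) _ (increment_centered n)).
Qed.

Lemma centered_Vbar_moment_le n (t : R) p : 0 < t ->
  \sum_(q <- nodes n) \sum_(q' <- nodes n) increment_cov n q q' ^+ 2 <=
    t ^+ 2 * (\sum_(q <- nodes n) increment_cov n q q) ^+ 2 ->
  4 * (2 * p).+1%:R * t <= 1 ->
  mean P (fun w => centered_Vbar n w ^+ (2 * p)) <=
    (8 * (2 * p).+1%:R * t * (\sum_(q <- nodes n) increment_cov n q q) ^+ 2) ^+ p.
Proof.
move=> t0 h1 h2.
exact: (@sumsq_moment_le _ _ _ P LC (@L_lin) (@L_int) (@L_mom) _ (nodes n) _ (increment_centered n)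
  _ t p p t0 erefl h1 h2 (leqnn p)).
Qed.

Lemma variance_ratio n (e : R) : e = \sum_(q <- nodes n) increment_cov n q q -> e != 0 ->
  'V_P[(fun w => (Vbar phi theta l n X w / e)%R)]%E =
  (e ^- 2 * (2 * \sum_(q <- nodes n) \sum_(q' <- nodes n) increment_cov n q q' ^+ 2))%:E.
Proof.
move=> eE e0.
have iV : P.-integrable setT (EFin \o Vbar phi theta l n X).
  have := @integ_sum _ _ _ P _ (nodes n) xpredT (fun=> 1) _ (fun q => increment_integrable n q q).
  by apply: eq_integrable => // w _; rewrite /= Vbar_increments; congr EFin;
    apply: eq_bigr => q _; rewrite mul1r expr2.
have E1 : 'E_P[(fun w => (Vbar phi theta l n X w / e)%R)]%E = 1%E.
  have -> : (fun w => Vbar phi theta l n X w / e) = (fun w => e^-1 * Vbar phi theta l n X w).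
    by apply/funext => w; rewrite mulrC.
  rewrite expectation_mean; last first.
    by have := integrableZl measurableT e^-1 iV; apply: eq_integrable.
  rewrite meanZ//; congr EFin; rewrite /mean -[Rintegral _ _ _]/(fine _).
  by have := mean_Vbar n; rewrite unlock => ->; rewrite -eE mulVf.
have iW := centered_Vbar_moment_integrable n 2.
rewrite /variance covariance.unlock E1 /= -centered_Vbar_variance.
have -> : ((fun w => Vbar phi theta l n X w / e) \- cst 1) *
    ((fun w => Vbar phi theta l n X w / e) \- cst 1) = (fun w => e ^- 2 * centered_Vbar n w ^+ 2).
  apply/funext => w; rewrite -[LHS]/((_ - 1) * (_ - 1)) centered_VbarE -eE.
  by field.
rewrite expectation_mean ?meanZ//.
by have := integrableZl measurableT (e ^- 2) iW; apply: eq_integrable.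
Qed.

End GridContrasts.

(** * Asymptotics of the expectation *)

Section Asymptotics.
Context {R : realType}.

Lemma limn_esup_le (u : nat -> \bar R) M : (\forall n \near \oo, (u n <= M)%E) ->
  (limn_esup u <= M)%E.
Proof.
move=> uM; apply: (@le_trans _ _ (ereal_sup (u @` [set n | (u n <= M)%E]))).
  by apply: ereal_inf_lbound; exists [set n | (u n <= M)%E].
by apply: ge_ereal_sup => _ [n un <-].
Qed.

Lemma limn_einf_ge (u : nat -> \bar R) m : (\forall n \near \oo, (m <= u n)%E) ->
  (m <= limn_einf u)%E.
Proof.
move=> um; rewrite /limn_einf leeNr; apply: limn_esup_le.
by apply: filterS um => n mn; rewrite leeN2.
Qed.

Lemma same_order_bounds (a b : nat -> R) (c C : R) : 0 < c ->
  (\forall n \near \oo, 0 < b n) ->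
  (\forall n \near \oo, c * b n <= a n <= C * b n) -> same_order a b.
Proof.
move=> c0 b0 ab; split.
  apply: (@lt_le_trans _ _ c%:E); first by rewrite lte_fin.
  apply: limn_einf_ge; apply: filterS2 b0 ab => n bn /andP[h _].
  by rewrite lee_fin ler_pdivlMr.
apply: (@le_lt_trans _ _ C%:E); last exact: ltry.
apply: limn_esup_le; apply: filterS2 b0 ab => n bn /andP[_ h].
by rewrite lee_fin ler_pdivrMr.
Qed.

Lemma npowR_near_infty (a e : R) : 0 < a -> 0 < e -> \forall n \near \oo, n%:R `^ (- a) <= e.
Proof.
move=> a0 e0; have := @near_mesh_size R 1 _ (ltn0Sn 0) (powR_near0 a0 e0).
apply: filterS => n; rewrite /mesh div1r => h; apply: le_trans h.
by rewrite -powR_inv1// -powRrM mulN1r.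
Qed.

Lemma asym_equiv_bounds (a b : nat -> R) (g : R) : 0 < g ->
  (exists C : R, \forall n \near \oo, 0 < b n /\ `|a n - b n| <= C * n%:R `^ (- g) * b n) ->
  asym_equiv a b.
Proof.
move=> g0 [C HC]; apply/cvgrPdist_le => e e0.
have C0 : 0 < `|C| + 1 by rewrite ltr_wpDl.
near=> n.
have [//|bn abn] := near HC n.
have ne : n%:R `^ (- g) <= e / (`|C| + 1).
  by near: n; apply: npowR_near_infty => //; rewrite divr_gt0.
rewrite distrC -[X in `|_ - X|](divff (lt0r_neq0 bn)) -mulrBl normrM normfV (gtr0_norm bn).
rewrite ler_pdivrMr//; apply: le_trans abn _; rewrite ler_wpM2r ?(ltW bn)//.
apply: le_trans (_ : (`|C| + 1) * n%:R `^ (- g) <= _).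
  by rewrite ler_wpM2r ?powR_ge0// (le_trans (ler_norm _))// lerDl.
by rewrite mulrC -ler_pdivlMr.
Unshelve. all: by end_near. Qed.

Lemma subinterval (u e : R) : 0 <= u <= 1 -> 0 < e -> exists a b : R,
  [/\ 0 <= a, a < b, b < 1 & forall x, a <= x <= b -> `|x - u| < e].
Proof.
move=> /andP[u0 u1] e0; pose m := Num.min e 1 / 5.
have e1 : 0 < Num.min e 1 by rewrite lt_min e0 ltr01.
have m0 : 0 < m by rewrite /m divr_gt0.
have m1 : m <= 1 / 5 by rewrite /m ler_pM2r ?invr_gt0// ge_min lexx orbT.
have me : 2 * m < e.
  have : 5 * m <= e by rewrite /m mulrC divfK// ge_min lexx.
  by move: m0; clear; move: m => m; lra.
clearbody m; clear e1.
(* The subinterval lies on the side of [u] that faces the middle of the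
   unit interval; [5 * m <= 1] leaves room for it. *)
have [h|h] := leP u (1 / 2).
  exists (u + m), (u + 2 * m); split; [lra|lra|lra|move=> x /andP[x1 x2]].
  by rewrite ltr_norml; apply/andP; split; lra.
exists (u - 2 * m), (u - m); split; [lra|lra|lra|move=> x /andP[x1 x2]].
by rewrite ltr_norml; apply/andP; split; lra.
Qed.

Lemma sum_nodes_le theta n (F : nat * nat -> R) (B : R) : 0 <= B ->
  (forall q, q \in nodes theta n -> `|F q| <= B) ->
  `|\sum_(q <- nodes theta n) F q| <= n%:R ^+ 2 * B.
Proof.
move=> B0 FB; apply: le_trans (ler_norm_sum _ _ _) _.
rewrite big_seq; apply: le_trans (_ : \sum_(q <- nodes theta n | q \in nodes theta n) B <= _).
  by apply: ler_sum => q qn; exact: FB.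
rewrite -big_seq big_const_seq count_predT iter_addr addr0 -[leLHS]mulr_natl ler_wpM2r//.
rewrite -natrX ler_nat size_allpairs !size_iota subn1 /= mulnn.
by rewrite leq_sqr leq_subr.
Qed.

End Asymptotics.

Section ExpectationAsymptotics.
Context {R : realType} (Om : set 'rV[R]_2) (phi : 'rV[R]_2 -> 'rV[R]_2).
Hypotheses (oOm : open Om) (hphi : C1_diffeo Om phi) (hsq : @unit_square R `<=` Om).
Context (theta : nat) (theta0 : (0 < theta)%N).
Context (nu : R) (l : 'I_2) (beta : nat -> R) (bstar tau : R)
  (K r : 'rV[R]_2 -> 'rV[R]_2 -> R).
Hypotheses (hnu : 0 < nu < 2) (b0 : bstar != 0) (tau0 : 0 < tau).
Hypothesis hr : exists C delta : R, 0 < delta /\ forall x y,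
  enorm (x - y) < delta -> `|r x y| <= C * enorm (x - y) `^ (2 * nu + tau).
Hypothesis hK : forall x y, K x y =
  \sum_(j < (Num.truncn nu).+1) beta j * enorm (x - y) ^+ (2 * j)
  + bstar * Gnu nu (enorm (x - y)) + r x y.
Hypothesis K_pos : forall (I : finType) (c : I -> R) (q : I -> 'rV[R]_2),
  \sum_i c i = 0 -> 0 <= quad c q K.

Let EV n := \sum_(q <- nodes theta n) cell_quad phi l K (node n q) (mesh theta n).
Let f n := fbar phi theta l n bstar nu.

Lemma mesh_powR n (a : R) : mesh theta n `^ a = theta%:R `^ a * n%:R `^ (- a) :> R.
Proof.
rewrite /mesh powRM// -powR_inv1// -powRrM mulN1r//.
Qed.

Lemma sqr_powR n (a : R) : (0 < n)%N -> n%:R ^+ 2 * n%:R `^ a = n%:R `^ (2 + a) :> R.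
Proof.
by move=> n0; rewrite (gt0_powRD 2 a) ?ltr0n//; have -> := powR_mulrn 2 (ler0n R n).
Qed.

(** There are at most [n ^+ 2] cells, and their mesh size is of order [n^-1]. *)
Lemma sum_cell_quad_upper : exists2 C : R, 0 < C & \forall n \near \oo,
  `|EV n - f n| <= C * n%:R `^ (4 - 2 * nu - tau) /\ `|EV n| <= C * n%:R `^ (4 - 2 * nu).
Proof.
have [C C0 HC] := cell_quad_model oOm hphi hsq l hnu tau0 hr hK.
exists (C * theta%:R `^ (2 * nu + tau - 2) + C * theta%:R `^ (2 * nu - 2)).
  by rewrite addr_gt0// mulr_gt0// powR_gt0// ltr0n.
have := near_mesh_size theta0 HC; have := nbhs_infty_gt 0.
apply: filterS2 => n n0 H; split.
  rewrite /f fbar_cells /EV -sumrB.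
  apply: le_trans (sum_nodes_le (B := C * mesh theta n `^ (2 * nu + tau - 2)) _ _) _.
  - by rewrite mulr_ge0 ?powR_ge0// ltW.
  - by move=> q qn; exact: (H _ (node_unit_square qn)).1.
  rewrite mesh_powR mulrCA [_ ^+ 2 * _]mulrCA sqr_powR// mulrA.
  rewrite (_ : 2 + - (2 * nu + tau - 2) = 4 - 2 * nu - tau); last by ring.
  by rewrite ler_wpM2r ?powR_ge0// lerDl mulr_ge0 ?powR_ge0// ltW.
apply: le_trans (sum_nodes_le (B := C * mesh theta n `^ (2 * nu - 2)) _ _) _.
- by rewrite mulr_ge0 ?powR_ge0// ltW.
- by move=> q qn; exact: (H _ (node_unit_square qn)).2.
rewrite mesh_powR mulrCA [_ ^+ 2 * _]mulrCA sqr_powR// mulrA.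
rewrite (_ : 2 + - (2 * nu - 2) = 4 - 2 * nu); last by ring.
by rewrite ler_wpM2r ?powR_ge0// lerDr mulr_ge0 ?powR_ge0// ltW.
Qed.

Hypothesis hJ : exists u v : R, [/\ 0 <= u <= 1, 0 <= v <= 1 & Jfun phi nu l u v != 0].

(** All terms are nonnegative, and a positive proportion of the mesh points
    lies close to a point where [Jfun] does not vanish. *)
Lemma sum_cell_quad_lower : exists2 c : R, 0 < c & \forall n \near \oo,
  c * n%:R `^ (4 - 2 * nu) <= EV n.
Proof.
have [u [v [u01 v01 J0]]] := hJ.
have Qy : unit_square (pt u v) by apply: ord2P; rewrite mxE.
have [k k0 [e e0 H]] := cell_quad_lower oOm hphi hsq hnu b0 tau0 hr hK K_pos Qy J0.
have [a [b [a0 ab b1 abu]]] := subinterval u01 e0.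
have [a' [b' [a0' ab' b1' abv]]] := subinterval v01 e0.
have [c1 c10 G1] := grid_proportion theta a0 ab b1.
have [c2 c20 G2] := grid_proportion theta a0' ab' b1'.
exists (c1 * c2 * k * theta%:R `^ (2 * nu - 2)).
  by rewrite !mulr_gt0 ?powR_gt0 ?ltr0n.
apply: filterS3 (filterI G1 G2) (near_mesh_size theta0 H) (nbhs_infty_gt 0) => n [G1n G2n] Hn n0.
pose F i1 i2 := cell_quad phi l K (node n (i1, i2)) (mesh theta n).
have F0 i1 i2 : 0 <= F i1 i2 by apply: K_pos; exact: coef_sum0.
have -> : EV n = \sum_(1 <= i1 < (n - theta).+1) \sum_(1 <= i2 < (n - theta).+1) F i1 i2.
  by rewrite (sum_nodes theta n F); apply: eq_bigr => -[].
pose m := k * mesh theta n `^ (2 * nu - 2).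
have m0 : 0 <= m by rewrite mulr_ge0 ?powR_ge0// ltW.
apply: le_trans (G1n _ (c2 * n%:R * m) _ _ _).
- rewrite (_ : c1 * n%:R * (c2 * n%:R * m) = c1 * c2 * (n%:R ^+ 2 * m)); last by ring.
  rewrite /m mesh_powR [_ ^+ 2 * _]mulrCA [_ ^+ 2 * _]mulrCA sqr_powR//.
  by rewrite (_ : 2 + - (2 * nu - 2) = 4 - 2 * nu) ?mulrA//; ring.
- by move=> i _; apply: sumr_ge0.
- move=> i1 hi1 ai1; apply: G2n => // i2 hi2 ai2; apply: Hn.
    apply: (@node_unit_square _ theta); apply/allpairsP; exists (i1, i2) => /=.
    by rewrite !mem_index_iota !ltnS.
  by rewrite rV2_norm gt_max !mxE /= abu// abv.
- by rewrite mulr_ge0// mulr_ge0// ltW.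
Qed.

Lemma sum_cell_quad_asymptotics :
  asym_equiv EV f /\ same_order f (fun n => n%:R `^ (4 - 2 * nu)).
Proof.
have [C C0 HC] := sum_cell_quad_upper; have [c c0 Hc] := sum_cell_quad_lower.
have c4 : 0 < c / (2 * C) by rewrite divr_gt0// mulr_gt0.
have npos : \forall n \near \oo, 0 < n%:R `^ (4 - 2 * nu) :> R.
  by apply: filterS (nbhs_infty_gt 0) => n n0; rewrite powR_gt0// ltr0n.
have split4 n : (0 < n)%N ->
    n%:R `^ (4 - 2 * nu - tau) = n%:R `^ (- tau) * n%:R `^ (4 - 2 * nu) :> R.
  by move=> n0; rewrite gt0_powRD ?ltr0n// mulrC.
have bnd : \forall n \near \oo, c / 2 * n%:R `^ (4 - 2 * nu) <= f n <= 2 * C * n%:R `^ (4 - 2 * nu).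
  near=> n.
  have n0 : (0 < n)%N by near: n; exact: nbhs_infty_gt.
  have N0 : 0 < n%:R `^ (4 - 2 * nu) :> R by rewrite powR_gt0// ltr0n.
  have [//|h1 h2] := near HC n.
  have h3 : c * n%:R `^ (4 - 2 * nu) <= EV n by near: n.
  have h4 : n%:R `^ (- tau) <= c / (2 * C) :> R by near: n; exact: npowR_near_infty.
  have h5 : n%:R `^ (- tau) <= 1 :> R by near: n; exact: npowR_near_infty.
  rewrite split4// in h1.
  have {}h4 : C * n%:R `^ (- tau) <= c / 2.
    by rewrite -ler_pdivlMl// (_ : C^-1 * (c / 2) = c / (2 * C))//; field; rewrite gt_eqF.
  have {}h5 : C * n%:R `^ (- tau) <= C by rewrite ler_piMr// ltW.
  move: h1 h2 h3 h4 h5 N0; move: (n%:R `^ (4 - 2 * nu)) (n%:R `^ (- tau)) (EV n) (f n) => N t E F.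
  rewrite !ler_norml => /andP[h1 h1'] /andP[h2 h2'] h3 h4 h5 N0; rewrite mulrA in h1 h1'.
  have u1 : C * t * N <= c / 2 * N by rewrite ler_pM2r.
  have u2 : C * t * N <= C * N by rewrite ler_pM2r.
  by apply/andP; split; lra.
have c2 : 0 < c / 2 by rewrite divr_gt0.
split; last exact: (same_order_bounds c2 npos bnd).
apply: (asym_equiv_bounds tau0); exists (C / (c / 2)).
apply: filterS3 (nbhs_infty_gt 0) HC bnd => n n0 [h1 _] /andP[h2 _].
have N0 : 0 < n%:R `^ (4 - 2 * nu) :> R by rewrite powR_gt0// ltr0n.
split; first by apply: lt_le_trans h2; rewrite mulr_gt0// divr_gt0.
apply: le_trans h1 _; rewrite split4// -!mulrA ler_pM2l//.
rewrite [leRHS]mulrCA ler_wpM2l ?powR_ge0// -ler_pdivrMl ?invr_gt0 ?divr_gt0//.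
by rewrite invrK.
Unshelve. all: by end_near. Qed.

End ExpectationAsymptotics.

(** * Sums of squared covariances *)

Section SquareSum.
Context {R : realType} (Om : set 'rV[R]_2) (phi : 'rV[R]_2 -> 'rV[R]_2).
Hypotheses (oOm : open Om) (hphi : C1_diffeo Om phi) (hsq : @unit_square R `<=` Om).
Context (theta : nat) (theta0 : (0 < theta)%N).
Context (nu : R) (l : 'I_2) (Kt : 'rV[R]_2 -> R).
Hypothesis hnu : 0 < nu < 2.
Let Delta := phi @` @unit_square R.
Hypothesis Kt_smooth : smooth_differences Delta Kt.
Hypothesis Kt_bound : bounded_differences nu Delta Kt.
Variable s : nat -> nat * nat -> nat * nat -> R.
Hypothesis sE : forall n q q', s n q q' =
  \sum_k \sum_m coef (cell phi (node n q, mesh theta n)) l k *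
    coef (cell phi (node n q', mesh theta n)) l m *
    Kt (cell phi (node n q, mesh theta n) k - cell phi (node n q', mesh theta n) m).
Hypothesis s_le : forall n q q', `|s n q q'| <= (s n q q + s n q' q') / 2.
Hypothesis s_diag : exists C : R, \forall n \near \oo, forall q, q \in nodes theta n ->
  `|s n q q| <= C * mesh theta n `^ (2 * nu - 2).

Definition node_dist (q q' : nat * nat) : nat := maxn (distn q.1 q'.1) (distn q.2 q'.2).

Lemma node_distE n q q' : `|node n q - node n q'| = (node_dist q q')%:R / n%:R :> R.
Proof.
have d i j : `|i%:R / n%:R - j%:R / n%:R| = (distn i j)%:R / n%:R :> R.
  rewrite -mulrBl normrM [`|n%:R^-1|]ger0_norm ?invr_ge0//; congr (_ / _).
  rewrite /distn; have [ij|/ltnW ij] := leqP i j.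
    by rewrite (eqP ij) add0n distrC -natrB// normr_nat.
  by rewrite (eqP ij) addn0 -natrB// normr_nat.
rewrite rV2_norm !mxE /= !d -maxr_pMl ?invr_ge0//; congr (_ / _).
by rewrite /node_dist natr_max.
Qed.

(** Mesh points further apart than a multiple of the mesh size are covered by
    [cov_decay]. The others are a bounded number of steps apart, and the bound
    on the variances suffices for them. The successor keeps the bound
    positive on the diagonal. *)
Lemma increment_cov_decay : exists2 C : R, 0 < C & \forall n \near \oo,
  forall q q', q \in nodes theta n -> q' \in nodes theta n ->
  `|s n q q'| <= C * n%:R `^ (2 - 2 * nu) * (node_dist q q').+1%:R `^ (2 * nu - 4).
Proof.
have e0 : 2 * nu - 4 <= 0 by case/andP: hnu => _ ?; lra.
have [C C0 [L L0 H]] := cov_decay oOm hphi hsq l hnu Kt_smooth Kt_bound.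
have [D HD] := s_diag.
have t0 : 0 < theta%:R :> R by rewrite ltr0n.
pose C1 := C * theta%:R ^+ 2 * 2^-1 `^ (2 * nu - 4).
pose C2 := `|D| * theta%:R `^ (2 * nu - 2) * (L * theta%:R + 1) `^ (4 - 2 * nu).
have C1p : 0 < C1 by rewrite !mulr_gt0 ?exprn_gt0 ?powR_gt0 ?invr_gt0.
have C2p : 0 <= C2 by rewrite !mulr_ge0 ?powR_ge0.
exists (C1 + C2); first by rewrite ltr_wpDr.
apply: filterS3 (nbhs_infty_gt 0) (near_mesh_size theta0 H) HD => n n0 Hn Dn q q' hq hq'.
have n0' : 0 < n%:R :> R by rewrite ltr0n.
set k := node_dist q q'.
have k1 : 0 < k.+1%:R :> R by rewrite ltr0n.
have [far|close] := leP (L * mesh theta n) `|node n q - node n q'|.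
  have := Hn _ _ (node_unit_square hq) (node_unit_square hq') far.
  rewrite -sE node_distE -/k => h; apply: le_trans h _.
  have k0 : 0 < k%:R :> R.
    move: far; rewrite node_distE -/k /mesh mulrA ler_pM2r ?invr_gt0// => far.
    by apply: lt_le_trans far; rewrite mulr_gt0.
  apply: le_trans (_ : C1 * n%:R `^ (2 - 2 * nu) * k.+1%:R `^ (2 * nu - 4) <= _); last first.
    by rewrite ler_wpM2r ?powR_ge0// ler_wpM2r ?powR_ge0// lerDl.
  have kk : k%:R `^ (2 * nu - 4) <= 2^-1 `^ (2 * nu - 4) * k.+1%:R `^ (2 * nu - 4) :> R.
    rewrite -powRM//; apply: (ler_npowR e0); first by rewrite mulr_gt0 ?invr_gt0.
    by rewrite ler_pdivrMl// mulr_natl mulr2n -natr1 lerD2l ler1n -(ltr0n R).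
  rewrite powRM ?invr_ge0// -powR_inv1// -powRrM mulN1r opprB /mesh.
  have -> : n%:R `^ (2 - 2 * nu) = n%:R ^- 2 * n%:R `^ (4 - 2 * nu) :> R.
    have -> : 2 - 2 * nu = 4 - 2 * nu - 2 by ring.
    by rewrite powR_split2// mulrC.
  rewrite /C1 exprMn exprVn.
  have -> : C * (theta%:R ^+ 2 / n%:R ^+ 2) * (k%:R `^ (2 * nu - 4) * n%:R `^ (4 - 2 * nu)) =
    (C * theta%:R ^+ 2 * (n%:R ^- 2 * n%:R `^ (4 - 2 * nu))) * k%:R `^ (2 * nu - 4) by ring.
  apply: le_trans (ler_wpM2l _ kk) _.
    by rewrite !mulr_ge0 ?powR_ge0 ?invr_ge0 ?exprn_ge0// ltW.
  by rewrite le_eqVlt; apply/orP; left; apply/eqP; ring.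
have {}close : k%:R <= L * theta%:R.
  by move: close; rewrite node_distE /mesh mulrA ltr_pM2r ?invr_gt0// => /ltW.
apply: le_trans (_ : C2 * n%:R `^ (2 - 2 * nu) * k.+1%:R `^ (2 * nu - 4) <= _); last first.
  by rewrite ler_wpM2r ?powR_ge0// ler_wpM2r ?powR_ge0// lerDr ltW.
apply: le_trans (s_le n q q') _.
apply: le_trans (_ : `|D| * mesh theta n `^ (2 * nu - 2) <= _).
  have a q1 : q1 \in nodes theta n -> s n q1 q1 <= `|D| * mesh theta n `^ (2 * nu - 2).
    move=> /Dn/(le_trans (ler_norm _)) h; apply: le_trans h _.
    by rewrite ler_wpM2r ?powR_ge0// ler_norm.
  by have := a q hq; have := a q' hq'; move: (`|D| * _) (s n q q) (s n q' q') => x y z; lra.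
rewrite mesh_powR opprB /C2.
have -> : `|D| * theta%:R `^ (2 * nu - 2) * (L * theta%:R + 1) `^ (4 - 2 * nu) * n%:R `^ (2 - 2 * nu)
    * k.+1%:R `^ (2 * nu - 4) =
  `|D| * (theta%:R `^ (2 * nu - 2) * n%:R `^ (2 - 2 * nu)) *
    ((L * theta%:R + 1) `^ (4 - 2 * nu) * k.+1%:R `^ (2 * nu - 4)) by ring.
rewrite ler_peMr ?mulr_ge0 ?powR_ge0//.
have {1}-> : 4 - 2 * nu = - (2 * nu - 4) by rewrite opprB.
rewrite powRN mulrC ler_pdivlMr ?powR_gt0 ?addr_gt0 ?mulr_gt0// mul1r.
by rewrite ler_npowR// -natr1 lerD2r.
Qed.

(** In the sum over shells the square of the decay has exponent [4 * nu - 8],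
    to which the size of the shell adds one. *)
Lemma sum_sqr_cov : exists2 C : R, 0 < C & \forall n \near \oo,
  \sum_(q <- nodes theta n) \sum_(q' <- nodes theta n) s n q q' ^+ 2 <=
  C * n%:R `^ (6 - 4 * nu) * \sum_(0 <= k < n) k.+1%:R `^ (4 * nu - 7).
Proof.
have [C C0 HC] := increment_cov_decay.
exists (8 * C ^+ 2); first by rewrite mulr_gt0 ?exprn_gt0.
apply: filterS2 (nbhs_infty_gt 0) HC => n n0 H.
have n0' : 0 < n%:R :> R by rewrite ltr0n.
have sqrP (x a : R) : 0 < x -> (x `^ a) ^+ 2 = x `^ (2 * a).
  by move=> x0; rewrite mulrC powRrM; have -> := powR_mulrn 2 (powR_ge0 x a).
pose g (k : nat) : R := k.+1%:R `^ (4 * nu - 8).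
pose S := \sum_(0 <= k < n) k.+1%:R `^ (4 * nu - 7) : R.
have gS : \sum_(0 <= k < (n - theta).+1) k.+1%:R * g k <= S.
  apply: le_trans (_ : \sum_(0 <= k < (n - theta).+1) k.+1%:R `^ (4 * nu - 7) <= _).
    apply: ler_sum => k _; rewrite /g -[X in X * _]powRr1// -gt0_powRD ?ltr0n//.
    by rewrite (_ : 1 + (4 * nu - 8) = 4 * nu - 7)//; ring.
  have nt : ((n - theta).+1 <= n)%N by lia.
  by rewrite /S (big_cat_nat (leq0n _) nt) /= lerDl sumr_ge0// => k _; exact: powR_ge0.
have row q : q \in nodes theta n -> \sum_(q' <- nodes theta n) s n q q' ^+ 2 <=
    C ^+ 2 * n%:R `^ (4 - 4 * nu) * (8 * S).
  move=> hq; have [/andP[_ q1] /andP[_ q2]] := mem_nodes hq.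
  apply: le_trans (_ : \sum_(q' <- nodes theta n) C ^+ 2 * n%:R `^ (4 - 4 * nu) * g (node_dist q q') <= _).
    rewrite big_seq [leRHS]big_seq; apply: ler_sum => q' hq'.
    rewrite -real_normK ?num_real//; apply: le_trans (_ : (C * n%:R `^ (2 - 2 * nu) *
       (node_dist q q').+1%:R `^ (2 * nu - 4)) ^+ 2 <= _).
      by rewrite lerXn2r ?nnegrE// ?H// !mulr_ge0 ?powR_ge0// ltW.
    rewrite !exprMn !sqrP ?ltr0n// /g le_eqVlt; apply/orP; left; apply/eqP.
    rewrite (_ : 2 * (2 - 2 * nu) = 4 - 4 * nu); last by ring.
    by rewrite (_ : 2 * (2 * nu - 4) = 4 * nu - 8)//; ring.
  rewrite -mulr_sumr ler_wpM2l ?mulr_ge0 ?exprn_ge0 ?powR_ge0 ?(ltW C0)//.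
  rewrite -(sum_nodes theta n (fun j1 j2 => g (node_dist q (j1, j2)))).
  apply: le_trans (shell_sum_le (f := g) (i1 := q.1) (i2 := q.2) _ _ _) _; rewrite ?ltnS//.
    by move=> k; exact: powR_ge0.
  by rewrite ler_pM2l.
have S0 : 0 <= S by apply: sumr_ge0 => k _; exact: powR_ge0.
apply: le_trans (ler_norm _) _.
apply: le_trans (sum_nodes_le (B := C ^+ 2 * n%:R `^ (4 - 4 * nu) * (8 * S)) _ _) _.
- by rewrite !mulr_ge0 ?exprn_ge0 ?powR_ge0// ltW.
- move=> q hq; rewrite ger0_norm; first exact: row.
  by apply: sumr_ge0 => q' _; exact: sqr_ge0.
have -> : n%:R ^+ 2 * (C ^+ 2 * n%:R `^ (4 - 4 * nu) * (8 * S)) =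
  8 * C ^+ 2 * (n%:R ^+ 2 * n%:R `^ (4 - 4 * nu)) * S by ring.
by rewrite sqr_powR// addrA (_ : 2 + 4 = 6 :> R)//; ring.
Qed.

End SquareSum.

(** * Almost sure convergence from summable moments *)

Section MomentConvergence.
Context {R : realType} {d : measure_display} {T : measurableType d} (P : probability T R).

Lemma sum_inv_sqr_bounded : exists B : R, forall N, \sum_(0 <= k < N) (k.+1%:R : R) ^- 2 <= B.
Proof.
have a2 : -2 < -1 :> R by lra.
have [B _ HB] := sum_powR_bounded a2; exists B => N; apply: le_trans (HB N).
rewrite le_eqVlt; apply/orP; left; apply/eqP; apply: eq_bigr => k _.
by rewrite powRN; have -> := powR_mulrn 2 (ler0n R k.+1).
Qed.

(** Summable even moments force almost sure convergence: the sum of the powers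
  has a finite mean. *)
Lemma moment_ae_cvg0 (Z : nat -> T -> R) (p : nat) (C : R) : (0 < p)%N ->
  (forall n, P.-integrable setT (EFin \o (fun w => Z n w ^+ (2 * p)))) ->
  (\forall n \near \oo, mean P (fun w => Z n w ^+ (2 * p)) <= C * n%:R ^- 2) ->
  {ae P, forall w, (fun n => Z n w) @ \oo --> (0 : R)}.
Proof.
move=> p0 iZ [N _ HN].
pose g n w : R := Z (n + N.+1)%N w ^+ (2 * p).
have g0 n w : 0 <= g n w by rewrite /g exprM exprn_ge0// sqr_ge0.
have ig n : P.-integrable setT (EFin \o g n) by exact: iZ.
have mg n : measurable_fun setT (EFin \o g n) by exact: measurable_int (ig n).
have [B HB] := sum_inv_sqr_bounded.
have sumg : (\sum_(n <oo) \int[P]_w (EFin \o g n) w < +oo)%E.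
  apply: (@le_lt_trans _ _ (`|C| * B)%:E); last exact: ltry.
  apply: lime_le; first by apply: is_cvg_nneseries => n _ _; apply: integral_ge0 => w _; rewrite lee_fin.
  apply: nearW => M.
  rewrite (eq_bigr (fun n => (mean P (g n))%:E)) => [|n _]; last first.
    by rewrite /mean /Rintegral fineK// (integrable_fin_num measurableT (ig n)).
  rewrite sumEFin lee_fin; apply: le_trans (_ : `|C| * \sum_(0 <= k < M) k.+1%:R ^- 2 <= _).
    rewrite mulr_sumr; apply: ler_sum => k _; apply: le_trans (HN (k + N.+1)%N _) _.
      by rewrite /= addnS; lia.
    apply: le_trans (_ : `|C| * (k + N.+1)%:R ^- 2 <= _).
      by rewrite ler_wpM2r ?invr_ge0 ?exprn_ge0// ler_norm.
    rewrite ler_wpM2l// lef_pV2 ?posrE ?exprn_gt0 ?ltr0n ?addn_gt0 ?orbT//.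
    by rewrite lerXn2r ?nnegrE// ler_nat addnS ltnS leq_addr.
  by rewrite ler_wpM2l.
pose G w := (\sum_(n <oo) (EFin \o g n) w)%E.
have G0 w : (0 <= G w)%E by apply: nneseries_ge0 => n _ _; rewrite lee_fin.
have iG : P.-integrable setT G.
  apply/integrableP; split.
    by apply: ge0_emeasurable_sum => // n w _ _; rewrite lee_fin.
  under eq_integral => w _ do rewrite gee0_abs//.
  rewrite integral_nneseries//; by move=> n w _; rewrite lee_fin.
have := integrable_ae measurableT iG; apply: filterS => w /(_ Logic.I) Gw.
have sg : cvgn (series (g^~ w)).
  apply: nondecreasing_is_cvgn.
    by apply/nondecreasing_seqP => n; rewrite !seriesEnat /= big_nat_recr//= lerDl.
  exists (fine (G w)) => _ [n _ <-]; rewrite -lee_fin fineK// seriesEnat /= -sumEFin.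
  by apply: nneseries_lim_ge => k _ _; rewrite lee_fin.
have gw := cvg_series_cvg_0 sg.
apply/cvgr0Pnorm_le => e e0; near=> n.
have nN : (N.+1 <= n)%N by near: n; exact: nbhs_infty_ge.
have gn : g (n - N.+1)%N w <= e ^+ (2 * p).
  near: n; have e2 : 0 < e ^+ (2 * p) by rewrite exprn_gt0.
  move: gw => /cvgr0Pnorm_le/(_ _ e2)[M _ HM].
  exists (M + N.+1)%N => // n /= hn; apply: le_trans (ler_norm _) (HM _ _) => /=; lia.
move: gn; rewrite /g subnK// => gn.
rewrite -(@ler_pXn2r _ (2 * p)) ?nnegrE ?(ltW e0) ?muln_gt0//.
by rewrite -normrX ger0_norm// exprM exprn_ge0// sqr_ge0.
Unshelve. all: by end_near. Qed.

End MomentConvergence.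

(** * Rates for the relative error *)

Section Assembly.
Context {R : realType}.

Local Notation shell_rate nu n :=
  (n%:R ^- 2 * \sum_(0 <= k < n) k.+1%:R `^ (4 * nu - 7)).

(** The square of the mean is of order [n `^ (8 - 4 * nu)], which leaves the
    factor [n ^- 2]. *)
Lemma variance_rate (nu : R) (S e : nat -> R) (c : R) : 0 < c ->
  (exists2 C : R, 0 < C & \forall n \near \oo,
    S n <= C * n%:R `^ (6 - 4 * nu) * \sum_(0 <= k < n) k.+1%:R `^ (4 * nu - 7)) ->
  (\forall n \near \oo, c * n%:R `^ (4 - 2 * nu) <= e n) ->
  exists2 C : R, 0 < C & \forall n \near \oo,
    0 < e n /\ e n ^- 2 * S n <= C * shell_rate nu n.
Proof.
move=> c0 [C C0 HS] He; exists (c ^- 2 * C); first by rewrite mulr_gt0 ?invr_gt0 ?exprn_gt0.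
apply: filterS3 (nbhs_infty_gt 0) He HS => n n1 h1 h2.
have n0 : 0 < n%:R :> R by rewrite ltr0n.
have N0 : 0 < n%:R `^ (4 - 2 * nu) :> R by rewrite powR_gt0.
have cN : 0 < c * n%:R `^ (4 - 2 * nu) by rewrite mulr_gt0.
have e0 : 0 < e n := lt_le_trans cN h1.
split=> //; set s := \sum_(0 <= k < n) _ in h2 *.
have s0 : 0 <= s by apply: sumr_ge0 => k _; exact: powR_ge0.
apply: le_trans (_ : e n ^- 2 * (C * n%:R `^ (6 - 4 * nu) * s) <= _).
  by rewrite ler_wpM2l ?invr_ge0 ?exprn_ge0// ltW.
apply: le_trans (_ : (c * n%:R `^ (4 - 2 * nu)) ^- 2 * (C * n%:R `^ (6 - 4 * nu) * s) <= _).
  rewrite ler_wpM2r ?mulr_ge0 ?powR_ge0 ?(ltW C0)// lef_pV2 ?posrE ?exprn_gt0//.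
  by rewrite lerXn2r ?nnegrE ?(ltW e0) ?(ltW cN).
have n2 : (n%:R `^ (4 - 2 * nu)) ^+ 2 = n%:R ^+ 2 * n%:R `^ (6 - 4 * nu) :> R.
  have -> : (n%:R `^ (4 - 2 * nu)) ^+ 2 = n%:R `^ ((4 - 2 * nu) * 2) :> R.
    by rewrite powRrM; have -> := powR_mulrn 2 (powR_ge0 (n%:R : R) (4 - 2 * nu)).
  by rewrite sqr_powR -?(ltr0n R)//; congr (_ `^ _); ring.
rewrite exprMn n2 le_eqVlt; apply/orP; left; apply/eqP; field.
by rewrite !gt_eqF// powR_gt0.
Qed.

Lemma bigO_seq_EFin (u v : nat -> R) (z : nat -> \bar R) (C : R) :
  (\forall n \near \oo, z n = (u n)%:E /\ 0 <= u n <= C * `|v n|) -> bigO_seq z v.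
Proof.
by move=> H; exists C; apply: filterS H => n [-> /andP[u0 uv]]; rewrite /= ger0_norm// lee_fin.
Qed.

(** The three regimes are those of the sum of [(1 + k) `^ (4 * nu - 7)],
  whose exponent crosses [-1] at [nu = 3 / 2]. *)
Lemma variance_regimes (nu : R) (u : nat -> R) (z : nat -> \bar R) (C : R) : 0 < C ->
  (\forall n \near \oo, z n = (u n)%:E /\
     0 <= u n <= C * shell_rate nu n) ->
  [/\ nu < 3 / 2 -> bigO_seq z (fun n => n%:R ^- 2),
      nu = 3 / 2 -> bigO_seq z (fun n => n%:R ^- 2 * ln n%:R) &
      3 / 2 < nu -> bigO_seq z (fun n => n%:R `^ (- 8 + 4 * nu))].
Proof.
move=> C0 H; split => hnu.
- have a1 : 4 * nu - 7 < -1 by lra.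
  have [B _ HB] := sum_powR_bounded a1.
  apply: (@bigO_seq_EFin u _ _ (C * B)); apply: filterS H => n [-> /andP[u0 un]].
  split => //; rewrite u0/=; apply: le_trans un _.
  rewrite ger0_norm ?invr_ge0 ?exprn_ge0// -mulrA ler_pM2l// mulrC.
  by rewrite ler_wpM2r ?invr_ge0 ?exprn_ge0.
- have l2 : 0 < ln 2 :> R by apply: ln_gt0; rewrite ltr1n.
  apply: (@bigO_seq_EFin u _ _ (C * (1 + (ln 2)^-1))); near=> n.
  have n2 : (2 <= n)%N by near: n; exact: nbhs_infty_ge.
  have n0 : (0 < n)%N by exact: ltnW.
  have [//|-> /andP[u0 un]] := near H n.
  have ln2 : ln 2 <= ln n%:R :> R by rewrite ler_ln ?posrE ?ltr0n// ler_nat.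
  have ln0 : 0 <= ln n%:R :> R by apply: le_trans ln2; exact: ltW.
  split => //; rewrite u0/=; apply: le_trans un _.
  rewrite ger0_norm; last by rewrite mulr_ge0// invr_ge0 exprn_ge0.
  rewrite -mulrA ler_pM2l// [leRHS]mulrCA ler_wpM2l ?invr_ge0 ?exprn_ge0//.
  apply: le_trans (_ : 1 + ln n%:R <= _).
    apply: le_trans (sum_inv_le n0); rewrite le_eqVlt; apply/orP; left; apply/eqP.
    apply: eq_bigr => k _; rewrite (_ : 4 * nu - 7 = -1); last by rewrite hnu; field.
    by rewrite powR_inv1.
  by rewrite mulrDl mul1r addrC lerD2l ler_pdivlMl// mulr1.
- have a1 : -1 < 4 * nu - 7 by lra.
  have [B _ HB] := sum_powR_le a1.
  apply: (@bigO_seq_EFin u _ _ (C * B)); near=> n.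
  have n0 : (0 < n)%N by near: n; exact: nbhs_infty_gt.
  have n0' : 0 < n%:R :> R by rewrite ltr0n.
  have [//|-> /andP[u0 un]] := near H n.
  split => //; rewrite u0/=; apply: le_trans un _.
  rewrite ger0_norm ?powR_ge0// -mulrA ler_pM2l//.
  apply: le_trans (ler_wpM2l _ (HB n n0)) _; first by rewrite invr_ge0 exprn_ge0.
  rewrite mulrCA (_ : - 8 + 4 * nu = (4 * nu - 7 + 1) - 2); last by ring.
  by rewrite powR_split2// [n%:R ^- 2 * _]mulrC.
Unshelve. all: by end_near. Qed.

(** A polynomial rate valid in all regimes: [4 * nu - 7 <= nu - 1] as
    [nu < 2], so that the sum over shells is at most of order [n `^ nu]. *)
Lemma square_sum_rate (nu C : R) (S e : nat -> R) : 0 < nu < 2 -> 0 < C ->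
  (\forall n \near \oo, 0 < e n /\
     e n ^- 2 * S n <= C * shell_rate nu n) ->
  exists2 D : R, 0 < D & \forall n \near \oo,
    0 < e n /\ S n <= (D * n%:R `^ (- ((2 - nu) / 2))) ^+ 2 * e n ^+ 2.
Proof.
move=> /andP[nu0 nu2] C0 H.
have a1 : -1 < nu - 1 by lra.
have [B B0 HB] := sum_powR_le a1.
have CB : 0 < C * B by rewrite mulr_gt0.
exists (1 + C * B); first by rewrite addr_gt0.
apply: filterS2 (nbhs_infty_gt 0) H => n n0 [e0 h].
have n0' : 0 < n%:R :> R by rewrite ltr0n.
split => //; rewrite mulrC -ler_pdivrMl ?exprn_gt0//; apply: le_trans h _.
apply: le_trans (_ : C * (n%:R ^- 2 * (B * n%:R `^ nu)) <= _).
  rewrite ler_pM2l// ler_wpM2l ?invr_ge0 ?exprn_ge0//.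
  have -> : nu = nu - 1 + 1 by ring.
  apply: le_trans (HB n n0); apply: ler_sum => k _.
  by apply: ler_powR; [rewrite ler1n|lra].
have -> : (((1 + C * B) * n%:R `^ (- ((2 - nu) / 2))) ^+ 2) =
    (1 + C * B) ^+ 2 * (n%:R ^- 2 * n%:R `^ nu).
  rewrite exprMn; congr (_ * _).
  have -> : (n%:R `^ (- ((2 - nu) / 2))) ^+ 2 = n%:R `^ (- ((2 - nu) / 2) * 2) :> R.
    by rewrite powRrM; have -> := powR_mulrn 2 (powR_ge0 (n%:R : R) (- ((2 - nu) / 2))).
  rewrite (_ : - ((2 - nu) / 2) * 2 = nu - 2); last by field.
  by rewrite powR_split2// mulrC.
rewrite (_ : C * (n%:R ^- 2 * (B * n%:R `^ nu)) = C * B * (n%:R ^- 2 * n%:R `^ nu)); last by ring.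
rewrite ler_wpM2r ?mulr_ge0 ?invr_ge0 ?exprn_ge0 ?powR_ge0//.
by move: (C * B) CB => x x0; nra.
Qed.

End Assembly.

Section AlmostSure.
Context {R : realType} (phi : 'rV[R]_2 -> 'rV[R]_2) (theta : nat) (l : 'I_2).
Context {d : measure_display} {T : measurableType d}
  (P : probability T R) (X : 'rV[R]_2 -> {RV P >-> R}) (mu : R)
  (K : 'rV[R]_2 -> 'rV[R]_2 -> R).
Hypotheses (hgauss : gaussian_field X) (hcov : has_mean_cov X mu K).
Let cov n := increment_cov phi theta l X n.
Let e n := \sum_(q <- nodes theta n) cov n q q.

(** The moment of order [2 * p] of the relative error is of order
    [n `^ (- a * p)], which is summable as soon as [2 <= a * p]. *)
Lemma ratio_ae_cvg (D a : R) : 0 < D -> 0 < a ->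
  (\forall n \near \oo, 0 < e n /\
    \sum_(q <- nodes theta n) \sum_(q' <- nodes theta n) cov n q q' ^+ 2 <=
      (D * n%:R `^ (- a)) ^+ 2 * e n ^+ 2) ->
  {ae P, forall w, (fun n => Vbar phi theta l n X w / e n) @ \oo --> (1 : R)}.
Proof.
move=> D0 a0 H.
(* The order of the moment is chosen so that [a * p >= 2]. *)
pose p := (Num.truncn (2 / a)).+1.
have pa : 2 <= a * p%:R.
  have /andP[_ h] : (Num.truncn (2 / a))%:R <= 2 / a < p%:R.
    by rewrite truncn_itv// divr_ge0// ltW.
  by rewrite mulrC -ler_pdivrMr// ltW.
pose b : R := (2 * p).+1%:R.
have b0 : 0 < b by rewrite ltr0n.
pose Z n w := centered_Vbar phi theta l X n w / e n.
have iZ n : P.-integrable setT (EFin \o (fun w => Z n w ^+ (2 * p))).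
  have := integrableZl measurableT (e n ^- (2 * p))
    (centered_Vbar_moment_integrable phi theta l hgauss hcov n (2 * p)).
  by apply: eq_integrable => // w _; rewrite /= -EFinM /Z exprMn exprVn mulrC.
have mZ : \forall n \near \oo, mean P (fun w => Z n w ^+ (2 * p)) <= (8 * b * D) ^+ p * n%:R ^- 2.
  near=> n.
  have n0 : (0 < n)%N by near: n; exact: nbhs_infty_gt.
  have n0' : 0 < n%:R :> R by rewrite ltr0n.
  have [//|en hn] := near H n.
  have t0 : 0 < D * n%:R `^ (- a) by rewrite mulr_gt0 ?powR_gt0.
  have small : 4 * b * (D * n%:R `^ (- a)) <= 1.
    rewrite mulrA -ler_pdivlMl ?mulr_gt0// mulr1; near: n; apply: npowR_near_infty => //.
    by rewrite invr_gt0 !mulr_gt0.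
  have hm := centered_Vbar_moment_le hgauss hcov t0 hn small.
  have -> : mean P (fun w => Z n w ^+ (2 * p)) =
      e n ^- (2 * p) * mean P (fun w => centered_Vbar phi theta l X n w ^+ (2 * p)).
    rewrite -meanZ; last exact: centered_Vbar_moment_integrable hgauss hcov n _.
    by congr mean; apply/funext => w; rewrite /Z exprMn exprVn mulrC.
  apply: le_trans (ler_wpM2l _ hm) _; first by rewrite invr_ge0 exprn_ge0// ltW.
  rewrite -/b -[\sum_(q <- nodes theta n) _]/(e n).
  have -> : (8 * b * (D * n%:R `^ (- a)) * e n ^+ 2) ^+ p =
      (8 * b * D) ^+ p * (n%:R `^ (- a)) ^+ p * e n ^+ (2 * p).
    by rewrite exprM -!exprMn; congr (_ ^+ p); ring.
  rewrite mulrC mulfK ?expf_neq0 ?gt_eqF//.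
  rewrite ler_wpM2l ?exprn_ge0 ?mulr_ge0 ?(ltW D0) ?(ltW b0)//.
  have -> : (n%:R `^ (- a)) ^+ p = n%:R `^ (- a * p%:R) :> R.
    by rewrite powRrM powR_mulrn ?powR_ge0.
  rewrite (_ : n%:R ^- 2 = n%:R `^ (- 2) :> R).
    by apply: ler_powR; [rewrite ler1n|rewrite mulNr lerN2].
  by rewrite powRN; have -> := powR_mulrn 2 (ltW n0').
have := moment_ae_cvg0 (ltn0Sn _) iZ mZ; apply: filterS => w Zw.
have c1 : (fun n => 1 + Z n w) @ \oo --> (1 : R).
  by rewrite -[X in _ --> X]addr0; apply: cvgD => //; exact: cvg_cst.
apply: cvg_trans c1; apply: near_eq_cvg; apply: filterS H => n [en _].
by rewrite /Z centered_VbarE -/(e n); field; rewrite gt_eqF.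
Unshelve. all: by end_near. Qed.

End AlmostSure.

(** * Expectation, variance and almost sure limit *)

Theorem theorem5 (R : realType) (d : measure_display) (T : measurableType d)
    (P : probability T R) (theta : nat) (l : 'I_2) (nu : R)
    (X : 'rV[R]_2 -> {RV P >-> R}) (mu : R)
    (K : 'rV[R]_2 -> 'rV[R]_2 -> R) (Kt : 'rV[R]_2 -> R)
    (beta : nat -> R) (bstar : R)
    (Om : set 'rV[R]_2) (phi : 'rV[R]_2 -> 'rV[R]_2)
    (htheta : theta = 1%N \/ theta = 2%N)
    (hnu : 0 < nu < 2)
    (hgauss : gaussian_field X)
    (hcov : has_mean_cov X mu K)
    (hstat : stationary_cov K Kt)
    (hiso : isotropic_cov K)
    (hmodel : cov_model nu beta bstar K)
    (hOm : open Om)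
    (hsq : @unit_square R `<=` Om)
    (hphi : C2_diffeo Om phi)
    (hJ : exists u v : R, [/\ 0 <= u <= 1, 0 <= v <= 1 & Jfun phi nu l u v != 0]) :
  let V := fun n : nat => Vbar phi theta l n X in
  let EV := fun n : nat => fine 'E_P[V n]%E in
  let f := fun n : nat => fbar phi theta l n bstar nu in
  let ratio := fun (n : nat) (w : T) => V n w / EV n in
  let varratio := fun n : nat => 'V_P[ratio n]%E in
  let Delta := phi @` @unit_square R in
  (asym_equiv EV f /\
   same_order f (fun n => n%:R `^ (4 - 2 * nu))) /\
  ((forall a1 a2 : nat, (a1 + a2 = 4)%N ->
      exists U : set 'rV[R]_2,
        [/\ open U,
            (forall x y, Delta x -> Delta y -> x != y -> U (x - y)),
            has_pderiv U a1 a2 Kt &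
            continuous_on U (pderiv a1 a2 Kt)]) ->
   (exists Ct : R, forall a1 a2 : nat, (a1 + a2 = 4)%N ->
      forall x y, Delta x -> Delta y -> x != y ->
        `|pderiv a1 a2 Kt (x - y)| <= Ct * enorm (x - y) `^ (2 * nu - 4)) ->
   [/\ (nu < 3 / 2 -> bigO_seq varratio (fun n => n%:R ^- 2)),
       (nu = 3 / 2 -> bigO_seq varratio (fun n => n%:R ^- 2 * ln n%:R)),
       (3 / 2 < nu -> bigO_seq varratio (fun n => n%:R `^ (- 8 + 4 * nu))) &
       {ae P, forall w, (fun n => ratio n w) @ \oo --> (1 : R)}]).
Proof.
move=> V EV f ratio varratio Delta.
have theta0 : (0 < theta)%N by case: htheta => ->.
have [hphi1 _] := hphi.
have [b0 [tau [r [tau0 hr hK]]]] := hmodel.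
have K_pos := quad_cov_ge0 hgauss hcov.
have EVcov n : EV n = \sum_(q <- nodes theta n) increment_cov phi theta l X n q q.
  exact: (mean_Vbar phi theta l hgauss hcov n).
have EVquad : EV = fun n => \sum_(q <- nodes theta n) cell_quad phi l K (node n q) (mesh theta n).
  by apply/funext => n; rewrite EVcov; apply: eq_bigr => q _; rewrite (increment_var _ _ _ hgauss hcov).
have [c c0 EVlow] := sum_cell_quad_lower hOm hphi1 hsq theta0 hnu b0 tau0 hr hK K_pos hJ.
split.
  rewrite EVquad; exact: (sum_cell_quad_asymptotics hOm hphi1 hsq theta0 hnu b0 tau0 hr hK K_pos hJ).
move=> Kt_smooth Kt_bound.
pose s n q q' := increment_cov phi theta l X n q q'.
pose S n := \sum_(q <- nodes theta n) \sum_(q' <- nodes theta n) s n q q' ^+ 2.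
have sE n q q' : s n q q' =
  \sum_k \sum_m coef (cell phi (node n q, mesh theta n)) l k *
    coef (cell phi (node n q', mesh theta n)) l m *
    Kt (cell phi (node n q, mesh theta n) k - cell phi (node n q', mesh theta n) m).
  rewrite /s (increment_covE _ _ _ hgauss hcov); apply: eq_bigr => k _; apply: eq_bigr => m _.
  by rewrite hstat.
have s_diag : exists C : R, \forall n \near \oo, forall q, q \in nodes theta n ->
    `|s n q q| <= C * mesh theta n `^ (2 * nu - 2).
  have [C C0 HC] := cell_quad_model hOm hphi1 hsq l hnu tau0 hr hK.
  exists C; apply: filterS (near_mesh_size theta0 HC) => n H q qn.
  by rewrite /s (increment_var _ _ _ hgauss hcov); exact: (H _ (node_unit_square qn)).2.
have S_le := sum_sqr_cov hOm hphi1 hsq theta0 hnu Kt_smooth Kt_bound sE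
  (increment_cov_le phi theta l hgauss hcov) s_diag.
have EVlow' : \forall n \near \oo, c * n%:R `^ (4 - 2 * nu) <= EV n by rewrite EVquad.
have [C C0 rate] := variance_rate c0 S_le EVlow'.
have varE : \forall n \near \oo, varratio n = (2 * (EV n ^- 2 * S n))%:E /\
    0 <= 2 * (EV n ^- 2 * S n) <=
      (2 * C) * (n%:R ^- 2 * \sum_(0 <= k < n) k.+1%:R `^ (4 * nu - 7)).
  apply: filterS rate => n [EV0 h]; split.
    have := variance_ratio hgauss hcov (EVcov n) (lt0r_neq0 EV0).
    by rewrite /varratio /ratio /V => ->; congr EFin; rewrite mulrCA.
  rewrite -mulrA ler_pM2l// h andbT mulr_ge0// mulr_ge0 ?invr_ge0 ?exprn_ge0 ?(ltW EV0)//.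
  by apply: sumr_ge0 => q _; apply: sumr_ge0 => q' _; exact: sqr_ge0.
have [v1 v2 v3] := variance_regimes (mulr_gt0 (ltr0n _ 2) C0) varE.
split => //.
have [D D0 sq] := square_sum_rate hnu C0 rate.
have a0 : 0 < (2 - nu) / 2 by case/andP: hnu => _ ?; lra.
have EVE : EV = fun n => \sum_(q <- nodes theta n) increment_cov phi theta l X n q q.
  by apply/funext => n.
move: sq; rewrite EVE => sq.
have := ratio_ae_cvg hgauss hcov D0 a0 sq.
by apply: filterS => w; rewrite /ratio EVE.
Qed.
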